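(* Let $r\geqslant 2$ be a fixed integer. For every $\varepsilon>0$ and every large real $T\geqslant 2$, \[ \int_1^T\Delta_{r,3}(x)\,dx\ll T^{r+1/6+\varepsilon}. \]
   Context: $\tau_k(n)$ is the number of ordered $k$-tuples of positive integers with product $n$. For $k\geqslant 3$ let $\Delta_k(x)=\sum_{n\leqslant x}\tau_k(n)-xP_{k-1}(\log x)$, where $xP_{k-1}(\log x)$ is the residue of $\zeta^k(s)x^s/s$ at $s=1$, and $\alpha_k=\inf\{a:\Delta_k(x)=O(x^a)\}$ (so $0<\alpha_k<1$). For fixed integers $r\geqslant 2$, $k\geqslant 3$ there are unique constants $d_{r,k,\ell}$ ($0\leqslant\ell\leqslant r(k-1)$) such that, with $M_{r,k}(x)=x^r\sum_{\ell=0}^{r(k-1)}d_{r,k,\ell}(\log x)^\ell$, one has $\sum_{n_1,\dots,n_r\leqslant x}\tau_k(n_1\cdots n_r)=M_{r,k}(x)+O(x^{r-1+\alpha_k+\varepsilon})$ for every $\varepsilon>0$. Define $\Delta_{r,k}(x)=\sum_{n_1,\dots,n_r\leqslant x}\tau_k(n_1\cdots n_r)-M_{r,k}(x)$. The implied constant may depend on $r$ and $\varepsilon$. *)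

(* Defs.v *)
(* Real and complex analysis is done over the Stdlib reals with Coquelicot;
   MathComp's boot layer is used only for finite sets and sums of naturals. *)
From Stdlib Require Import Reals.
From Coquelicot Require Import Coquelicot.
From mathcomp Require Import all_boot.

Set Implicit Arguments.
Unset Strict Implicit.
Unset Printing Implicit Defensive.

Open Scope R_scope.

Definition nat_floor (x : R) : nat := Z.to_nat (Zfloor x).

(* The number of ordered k-tuples of positive integers with product n (n >= 1):
   the entries of such a tuple are at most n, hence range over 'I_n.+1. *)
Definition tau (k n : nat) : nat :=
  #|[set f : {ffun 'I_k -> 'I_n.+1} |
      [forall i, (0 < f i)%N] && ((\prod_(i < k) f i)%N == n)]|.

Definition tau_sum (k : nat) (x : R) : nat :=
  (\sum_(1 <= n < (nat_floor x).+1) tau k n)%N.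

(* The sum of tau_k(n_1 ... n_r) over positive integers n_1, ..., n_r <= x;
   f encodes n_i = (f i).+1. *)
Definition tau_multi_sum (r k : nat) (x : R) : nat :=
  (\sum_(f : {ffun 'I_r -> 'I_(nat_floor x)})
     tau k (\prod_(i < r) (f i).+1))%N.

Definition poly_eval (c : nat -> R) (deg : nat) (y : R) : R :=
  sum_f_R0 (fun l => c l * y ^ l) deg.

Definition Cexp (z : C) : C :=
  (exp (Re z) * cos (Im z), exp (Re z) * sin (Im z)).

(* x^s for real x > 0. *)
Definition rpowC (x : R) (s : C) : C := Cexp (s * RtoC (ln x))%C.

Definition is_riemann_zeta (zeta : C -> C) : Prop :=
  (forall s : C, s <> RtoC 1 ->
     @ex_derive C_AbsRing C_NormedModule zeta s) /\
  (forall s : C, 1 < Re s ->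
     @is_series C_AbsRing C_NormedModule
       (fun n => rpowC (INR n.+1) (- s)%C) (zeta s)).

(* rho is the coefficient of (s - a)^(-1) in a Laurent expansion
   f(s) = \sum_n c_n (s - a)^(n - m - 1), valid in a punctured disc around a. *)
Definition is_residue (f : C -> C) (a rho : C) : Prop :=
  exists (m : nat) (c : nat -> C) (delta : R),
    0 < delta /\
    (forall s : C, s <> a -> Cmod (s - a)%C < delta ->
       @is_pseries C_AbsRing C_NormedModule c (s - a)%C
         ((s - a) ^ m.+1 * f s)%C) /\
    rho = c m.

(* The coefficients p_0, ..., p_(k-1) define the polynomial P_(k-1). *)
Definition is_residue_poly (zeta : C -> C) (k : nat) (p : nat -> R) : Prop :=
  forall x : R, 0 < x ->
    is_residue (fun s => (zeta s ^ k * rpowC x s / s)%C) (RtoC 1)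
      (RtoC (x * poly_eval p k.-1 (ln x))).

Definition Delta (k : nat) (p : nat -> R) (x : R) : R :=
  INR (tau_sum k x) - x * poly_eval p k.-1 (ln x).

(* f(x) = O(x^a) as x tends to +oo. *)
Definition bigO_pow (f : R -> R) (a : R) : Prop :=
  exists K X : R, forall x : R, X <= x -> Rabs (f x) <= K * Rpower x a.

Definition alpha (k : nat) (p : nat -> R) : R :=
  real (Glb_Rbar (fun a => bigO_pow (Delta k p) a)).

Definition Mmain (r k : nat) (d : nat -> R) (x : R) : R :=
  x ^ r * poly_eval d (r * k.-1)%N (ln x).

Definition Delta_multi (r k : nat) (d : nat -> R) (x : R) : R :=
  INR (tau_multi_sum r k x) - Mmain r k d x.

(* This property determines d_0, ..., d_(r(k-1)) uniquely, as alpha_k < 1. *)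
Definition is_main_coefs (r k : nat) (p d : nat -> R) : Prop :=
  forall eps : R, 0 < eps ->
    bigO_pow (Delta_multi r k d) (INR r - 1 + alpha k p + eps).

(* Main.v *)
Require Import Defs.
From Stdlib Require Import Reals ZArith Lra Lia.
From Coquelicot Require Import Coquelicot.
From HB Require Import structures.
From mathcomp Require Import all_boot.
From mathcomp Require Import zify.

Set Implicit Arguments.
Unset Strict Implicit.
Unset Printing Implicit Defensive.

Open Scope R_scope.

(** Counting by the sizes of the three factors with respect to
    [n ~ T^(1/3)] reduces the Riesz mean [\sum_(m <= T) tau_3(m) (T - m)] to harmonic
    sums and to sums of [B_2({x / b})], which the Fourier series of [B_2] and the van der
    Corput inequality bound; its error term is [O(T^(7/6) log T)].  As [\sum_(m <= x) tau_3(m)]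
    is monotone, [Delta_3(x) << x^(7/12 + eps)], while the primitive of [Delta_3] is
    [O(T^(7/6 + eps))].

    For [r] variables, [tau_3(n_1 ... n_r)] is the convolution of [\prod tau_3(n_i)] with a
    function that vanishes at [(d_1, ..., d_r)] as soon as some prime divides exactly one
    [d_i]; this makes the sums over all [d] converge.  A product of main terms with a single
    remainder [Delta_3(x / d_i)] is integrated by parts, and one with two remainders
    gains [x^(-5/6)].

    The main term found in this way and the given one are [x^r] times polynomials in [log x]
    that are close on an arbitrarily long range of [x], hence, by finite differences, close on
    [[1, T]].  The residue polynomial is read off the expansion of [zeta(1 + u)] for real
    [u -> 0+]. *)

(** The exponent 7/6 comes from the cut at [n ~ T^(1/3)]: after a midpoint correction a harmonic sum
    has error [n^(-5/2)], and [T^2 (T^(1/3))^(-5/2) = T^(7/6)]; the sums of [B_2] reach the same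
    power. Expanding at [n + 1/2] instead of [n] makes the remaining terms vanish to third order at
    the cut, so that rounding the cube root costs only [O(T)].

    Sums over tuples run over finite boxes ['I_B]. Divisors of integers up to [B] stay in the box,
    so Dirichlet inversion is exact there and no infinite multiple series is formed. The price is a
    main term whose coefficients depend on [B], with [B] growing with [T]. Hence all bounds are
    uniform in [B], and the comparison with the fixed [d] uses values far beyond [T], not limits of
    coefficients.

    A remainder at [x / d_i] decays only like [d_i^(-7/12)], and like [d_i^(-1/6)] after
    integration, which costs a factor [d_i]. No single variable then gives convergence; the support
    of [gcoef] does, as soon as the decay exponents of any two variables add up to more than 1. The
    pairs used are 7/12 + 7/12 and 3/20 + 18/20. *)

Arguments INR : simpl never.

(** * Sums and products of reals over finite index sets *)

HB.instance Definition _ := Monoid.isComLaw.Build R 0 Rplus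
  (fun x y z => esym (Rplus_assoc x y z)) Rplus_comm Rplus_0_l.
HB.instance Definition _ := Monoid.isComLaw.Build R 1 Rmult
  (fun x y z => esym (Rmult_assoc x y z)) Rmult_comm Rmult_1_l.
HB.instance Definition _ := Monoid.isMulLaw.Build R 0 Rmult Rmult_0_l Rmult_0_r.
HB.instance Definition _ := Monoid.isAddLaw.Build R Rmult Rplus
  Rmult_plus_distr_r Rmult_plus_distr_l.

Notation "\rsum_ ( i <- r | P ) F" := (\big[Rplus/0]_(i <- r | P%B) F)
  (at level 36, F at level 36, i, r at level 50).
Notation "\rsum_ ( i <- r ) F" := (\big[Rplus/0]_(i <- r) F)
  (at level 36, F at level 36, i, r at level 50).
Notation "\rsum_ ( i < n ) F" := (\big[Rplus/0]_(i < n) F)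
  (at level 36, F at level 36, i, n at level 50).
Notation "\rsum_ ( i : t ) F" := (\big[Rplus/0]_(i : t) F)
  (at level 36, F at level 36, i at level 50).
Notation "\rprod_ ( i <- r | P ) F" := (\big[Rmult/1]_(i <- r | P%B) F)
  (at level 36, F at level 36, i, r at level 50).
Notation "\rprod_ ( i <- r ) F" := (\big[Rmult/1]_(i <- r) F)
  (at level 36, F at level 36, i, r at level 50).
Notation "\rprod_ ( i < n ) F" := (\big[Rmult/1]_(i < n) F)
  (at level 36, F at level 36, i, n at level 50).

Notation "\rprod_ ( i < n | P ) F" := (\big[Rmult/1]_(i < n | P%B) F)
  (at level 36, F at level 36, i, n at level 50).

Section BigReal.
Variables (I : Type) (s : seq I).

Lemma rsum_Rabs (P : pred I) (F : I -> R) :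
  Rabs (\rsum_(i <- s | P i) F i) <= \rsum_(i <- s | P i) Rabs (F i).
Proof.
apply: (big_ind2 (fun x y => Rabs x <= y)) => [|x y u v h1 h2|i _].
- by rewrite Rabs_R0; lra.
- by have := Rabs_triang x u; lra.
- by lra.
Qed.

Lemma rsum_le (P : pred I) (F G : I -> R) :
  (forall i, P i -> F i <= G i) -> \rsum_(i <- s | P i) F i <= \rsum_(i <- s | P i) G i.
Proof.
by move=> h; apply: (big_ind2 (fun x y => x <= y)) => [|x y u v|i /h] //; lra.
Qed.

Lemma rsum_ge0 (P : pred I) (F : I -> R) :
  (forall i, P i -> 0 <= F i) -> 0 <= \rsum_(i <- s | P i) F i.
Proof. by move=> h; apply: big_ind => [|x y|i /h] //; lra. Qed.

Lemma rprod_ge0 (P : pred I) (F : I -> R) :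
  (forall i, P i -> 0 <= F i) -> 0 <= \rprod_(i <- s | P i) F i.
Proof. by move=> h; apply: big_ind => [|x y|i /h] //; [lra | exact: Rmult_le_pos]. Qed.

Lemma rprod_gt0 (P : pred I) (F : I -> R) :
  (forall i, P i -> 0 < F i) -> 0 < \rprod_(i <- s | P i) F i.
Proof. by move=> h; apply: big_ind => [|x y|i /h] //; [lra | exact: Rmult_lt_0_compat]. Qed.

Lemma rprod_le (P : pred I) (F G : I -> R) :
  (forall i, P i -> 0 <= F i <= G i) ->
  0 <= \rprod_(i <- s | P i) F i <= \rprod_(i <- s | P i) G i.
Proof.
move=> h; apply: (big_ind2 (fun x y => 0 <= x <= y)) => [|x y u v [h1 h2] [h3 h4]|i /h //].
  by lra.
by split; [exact: Rmult_le_pos | exact: Rmult_le_compat].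
Qed.

Lemma rprod_Rabs (P : pred I) (F : I -> R) :
  Rabs (\rprod_(i <- s | P i) F i) = \rprod_(i <- s | P i) Rabs (F i).
Proof. by apply: (big_morph Rabs) => [x y|]; [exact: Rabs_mult | exact: Rabs_R1]. Qed.

Lemma rsumN (P : pred I) (F : I -> R) :
  \rsum_(i <- s | P i) (- F i) = - \rsum_(i <- s | P i) F i.
Proof.
by symmetry; apply: (big_morph Ropp) => [x y|]; [exact: Ropp_plus_distr | exact: Ropp_0].
Qed.

Lemma rsumB (P : pred I) (F G : I -> R) :
  \rsum_(i <- s | P i) (F i - G i) =
  \rsum_(i <- s | P i) F i - \rsum_(i <- s | P i) G i.
Proof. by rewrite big_split rsumN. Qed.

Lemma rsumZ (P : pred I) (c : R) (F : I -> R) :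
  \rsum_(i <- s | P i) (c * F i) = c * \rsum_(i <- s | P i) F i.
Proof. by rewrite big_distrr. Qed.

Lemma INR_sum (P : pred I) (F : I -> nat) :
  INR (\sum_(i <- s | P i) F i)%N = \rsum_(i <- s | P i) INR (F i).
Proof. by apply: (big_morph INR) => // m n; rewrite plus_INR. Qed.

Lemma INR_prod (P : pred I) (F : I -> nat) :
  INR (\prod_(i <- s | P i) F i)%N = \rprod_(i <- s | P i) INR (F i).
Proof. by apply: (big_morph INR) => // m n; rewrite mult_INR. Qed.

End BigReal.

Lemma rsum0 (F : 'I_0 -> R) : \rsum_(i < 0) F i = 0.
Proof. exact: big_ord0. Qed.

Lemma rsum_recr (n : nat) (F : nat -> R) :
  \rsum_(i < n.+1) F i = \rsum_(i < n) F i + F n.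
Proof. exact: big_ord_recr. Qed.

Lemma rsum_split (m n : nat) (F : nat -> R) :
  \rsum_(i < m + n) F i = \rsum_(i < m) F i + \rsum_(i < n) F (m + i)%N.
Proof. by rewrite big_split_ord. Qed.

Lemma rsum_const (n : nat) (c : R) : \rsum_(i < n) c = INR n * c.
Proof.
elim: n => [|n IH]; first by rewrite big_ord0 Rmult_0_l.
by rewrite big_ord_recr IH S_INR /=; lra.
Qed.

Lemma Rabs_rsum_le (I : Type) (s : seq I) (P : pred I) (F G : I -> R) :
  (forall i, P i -> Rabs (F i) <= G i) ->
  Rabs (\rsum_(i <- s | P i) F i) <= \rsum_(i <- s | P i) G i.
Proof. by move=> h; apply: Rle_trans (rsum_Rabs _ _ _) (rsum_le _ h). Qed.

(** * Naturals as reals, integer parts and real powers *)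

Lemma leq_INR (m n : nat) : (m <= n)%N -> INR m <= INR n.
Proof. by move=> /leP; exact: le_INR. Qed.

Lemma INR_leq (m n : nat) : INR m <= INR n -> (m <= n)%N.
Proof. by move=> /INR_le /leP. Qed.

Lemma INR_ltn (m n : nat) : INR m < INR n -> (m < n)%N.
Proof. by move=> /INR_lt /ltP. Qed.

Lemma INR_2 : INR 2 = 2. Proof. by rewrite S_INR INR_1; lra. Qed.
Lemma INR_3 : INR 3 = 3. Proof. by rewrite S_INR INR_2; lra. Qed.

Lemma INRS_gt0 (n : nat) : 0 < INR n.+1.
Proof. exact: (lt_0_INR n.+1 (Nat.lt_0_succ n)). Qed.

Lemma INRS_ge1 (n : nat) : 1 <= INR n.+1.
Proof. by rewrite S_INR; have := pos_INR n; lra. Qed.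

Lemma INR_gt0 (n : nat) : (0 < n)%N -> 0 < INR n.
Proof. by case: n => // n _; exact: INRS_gt0. Qed.

Lemma INR_ge1 (n : nat) : (0 < n)%N -> 1 <= INR n.
Proof. by case: n => // n _; exact: INRS_ge1. Qed.

Lemma nat_floor_le (x : R) : 0 <= x -> INR (nat_floor x) <= x.
Proof.
move=> hx; rewrite /nat_floor INR_IZR_INZ Z2Nat.id; first by have := Zfloor_bound x; lra.
by apply: Zfloor_lub; exact: hx.
Qed.

Lemma nat_floor_gt (x : R) : x < INR (nat_floor x) + 1.
Proof.
have [_ h] := Zfloor_bound x; apply: Rlt_le_trans h _.
apply: Rplus_le_compat_r; rewrite /nat_floor INR_IZR_INZ; apply: IZR_le; lia.
Qed.

Lemma leq_nat_floor (n : nat) (x : R) : 0 <= x -> (n <= nat_floor x)%N <-> INR n <= x.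
Proof.
move=> hx; split=> h.
  by apply: Rle_trans (nat_floor_le hx); exact: leq_INR.
by rewrite -ltnS; apply: INR_ltn; rewrite S_INR; have := nat_floor_gt x; lra.
Qed.

Lemma nat_floor_unique (n : nat) (x : R) : INR n <= x < INR n + 1 -> nat_floor x = n.
Proof.
move=> [h1 h2]; have hx : 0 <= x by have := pos_INR n; lra.
apply/eqP; rewrite eqn_leq; apply/andP; split.
  by rewrite -ltnS; apply: INR_ltn; rewrite S_INR; have := nat_floor_le hx; lra.
by apply/leq_nat_floor.
Qed.

Lemma Rpower_gt0 (x y : R) : 0 < Rpower x y.
Proof. exact: exp_pos. Qed.

Lemma Rpower_ge0 (x y : R) : 0 <= Rpower x y.
Proof. exact: Rlt_le (exp_pos _). Qed.

Lemma Rpower_base1 (y : R) : Rpower 1 y = 1.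
Proof. by rewrite /Rpower ln_1 Rmult_0_r exp_0. Qed.

Lemma Rpower_mulE (x y a : R) : 0 < x -> 0 < y ->
  Rpower (x * y) a = Rpower x a * Rpower y a.
Proof. by move=> hx hy; rewrite Rpower_mult_distr. Qed.

Lemma Rpower_le_exp (x a b : R) : 1 <= x -> a <= b -> Rpower x a <= Rpower x b.
Proof.
move=> hx hab; have [->|h] := Req_dec x 1; first by rewrite !Rpower_base1; lra.
by apply: Rle_Rpower; lra.
Qed.

Lemma Rpower_ge1 (x a : R) : 1 <= x -> 0 <= a -> 1 <= Rpower x a.
Proof. by move=> hx ha; rewrite -(Rpower_O x); [exact: Rpower_le_exp | lra]. Qed.

Lemma Rpower_le_base (x y a : R) : 0 < x <= y -> 0 <= a -> Rpower x a <= Rpower y a.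
Proof. by move=> h ha; apply: Rle_Rpower_l. Qed.

Lemma Rpower_inv (x a : R) : 0 < x -> Rpower (/ x) a = Rpower x (- a).
Proof. by move=> hx; rewrite /Rpower ln_Rinv //; congr exp; ring. Qed.

Lemma Rpower_div (x y a : R) : 0 < x -> 0 < y ->
  Rpower (x / y) a = Rpower x a * Rpower y (- a).
Proof.
by move=> hx hy; rewrite Rpower_mulE ?Rpower_inv //; apply: Rinv_0_lt_compat.
Qed.

Lemma Rpower_natr (x : R) (n : nat) : 0 < x -> Rpower x (INR n) = x ^ n.
Proof. exact: Rpower_pow. Qed.

Lemma ln_le_sub1 (x : R) : 0 < x -> ln x <= x - 1.
Proof. by move=> hx; have := exp_ineq1_le (ln x); rewrite exp_ln //; lra. Qed.

Lemma ln_ge0 (x : R) : 1 <= x -> 0 <= ln x.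
Proof. by move=> h; rewrite -ln_1; apply: ln_le; lra. Qed.

Lemma ln_le_Rpower (x a : R) : 0 < x -> 0 < a -> ln x <= Rpower x a / a.
Proof.
move=> hx ha; have := exp_ineq1_le (a * ln x); rewrite -/(Rpower x a) => h.
by apply: (Rmult_le_reg_l a) => //; field_simplify; lra.
Qed.

Lemma sum_Rpower_le (delta : R) (N : nat) : 0 < delta ->
  \rsum_(n < N) Rpower (INR n.+1) (- 1 - delta) <= 1 + / delta.
Proof.
move=> hd; case: N => [|N].
  by rewrite big_ord0; have := Rinv_0_lt_compat _ hd; lra.
(* The induction needs the stronger bound with the tail of the comparison integral subtracted; its
   step is a Bernoulli inequality for [((y - 1) / y)^(-delta)]. *)
suff: \rsum_(n < N.+1) Rpower (INR n.+1) (- 1 - delta) <=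
      1 + / delta - Rpower (INR N.+1) (- delta) / delta.
  have := Rmult_lt_0_compat _ _ (Rpower_gt0 (INR N.+1) (- delta)) (Rinv_0_lt_compat _ hd).
  by rewrite -/(Rdiv _ _); lra.
elim: N => [|N IH].
  by rewrite big_ord1 /= INR_1 !Rpower_base1; lra.
rewrite (rsum_recr _ (fun n => Rpower (INR n.+1) (- 1 - delta))).
have hN : 0 < INR N.+1 := INRS_gt0 N.
have hN2 : 0 < INR N.+2 := INRS_gt0 _.
set y := INR N.+2 in hN2 *.
have e : INR N.+1 = y - 1 by rewrite /y [INR N.+2]S_INR; lra.
rewrite e in IH hN.
have h1 : Rpower y (- delta) * (1 + delta / y) <= Rpower (y - 1) (- delta).
  have -> : Rpower (y - 1) (- delta) = Rpower y (- delta) * Rpower ((y - 1) / y) (- delta).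
    rewrite -Rpower_mulE //; first by congr Rpower; field; lra.
    exact: Rdiv_lt_0_compat.
  apply: Rmult_le_compat_l; first exact: Rpower_ge0.
  have := exp_ineq1_le (- delta * ln ((y - 1) / y)).
  rewrite -/(Rpower _ _) => h.
  have h2 := ln_le_sub1 (Rdiv_lt_0_compat _ _ hN hN2).
  have h3 : (y - 1) / y - 1 = - / y by field; lra.
  apply: Rle_trans h; rewrite h3 in h2.
  have := Rmult_le_compat_l delta _ _ (Rlt_le _ _ hd) h2; lra.
have h2 : Rpower y (- 1 - delta) = Rpower y (- delta) / y.
  have -> : - 1 - delta = - delta + (- (1)) by ring.
  by rewrite Rpower_plus [Rpower y (- (1))]Rpower_Ropp Rpower_1.
rewrite h2.
have h3 : Rpower (y - 1) (- delta) / delta >= Rpower y (- delta) / delta + Rpower y (- delta) / y.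
  have -> : Rpower y (- delta) / delta + Rpower y (- delta) / y =
            Rpower y (- delta) * (1 + delta / y) / delta by field; lra.
  apply: Rle_ge; apply: Rmult_le_compat_r h1.
  exact: Rlt_le (Rinv_0_lt_compat _ hd).
lra.
Qed.

Lemma Rabs_sub_le (x y : R) : Rabs (x - y) <= Rabs x + Rabs y.
Proof. by rewrite -(Rabs_Ropp y); exact: Rabs_triang. Qed.

Lemma Rle_divI (a b c : R) : 0 < c -> a * c <= b -> a <= b / c.
Proof. by move=> hc h; apply: (proj1 (Rle_div_r _ _ _ _)). Qed.

Lemma Rdiv_leI (a b c : R) : 0 < c -> a <= b * c -> a / c <= b.
Proof. by move=> hc h; apply: (proj2 (Rle_div_l _ _ _ _)). Qed.

(** * Exponential sums *)

(** Passing from [n] to [n + 1] changes the deviation by [(w (n+1) - w n) s (n+1)], whose size is at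
    most the growth of the weight. Keeping the boundary term on the left is what lets these changes
    telescope. *)
Lemma abel_nondecreasing (w s : nat -> R) (n : nat) :
  (forall j, (j <= n)%N -> 0 <= w j) ->
  (forall j, (j < n)%N -> w j <= w j.+1) ->
  (forall j, Rabs (s j) <= 1) ->
  Rabs (\rsum_(j < n.+1) (w j * (s j.+1 - s j)) - w n * s n.+1) <= w n.
Proof.
elim: n => [|n IH] h0 hw hs.
  rewrite (rsum_recr _ (fun j => w j * (s j.+1 - s j))) rsum0.
  have -> : 0 + w 0%N * (s 1%N - s 0%N) - w 0%N * s 1%N = - (w 0%N * s 0%N) by ring.
  rewrite Rabs_Ropp Rabs_mult Rabs_pos_eq; last exact: h0.
  by have := Rmult_le_compat_l _ _ _ (h0 0%N isT) (hs 0%N); lra.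
have {}IH := IH (fun j hj => h0 j (leqW hj)) (fun j hj => hw j (leqW hj)) hs.
rewrite (rsum_recr _ (fun j => w j * (s j.+1 - s j))).
set A := (\rsum_(j < n.+1) _) in IH *.
have -> : A + w n.+1 * (s n.+2 - s n.+1) - w n.+1 * s n.+2 =
          (A - w n * s n.+1) - (w n.+1 - w n) * s n.+1 by ring.
have h1 : Rabs ((w n.+1 - w n) * s n.+1) <= w n.+1 - w n.
  rewrite Rabs_mult Rabs_pos_eq; last by have := hw n (ltnSn n); lra.
  have := hs n.+1; have := hw n (ltnSn n) => h2 h3.
  have h4 : 0 <= w n.+1 - w n by lra.
  by have := Rmult_le_compat_l _ _ _ h4 h3; lra.
by have := Rabs_sub_le (A - w n * s n.+1) ((w n.+1 - w n) * s n.+1); lra.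
Qed.

Lemma mul_cos_le_sin (x : R) : 0 <= x <= PI -> x * cos x <= sin x.
Proof.
move=> [h0 h1]; have [->|hx] := Req_dec x 0; first by rewrite sin_0; lra.
have hx0 : 0 < x by lra.
have [c [e hc]] := MVT_cor2 sin cos 0 x hx0 (fun c _ => derivable_pt_lim_sin c).
have : cos x <= cos c by apply: cos_decr_1; lra.
by move=> h; move: e; rewrite sin_0 => e;
  have := Rmult_le_compat_l x _ _ (Rlt_le _ _ hx0) h; lra.
Qed.

Definition cot (x : R) : R := cos x / sin x.

Lemma cot_bounds (x y : R) : 0 < x -> x <= y -> y <= PI / 2 ->
  [/\ 0 <= cot y, cot y <= cot x & cot x <= / x].
Proof.
move=> h0 h1 h2; have hpi := PI_RGT_0.
have sx : 0 < sin x by apply: sin_gt_0; lra.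
have sy : 0 < sin y by apply: sin_gt_0; lra.
have cy : 0 <= cos y by apply: cos_ge_0; lra.
have cxy : cos y <= cos x by apply: cos_decr_1; lra.
have sxy : sin x <= sin y by apply: sin_incr_1; lra.
rewrite /cot; split.
- exact: Rdiv_le_0_compat.
- apply: Rmult_le_compat => //; first exact: Rlt_le (Rinv_0_lt_compat _ sy).
  exact: Rinv_le_contravar.
- apply/Rle_div_l => //; have := @mul_cos_le_sin x; move=> h.
  apply: (Rmult_le_reg_l x) => //; rewrite -Rmult_assoc Rinv_r; last lra.
  by rewrite Rmult_1_l; apply: h; lra.
Qed.

(* [cos a] is written through increments of [cos] and [sin] over [a, b] with the
   weight [cot ((b - a) / 2)], so that monotone increments allow partial summation. *)
Lemma cos_increment (a b : R) : sin ((b - a) / 2) <> 0 ->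
  cos a = - (1 / 2) * (cos b - cos a) + 1 / 2 * (cot ((b - a) / 2) * (sin b - sin a)).
Proof.
move=> hs; rewrite /cot; set d := (b - a) / 2 in hs *; set m := (a + b) / 2.
have -> : a = m - d by rewrite /m /d; field.
have -> : b = m + d by rewrite /m /d; field.
by rewrite cos_plus cos_minus sin_plus sin_minus; field.
Qed.

(** By [cos_increment] the sum is a telescoping part, at most 1, plus increments of [sin] weighted
    by the cotangent of the half-increments of [f]. These lie in [(0, PI/2]] and decrease, so the
    weights are nonnegative, nondecreasing and at most [2 / t]. *)
Lemma kusmin_landau (f : nat -> R) (n : nat) (t : R) : 0 < t ->
  (forall j, (j < n)%N -> t <= f j.+1 - f j <= PI) ->
  (forall j, (j.+1 < n)%N -> f j.+2 - f j.+1 <= f j.+1 - f j) ->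
  Rabs (\rsum_(j < n) cos (f j)) <= 1 + 2 / t.
Proof.
move=> ht h1 h2; have h2t : 0 < 2 / t by apply: Rdiv_lt_0_compat; lra.
case: n h1 h2 => [|n] h1 h2; first by rewrite rsum0 Rabs_R0; lra.
pose w j := cot ((f j.+1 - f j) / 2).
have hj j : (j < n.+1)%N -> [/\ 0 <= w j, w j <= w j & w j <= / ((f j.+1 - f j) / 2)].
  by move=> /h1 h; apply: cot_bounds; lra.
have hsin j : (j < n.+1)%N -> sin ((f j.+1 - f j) / 2) <> 0.
  by move=> /h1 h; have hpi := PI_RGT_0; apply/Rgt_not_eq/sin_gt_0; lra.
have -> : \rsum_(j < n.+1) cos (f j) = - (1 / 2) * (cos (f n.+1) - cos (f 0%N)) +
   1 / 2 * \rsum_(j < n.+1) (w j * (sin (f j.+1) - sin (f j))).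
  suff h k : (k <= n.+1)%N -> \rsum_(j < k) cos (f j) =
      - (1 / 2) * (cos (f k) - cos (f 0%N)) +
      1 / 2 * \rsum_(j < k) (w j * (sin (f j.+1) - sin (f j))) by exact: h.
  elim: k => [|k IH] hk; first by rewrite !rsum0; ring.
  rewrite (rsum_recr _ (fun j => cos (f j))).
  rewrite (rsum_recr _ (fun j => w j * (sin (f j.+1) - sin (f j)))) IH; last exact: ltnW.
  by have := @cos_increment (f k) (f k.+1) (hsin k hk); rewrite -/(w k) => {2}->; ring.
have := @abel_nondecreasing w (fun j => sin (f j)) n.
set A := (\rsum_(j < n.+1) _) => hA.
have {}hA : Rabs (A - w n * sin (f n.+1)) <= w n.
  apply: hA => [j hjn|j hjn|j]; first by have [] := hj j hjn.
    have [] := @cot_bounds ((f j.+2 - f j.+1) / 2) ((f j.+1 - f j) / 2) => //.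
    - by have := h1 j.+1 hjn; lra.
    - by have := h2 j hjn; lra.
    - by have := h1 j (leqW hjn); lra.
  by apply: Rabs_le; have := SIN_bound (f j); lra.
have [w0 _ w1] := hj n (ltnSn n).
have hw : w n <= 2 / t.
  apply: Rle_trans w1 _; have := h1 n (ltnSn n) => h.
  rewrite Rinv_div; apply: Rmult_le_compat_l; first lra.
  by apply: Rinv_le_contravar; lra.
have hs := SIN_bound (f n.+1); have hc1 := COS_bound (f n.+1); have hc2 := COS_bound (f 0%N).
have h3 : Rabs (w n * sin (f n.+1)) <= w n.
  rewrite Rabs_mult Rabs_pos_eq //; have : Rabs (sin (f n.+1)) <= 1 by apply: Rabs_le; lra.
  by move=> h; have := Rmult_le_compat_l _ _ _ w0 h; lra.
move: hA h3 => /Rabs_le_between hA /Rabs_le_between h3.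
by apply: Rabs_le; lra.
Qed.

Lemma sqr_rsum_le (n : nat) (F : nat -> R) :
  (\rsum_(m < n) F m) ^ 2 <= INR n * \rsum_(m < n) (F m ^ 2).
Proof.
elim: n => [|n IH]; first by rewrite !rsum0 /=; lra.
rewrite (rsum_recr _ F) (rsum_recr _ (fun m => F m ^ 2)) S_INR.
set S := (\rsum_(m < n) F m) in IH *; set Q := (\rsum_(m < n) _) in IH *.
have hn := pos_INR n; have [e|hn0] := Req_dec (INR n) 0.
  rewrite e Rmult_0_l in IH *; have -> : S = 0 by nra.
  suff : 0 <= Q by nra.
  by apply: rsum_ge0 => i _; exact: pow2_ge_0.
suff : 2 * S * F n <= Q + INR n * F n ^ 2 by nra.
apply: (Rmult_le_reg_l (INR n)); first lra.
have := pow2_ge_0 (S - INR n * F n); nra.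
Qed.

Definition ind (b : bool) : R := if b then 1 else 0.

Lemma ind_and (a b : bool) : ind (a && b) = ind a * ind b.
Proof. by case: a; case: b; rewrite /ind /=; ring. Qed.

Lemma rsum_ind_interval (n a c : nat) : (c <= n)%N ->
  \rsum_(m < n) ind (a <= m < c)%N = INR (c - a).
Proof.
move=> hc; have -> : \rsum_(m < n) ind (a <= m < c)%N = INR (minn c n - a).
  elim: n {hc} => [|n IH]; first by rewrite rsum0 minn0.
  rewrite (rsum_recr _ (fun m => ind (a <= m < c)%N)) IH.
  case: (leqP a n) => ha; last first.
    rewrite /= /ind Rplus_0_r; congr INR; lia.
  case: (ltnP n c) => hc; rewrite /ind /=.
    by rewrite -S_INR; congr INR; lia.
  by rewrite Rplus_0_r; congr INR; lia.
by congr INR; lia.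
Qed.

Lemma rsum_diagonals (B : nat) (G : nat -> nat -> R) : (forall a b, G a b = G b a) ->
  \rsum_(a < B) \rsum_(b < B) G a b =
  \rsum_(a < B) G a a + 2 * \rsum_(k < B) \rsum_(b < B - k.+1) G (b + k.+1)%N b.
Proof.
move=> hG; elim: B => [|B IH]; first by rewrite !rsum0; ring.
rewrite (rsum_recr _ (fun a => \rsum_(b < B.+1) G a b)) (rsum_recr _ (fun a => G a a)).
rewrite (rsum_recr _ (fun k => \rsum_(b < B.+1 - k.+1) G (b + k.+1)%N b)) subnn rsum0.
rewrite (eq_bigr (fun a : 'I_B => \rsum_(b < B) G a b + G B a)); last first.
  by move=> a _; rewrite (rsum_recr _ (G a)) (hG a B).
rewrite big_split IH (rsum_recr _ (G B)).
rewrite [X in _ = _ + 2 * (X + 0)](eq_bigr (fun k : 'I_B =>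
   \rsum_(b < B - k.+1) G (b + k.+1)%N b + G B (B - k.+1)%N)); last first.
  move=> k _; have -> : (B.+1 - k.+1)%N = (B - k.+1).+1 by have := ltn_ord k; lia.
  rewrite (rsum_recr _ (fun b => G (b + k.+1)%N b)); congr (_ + G _ _).
  by have := ltn_ord k; lia.
rewrite big_split.
have -> : \rsum_(k < B) G B (B - k.+1)%N = \rsum_(k < B) G B k.
  by rewrite [RHS](reindex_inj rev_ord_inj).
set X1 := (\rsum_(a < B) \rsum_(b < _) _); set X2 := (\rsum_(a < B) G a a).
set X3 := (\rsum_(k < B) _); rewrite /=; ring.
Qed.

(** Each [b] lies in exactly [K] of the [B + K] windows of length [K]. Cauchy-Schwarz over the
    windows turns the square of the sum into correlations, in which a pair at distance [k + 1] is
    weighted by the [K - (k + 1)] windows containing both. *)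
Lemma van_der_corput (f : nat -> R) (B K : nat) (U : R) :
  (0 < K)%N -> (K <= B)%N ->
  (forall k, (k < K)%N ->
     Rabs (\rsum_(b < B - k.+1) cos (f (b + k.+1)%N - f b)) <= U / INR k.+1) ->
  INR K * (\rsum_(b < B) cos (f b)) ^ 2 <=
  (INR B + INR K) * (INR B + 2 * U * \rsum_(k < K) / INR k.+1).
Proof.
move=> K0 KB hU.
pose J m b := ind (b <= m < b + K)%N.
have hJ b : (b < B)%N -> \rsum_(m < B + K) J m b = INR K.
  by move=> hb; rewrite (@rsum_ind_interval _ b (b + K)) ?addKn //; lia.
have hJJ a b : (a < B)%N -> (b < B)%N -> (b <= a)%N ->
    \rsum_(m < B + K) (J m a * J m b) = INR (K - (a - b)).
  move=> ha hb hab; rewrite (eq_bigr (fun m : 'I_(B + K) => ind (a <= m < b + K)%N)).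
    by rewrite rsum_ind_interval; [congr INR; lia | lia].
  by move=> m _; rewrite -ind_and; congr ind; lia.
pose N a b := \rsum_(m < B + K) (J m a * J m b).
have hsq g : (INR K * \rsum_(b < B) g b) ^ 2 <=
    (INR B + INR K) * \rsum_(a < B) \rsum_(b < B) (N a b * (g a * g b)).
  have -> : INR K * (\rsum_(b < B) g b) = \rsum_(m < B + K) \rsum_(b < B) (J m b * g b).
    rewrite exchange_big big_distrr; apply: eq_bigr => b _.
    by rewrite -(hJ b (ltn_ord b)) big_distrl.
  apply: Rle_trans (sqr_rsum_le _ (fun m => \rsum_(b < B) (J m b * g b))) _.
  rewrite plus_INR; apply: Req_le; congr (_ * _).
  rewrite [RHS](eq_bigr (fun a : 'I_B => \rsum_(m < B + K) \rsum_(b < B)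
      (J m a * J m b * (g a * g b)))); last first.
    by move=> a _; rewrite exchange_big; apply: eq_bigr => b _; rewrite big_distrl.
  rewrite exchange_big; apply: eq_bigr => m _ /=.
  rewrite Rmult_1_r big_distrl; apply: eq_bigr => a _ /=.
  rewrite big_distrr; apply: eq_bigr => b _ /=; ring.
have hc := hsq (fun b => cos (f b)); have hs := hsq (fun b => sin (f b)).
(* Adding the nonnegative square of the sine sum replaces [cos (f a) cos (f b)] by
   [cos (f a - f b)]; this stands in for complex exponentials. *)
have hcs : INR K ^ 2 * (\rsum_(b < B) cos (f b)) ^ 2 <= (INR B + INR K) *
    \rsum_(a < B) \rsum_(b < B) (N a b * cos (f a - f b)).
  have -> : \rsum_(a < B) \rsum_(b < B) (N a b * cos (f a - f b)) =
     \rsum_(a < B) \rsum_(b < B) (N a b * (cos (f a) * cos (f b))) +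
     \rsum_(a < B) \rsum_(b < B) (N a b * (sin (f a) * sin (f b))).
    rewrite -big_split; apply: eq_bigr => a _; rewrite -big_split; apply: eq_bigr => b _.
    by rewrite cos_minus /=; ring.
  rewrite Rpow_mult_distr in hc; have := pow2_ge_0 (INR K * \rsum_(b < B) sin (f b)).
  lra.
have hK : 0 < INR K by exact: INR_gt0.
apply: (Rmult_le_reg_l (INR K)) => //.
rewrite -Rmult_assoc; have -> : INR K * INR K = INR K ^ 2 by ring.
apply: Rle_trans hcs _.
rewrite (Rmult_comm (INR K)) Rmult_assoc; apply: Rmult_le_compat_l.
  by have := pos_INR B; lra.
rewrite (rsum_diagonals B (G := fun a b => N a b * cos (f a - f b))); last first.
  move=> a b; congr (_ * _); last by rewrite -cos_neg; congr cos; ring.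
  by apply: eq_bigr => m _; ring.
rewrite Rmult_plus_distr_r; apply: Rplus_le_compat.
  apply: Req_le; rewrite (eq_bigr (fun a : 'I_B => INR K)); first by rewrite rsum_const.
  move=> a _; rewrite Rminus_diag cos_0 Rmult_1_r /N hJJ ?ltn_ord //.
  by congr INR; lia.
rewrite !Rmult_assoc; apply: Rmult_le_compat_l; first lra.
rewrite -(subnKC KB) big_split_ord /= [X in _ + X]big1 ?Rplus_0_r; last first.
  move=> k _; apply: big1 => b _; rewrite /N hJJ; try by have := ltn_ord b; lia.
  have -> : (K - (b + (K + k).+1 - b))%N = 0%N by lia.
  by rewrite Rmult_0_l.
rewrite (Rmult_comm _ (INR K)) -Rmult_assoc.
rewrite big_distrr; apply: rsum_le => k _ /=.
have hk := hU k (ltn_ord k).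
rewrite (subnKC KB) (eq_bigr (fun b : 'I_(B - k.+1) =>
   INR (K - k.+1) * cos (f (b + k.+1)%N - f b))); last first.
  move=> b _; congr (_ * _); rewrite /N hJJ; try by have := ltn_ord b; lia.
  congr INR; lia.
rewrite -big_distrr /=.
apply: Rle_trans (Rle_abs _) _; rewrite Rabs_mult Rabs_pos_eq; last exact: pos_INR.
rewrite -/(Rdiv _ _).
have -> : U * INR K / INR k.+1 = INR K * (U / INR k.+1) by rewrite /Rdiv; ring.
apply: Rmult_le_compat => //; [exact: pos_INR | exact: Rabs_pos | apply: leq_INR; lia].
Qed.

Lemma harmonic_le (K : nat) : (0 < K)%N -> \rsum_(k < K) / INR k.+1 <= 1 + ln (INR K).
Proof.
case: K => // K _; elim: K => [|K IH].
  by rewrite (rsum_recr _ (fun k => / INR k.+1)) rsum0 INR_1 ln_1 Rinv_1; lra.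
rewrite (rsum_recr _ (fun k => / INR k.+1)).
have h1 := INRS_gt0 K; have h2 := INRS_gt0 K.+1.
have := ln_le_sub1 (Rdiv_lt_0_compat _ _ h1 h2).
rewrite ln_div //; have -> : INR K.+1 / INR K.+2 - 1 = - / INR K.+2.
  by rewrite [INR K.+2]S_INR; field; lra.
lra.
Qed.

Lemma PI_gt3 : 3 < PI.
Proof. by have := PI2_3_2; lra. Qed.

(** The differenced phase has positive decreasing increments of size about [y (k+1) / P^3], so
    [kusmin_landau] applies. The condition [4 y (k+1) <= P^3] is what keeps them below [PI]; the
    lower bound uses that all denominators are at most [3 P]. *)
Lemma cos_reciprocal_sum_diff (y : R) (P B k : nat) :
  (0 < P)%N -> (B <= P)%N -> (k < B)%N -> 0 < y -> 4 * y * INR k.+1 <= INR P ^ 3 ->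
  Rabs (\rsum_(b < B - k.+1)
     cos (2 * PI * y / INR (P + (b + k.+1)).+1 - 2 * PI * y / INR (P + b).+1)) <=
  6 * (INR P ^ 3 / y) / INR k.+1.
Proof.
move=> P0 BP kB y0 hy.
set q := INR k.+1 in hy *; have q1 : 1 <= q by exact: INRS_ge1.
pose beta (b : nat) := INR (P + b).+1.
have hpi := PI_gt3.
have betaS b : beta b.+1 = beta b + 1 by rewrite /beta addnS S_INR.
have betaD b : INR (P + (b + k.+1)).+1 = beta b + q.
  by rewrite /beta /q addnA -addSn plus_INR.
have p1 : 1 <= INR P by exact: INR_ge1.
have betaP b : INR P + 1 <= beta b.
  by rewrite /beta S_INR plus_INR; have := pos_INR b; lra.
pose f b := 2 * PI * y / (beta b + q) - 2 * PI * y / beta b.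
have fS b : f b.+1 - f b = 2 * PI * y * q *
    (/ (beta b * (beta b + 1) * (beta b + q)) +
     / ((beta b + 1) * (beta b + q) * (beta b + q + 1))).
  by rewrite /f betaS; have := betaP b => h; field; lra.
have c0 : 0 < 2 * PI * y * q by apply: Rmult_lt_0_compat; [apply: Rmult_lt_0_compat|]; lra.
have p3 : 0 < INR P ^ 3 by apply: pow_lt; lra.
set t := 2 * PI * y * q * (2 / (27 * INR P ^ 3)).
have t0 : 0 < t by apply: Rmult_lt_0_compat => //; apply: Rdiv_lt_0_compat; lra.
have key : Rabs (\rsum_(b < B - k.+1) cos (f b)) <= 1 + 2 / t.
  apply: kusmin_landau => // b hb.
    rewrite fS; have hb1 := betaP b.
    have hb2 : beta b + q + 1 <= 3 * INR P.
      rewrite /beta /q -plus_INR -S_INR.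
      have -> : 3 * INR P = INR (3 * P) by rewrite mult_INR /=; congr (_ * _); rewrite /INR; lra.
      by apply: leq_INR; lia.
    split.
      apply: Rmult_le_compat_l; first lra.
      have h27 a b' c : 0 < a <= 3 * INR P -> 0 < b' <= 3 * INR P -> 0 < c <= 3 * INR P ->
          / (27 * INR P ^ 3) <= / (a * b' * c).
        move=> ha hb' hc; apply: Rinv_le_contravar.
          by apply: Rmult_lt_0_compat; [apply: Rmult_lt_0_compat|]; lra.
        have -> : 27 * INR P ^ 3 = 3 * INR P * (3 * INR P) * (3 * INR P) by ring.
        apply: Rmult_le_compat; try lra; first by apply: Rmult_le_pos; lra.
        by apply: Rmult_le_compat; lra.
      have h1 := h27 (beta b) (beta b + 1) (beta b + q).
      have h2 := h27 (beta b + 1) (beta b + q) (beta b + q + 1).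
      by rewrite /Rdiv; have {}h1 := h1 ltac:(lra) ltac:(lra) ltac:(lra);
        have {}h2 := h2 ltac:(lra) ltac:(lra) ltac:(lra); lra.
    have h1 a b' c : INR P <= a -> INR P <= b' -> INR P <= c ->
        / (a * b' * c) <= / (INR P ^ 3).
      move=> ha hb' hc; apply: Rinv_le_contravar => //.
      have -> : INR P ^ 3 = INR P * INR P * INR P by ring.
      apply: Rmult_le_compat; try lra; first by apply: Rmult_le_pos; lra.
      by apply: Rmult_le_compat; lra.
    have g1 := h1 (beta b) (beta b + 1) (beta b + q) ltac:(lra) ltac:(lra) ltac:(lra).
    have g2 := h1 (beta b + 1) (beta b + q) (beta b + q + 1) ltac:(lra) ltac:(lra) ltac:(lra).
    apply: Rle_trans (Rmult_le_compat_l _ _ (2 * / INR P ^ 3) (Rlt_le _ _ c0) _) _; first lra.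
    apply: (Rmult_le_reg_r (INR P ^ 3)) => //.
    have -> : 2 * PI * y * q * (2 * / INR P ^ 3) * INR P ^ 3 = PI * (4 * y * q) by field; lra.
    by apply: Rmult_le_compat_l; lra.
  rewrite !fS; apply: Rmult_le_compat_l; first lra.
  have h1 a b' c a' b'' c' : 0 < a <= a' -> 0 < b' <= b'' -> 0 < c <= c' ->
      / (a' * b'' * c') <= / (a * b' * c).
    move=> ha hb' hc; apply: Rinv_le_contravar.
      by apply: Rmult_lt_0_compat; [apply: Rmult_lt_0_compat|]; lra.
    apply: Rmult_le_compat; try lra; first by apply: Rmult_le_pos; lra.
    by apply: Rmult_le_compat; lra.
  have hb1 := betaP b; rewrite betaS; apply: Rplus_le_compat; apply: h1; lra.
rewrite (eq_bigr (fun b : 'I_(B - k.+1) => cos (f b))); last first.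
  by move=> b _; rewrite /f betaD.
apply: Rle_trans key _.
(* The factor [27 / (2 PI)] is below 5 and the summand 1 is at most a quarter of [P^3 / (y q)],
   whence the constant 6. *)
have -> : 2 / t = 27 / (2 * PI) * (INR P ^ 3 / y / q) by rewrite /t; field; lra.
have h1 : 1 <= / 4 * (INR P ^ 3 / y / q).
  apply: (Rmult_le_reg_r (4 * y * q)); first by apply: Rmult_lt_0_compat; lra.
  have -> : / 4 * (INR P ^ 3 / y / q) * (4 * y * q) = INR P ^ 3 by field; lra.
  lra.
have h2 : 27 / (2 * PI) <= 5 by apply: Rdiv_leI; lra.
have h3 : 0 <= INR P ^ 3 / y / q by lra.
have := Rmult_le_compat_r _ _ _ h3 h2.
have -> : 6 * (INR P ^ 3 / y) / q = 6 * (INR P ^ 3 / y / q) by rewrite /Rdiv; ring.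
lra.
Qed.

(** The van der Corput inequality with about [V / 4] shifts, [V = P^3 / y]. Both terms of the
    outcome, [P^2 / V] and [P] up to a logarithm, are at most about [y / P], because [P^2 <= y]. *)
Lemma cos_reciprocal_sum (y : R) (P B : nat) :
  (0 < P)%N -> (B <= P)%N -> INR P ^ 2 <= y ->
  Rabs (\rsum_(b < B) cos (2 * PI * y / INR (P + b).+1)) <=
  15 * (sqrt (y / INR P) * (1 + ln (INR P))).
Proof.
move=> P0 BP hy.
set C := (\rsum_(b < B) _).
have p1 : 1 <= INR P by exact: INR_ge1.
have lnp : 0 <= ln (INR P) by exact: ln_ge0.
have y1 : 1 <= y by apply: Rle_trans hy; nra.
have hyp0 : 0 < y / INR P by apply: Rdiv_lt_0_compat; lra.
have hpy : INR P <= y / INR P by apply: Rle_divI; nra.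
set L := 1 + ln (INR P); have L1 : 1 <= L by rewrite /L; lra.
suff hC : C ^ 2 <= 208 * (y / INR P) * L.
  apply: Rsqr_incr_0_var; last by have := sqrt_pos (y / INR P); nra.
  rewrite -Rsqr_abs !Rsqr_mult Rsqr_sqrt; last lra.
  have -> : Rsqr C = C ^ 2 by rewrite /Rsqr; ring.
  apply: Rle_trans hC _; rewrite /Rsqr.
  have : (y / INR P) * L <= (y / INR P) * (L * L) by apply: Rmult_le_compat_l; nra.
  have : 0 <= y / INR P * (L * L) by nra.
  lra.
have hCB : Rabs C <= INR B.
  apply: Rle_trans (rsum_Rabs _ _ _) _; rewrite -[INR B]Rmult_1_r -rsum_const.
  by apply: rsum_le => i _; apply: Rabs_le; have := COS_bound (2 * PI * y / INR (P + i).+1); lra.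
have hC2 : C ^ 2 <= INR B ^ 2.
  by rewrite -(pow2_abs C); apply: pow_incr; split => //; exact: Rabs_pos.
have hBP : INR B <= INR P by exact: leq_INR.
have hB0 := pos_INR B.
have hyL : y / INR P <= y / INR P * L by nra.
(* Here not even one shift is admissible, but the trivial bound [P] is already at most
   [2 sqrt (y / P)]. *)
have [h4|h4] := Rlt_le_dec (INR P ^ 3) (4 * y).
  have : INR B ^ 2 <= INR P ^ 2 by apply: pow_incr; lra.
  have : INR P ^ 2 <= 4 * (y / INR P).
    have -> : 4 * (y / INR P) = (4 * y) / INR P by rewrite /Rdiv; ring.
    apply: Rle_divI; first lra.
    by have -> : INR P ^ 2 * INR P = INR P ^ 3; [ring | lra].
  nra.
have [e0|B0] := posnP B.
  have : INR B = 0 by rewrite e0.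
  by move=> hb; move: hC2; rewrite hb; nra.
(* The largest number of shifts allowed by [cos_reciprocal_sum_diff]; it is capped at [B] below. *)
pose K0 := nat_floor (INR P ^ 3 / (4 * y)).
have h5 : 1 <= INR P ^ 3 / (4 * y) by apply: Rle_divI; lra.
have hK0 : (0 < K0)%N by apply/leq_nat_floor; rewrite ?INR_1; lra.
have hK0le : INR K0 <= INR P ^ 3 / (4 * y) by apply: nat_floor_le; lra.
have hK0gt : INR P ^ 3 / (4 * y) < INR K0 + 1 := nat_floor_gt _.
pose K := minn K0 B.
have K_gt0 : (0 < K)%N by rewrite /K; lia.
have KB : (K <= B)%N by rewrite /K; lia.
have kle : INR K <= INR P ^ 3 / (4 * y).
  by apply: Rle_trans hK0le; apply: leq_INR; rewrite /K; lia.
have k1 : 1 <= INR K by exact: INR_ge1.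
have kB : INR K <= INR B by exact: leq_INR.
set V := INR P ^ 3 / y.
have V0 : 0 < V by apply: Rdiv_lt_0_compat; nra.
have hV4 : INR P ^ 3 / (4 * y) = V / 4 by rewrite /V; field; lra.
rewrite hV4 in hK0le hK0gt kle h5.
have hVp : V <= INR P.
  rewrite /V; apply: Rdiv_leI; first lra.
  have -> : INR P ^ 3 = INR P * INR P ^ 2 by ring.
  by apply: Rmult_le_compat_l; lra.
have := @van_der_corput (fun b => 2 * PI * y / INR (P + b).+1) B K (6 * V) K_gt0 KB _.
rewrite -/C; move=> hv.
have {}hv : INR K * C ^ 2 <= (INR B + INR K) * (INR B + 2 * (6 * V) * L).
  apply: Rle_trans (hv _) _.
    move=> k hk; apply: cos_reciprocal_sum_diff => //; [lia | lra |].
    have : INR k.+1 <= INR K by apply: leq_INR.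
    move=> hk'; have : INR k.+1 <= V / 4 by lra.
    rewrite -hV4 => /(Rle_div_r _ _ _ (_ : 4 * y > 0)) h; have := h ltac:(lra); lra.
  apply: Rmult_le_compat_l; first lra.
  apply: Rplus_le_compat_l; apply: Rmult_le_compat_l; first lra.
  apply: Rle_trans (harmonic_le K_gt0) _; rewrite /L.
  by have := ln_le (INR K) (INR P) ltac:(lra) ltac:(lra); lra.
(* An integer part that is at least 1 is at least half of its argument, here [V / 4]. If the cap is
   active instead, the block is shorter than the range of shifts and the inequality simplifies. *)
have hK8 : V / 8 <= INR K \/ INR K = INR B.
  have [hB|hB] := leqP K0 B; last by right; congr INR; rewrite /K; lia.
  left; have -> : K = K0 by rewrite /K; lia.
  have := INR_ge1 hK0; lra.
have hVL : 0 <= V * L <= y / INR P * L by split; [nra | apply: Rmult_le_compat_r; lra].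
case: hK8 => hK8; last first.
  rewrite hK8 in hv; have hB1 : 0 < INR B by exact: INR_gt0.
  have : INR B * C ^ 2 <= INR B * (2 * (INR B + 2 * (6 * V) * L)) by lra.
  move=> /(Rmult_le_reg_l _ _ _ hB1); lra.
have h6 : INR K * C ^ 2 <= INR K * (16 * / V * INR P * (INR P + 12 * V * L)).
  apply: Rle_trans hv _.
  have -> : INR K * (16 * / V * INR P * (INR P + 12 * V * L)) =
     (2 * INR P) * (INR K * (8 * / V)) * (INR P + 12 * V * L) by ring.
  have h7 : 1 <= INR K * (8 * / V).
    have -> : INR K * (8 * / V) = (8 * INR K) / V by rewrite /Rdiv; ring.
    by apply: Rle_divI; lra.
  apply: Rmult_le_compat; try lra.
  by apply: Rle_trans (_ : _ <= 2 * INR P * 1) _; [lra | apply: Rmult_le_compat_l; lra].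
have {h6} := Rmult_le_reg_l _ _ _ (Rlt_le_trans _ _ _ Rlt_0_1 k1) h6.
have -> : 16 * / V * INR P * (INR P + 12 * V * L) = 16 * (y / INR P) + 192 * (INR P * L).
  by rewrite /V; field; lra.
have : INR P * L <= y / INR P * L by apply: Rmult_le_compat_r; lra.
lra.
Qed.

(** * Fourier series of the second Bernoulli function *)

Lemma is_derive_rsum (I : Type) (s : seq I) (P : pred I) (F : I -> R -> R) (F' : I -> R)
    (x : R) :
  (forall i, P i -> is_derive (F i) x (F' i)) ->
  is_derive (fun t => \rsum_(i <- s | P i) F i t) x (\rsum_(i <- s | P i) F' i).
Proof.
move=> h; elim: s => [|i s IH].
  rewrite big_nil; apply: (is_derive_ext (fun=> 0)) => [t|]; first by rewrite big_nil.
  exact: is_derive_const.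
rewrite big_cons; case Pi: (P i).
  apply: (is_derive_ext (fun t => F i t + \rsum_(j <- s | P j) F j t)) => [t|].
    by rewrite big_cons Pi.
  by apply: (@is_derive_plus R_AbsRing); [exact: h |].
by apply: is_derive_ext IH => t; rewrite big_cons Pi.
Qed.

Lemma MVT_is_derive (f f' : R -> R) (a b : R) : a <= b ->
  (forall x, a <= x <= b -> is_derive f x (f' x)) ->
  exists2 c, a <= c <= b & f b - f a = f' c * (b - a).
Proof.
move=> hab h; have [->|ne] := Req_dec a b; first by exists b; [lra | ring].
have [|c [e hc]] := MVT_cor2 f f' a b _ (fun c hc => proj1 (is_derive_Reals _ _ _) (h c hc)).
  lra.
by exists c => //; lra.
Qed.

Lemma MVT_abs_le (f f' : R -> R) (a b M : R) : a <= b ->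
  (forall x, a <= x <= b -> is_derive f x (f' x)) ->
  (forall x, a <= x <= b -> Rabs (f' x) <= M) ->
  Rabs (f b - f a) <= M * (b - a).
Proof.
move=> hab h hM; have [c hc ->] := MVT_is_derive hab h.
rewrite Rabs_mult [Rabs (b - a)]Rabs_pos_eq; last lra.
by apply: Rmult_le_compat_r; [lra | exact: hM].
Qed.

Lemma sqr_sin_le (x : R) : 0 <= x -> sin x ^ 2 <= x ^ 2.
Proof.
move=> h; have [->|hx] := Req_dec x 0; first by rewrite sin_0; lra.
have h1 : sin x < x by apply: sin_lt_x; lra.
suff : - x <= sin x by move=> h2; have := Rmult_le_pos (x - sin x) (x + sin x); nra.
have hpi := PI_gt3; have [h2|h2] := Rle_dec x PI.
  by apply: Rle_trans (sin_ge_0 _ _ _); lra.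
by have := SIN_bound x; lra.
Qed.

(** The exponent 1/2 is deliberately weak: at frequency [h] it loses only [sqrt h], so that
    [\sum sqrt h / h^2] still converges. *)
Lemma one_sub_cos_le (u : R) : 0 <= u -> 0 <= 1 - cos u <= 2 * sqrt u.
Proof.
move=> hu; have := COS_bound u => hb; split; first lra.
have [h1|h1] := Rle_dec u 1; last first.
  have : sqrt 1 <= sqrt u by apply: sqrt_le_1_alt; lra.
  by rewrite sqrt_1; lra.
have e : u = 2 * (u / 2) by field.
have {1}-> : cos u = 1 - 2 * sin (u / 2) ^ 2 by rewrite {1}e cos_2a_sin; ring.
have h2 := @sqr_sin_le (u / 2) ltac:(lra).
have h3 := sqrt_pos u; have h4 := sqrt_sqrt u hu.
have h5 : sqrt u <= 1 by rewrite -sqrt_1; apply: sqrt_le_1_alt.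
have h6 : sqrt u * sqrt u <= sqrt u * 1 by apply: Rmult_le_compat_l.
have : (u / 2) ^ 2 <= u / 4 by nra.
lra.
Qed.

Definition bern2 (t : R) : R := t ^ 2 - t + 1 / 6.

Definition bern2_partial (N : nat) (t : R) : R :=
  \rsum_(h < N) (cos (2 * PI * INR h.+1 * t) / (PI ^ 2 * INR h.+1 ^ 2)).

Definition bern2_err (N : nat) (t : R) : R := bern2 t - bern2_partial N t.

Definition bern2_err' (N : nat) (t : R) : R :=
  2 * t - 1 + \rsum_(h < N) (2 * sin (2 * PI * INR h.+1 * t) / (PI * INR h.+1)).

Lemma is_derive_bern2_err (N : nat) (t : R) :
  is_derive (bern2_err N) t (bern2_err' N t).
Proof.
have hpi := PI_RGT_0.
have -> : bern2_err' N t = (2 * t - 1) -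
    \rsum_(h < N) - (2 * sin (2 * PI * INR h.+1 * t) / (PI * INR h.+1)).
  by rewrite rsumN /Rminus Ropp_involutive.
apply: (@is_derive_minus R_AbsRing).
  rewrite /bern2; auto_derive => //; rewrite INR_2; ring.
apply: is_derive_rsum => h _; have := INRS_gt0 h => hh.
by auto_derive => //; field; lra.
Qed.

Lemma dirichlet_kernel (N : nat) (a : R) :
  sin a * (1 + 2 * \rsum_(h < N) cos (2 * INR h.+1 * a)) = sin ((2 * INR N + 1) * a).
Proof.
elim: N => [|N IH].
  by rewrite rsum0 /INR; rewrite Rmult_0_r Rplus_0_r Rmult_1_r; congr sin; ring.
rewrite (rsum_recr _ (fun h => cos (2 * INR h.+1 * a))) S_INR.
have -> : (2 * (INR N + 1) + 1) * a = (2 * (INR N + 1)) * a + a by ring.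
have e : (2 * INR N + 1) * a = (2 * (INR N + 1)) * a - a by ring.
rewrite e sin_minus in IH; rewrite sin_plus.
set S := (\rsum_(h < N) _) in IH *; lra.
Qed.

Lemma is_derive_bern2_err' (N : nat) (t : R) : sin (PI * t) <> 0 ->
  is_derive (bern2_err' N) t (2 * (sin ((2 * INR N + 1) * (PI * t)) / sin (PI * t))).
Proof.
move=> hs; have hpi := PI_RGT_0; rewrite -dirichlet_kernel.
have -> : 2 * (sin (PI * t) * (1 + 2 * \rsum_(h < N) cos (2 * INR h.+1 * (PI * t))) / sin (PI * t))
   = 2 + \rsum_(h < N) (4 * cos (2 * PI * INR h.+1 * t)).
  rewrite rsumZ (eq_bigr (fun h : 'I_N => cos (2 * PI * INR h.+1 * t))); first by rewrite /=; field.
  by move=> h _; congr cos; ring.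
apply: (@is_derive_plus R_AbsRing); first by auto_derive => //; ring.
apply: is_derive_rsum => h _; have := INRS_gt0 h => hh.
by auto_derive => //; field; lra.
Qed.

Lemma bern2_err'_half (N : nat) : bern2_err' N (1 / 2) = 0.
Proof.
rewrite /bern2_err' big1 => [|h _]; first by rewrite /=; field.
have -> : 2 * PI * INR h.+1 * (1 / 2) = 0 + IZR (Z.of_nat h.+1) * PI.
  by rewrite -INR_IZR_INZ; field.
rewrite Rplus_0_l; have -> : sin (IZR (Z.of_nat h.+1) * PI) = 0 by apply: sin_eq_0_1; exists (Z.of_nat h.+1).
by rewrite /Rdiv; ring.
Qed.

Lemma cos_odd_half (N : nat) : cos ((2 * INR N + 1) * (PI * (1 / 2))) = 0.
Proof.
have -> : (2 * INR N + 1) * (PI * (1 / 2)) = PI / 2 + IZR (Z.of_nat N) * PI.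
  by rewrite -INR_IZR_INZ; field.
by rewrite cos_plus cos_PI2 (sin_eq_0_1 (IZR (Z.of_nat N) * PI)) ?Rmult_0_r ?Rmult_0_l;
  [ring | exists (Z.of_nat N)].
Qed.

(** The second derivative of the error is twice a Dirichlet kernel, whose oscillation makes the
    first derivative [O(1/N)] away from 0. Integrating from 1/2, where the first derivative
    vanishes, gives the bound. *)
Lemma bern2_err_inner (N : nat) (d t : R) : 0 < d -> d <= t <= 1 / 2 ->
  Rabs (bern2_err N t - bern2_err N (1 / 2)) <= 4 / (INR N.+1 * sin (PI * d) ^ 2).
Proof.
move=> d0 ht; have hpi := PI_gt3.
set s := sin (PI * d); set m := 2 * INR N + 1.
have hs t' : d <= t' <= 1 / 2 -> s <= sin (PI * t') <= 1.
  move=> h; split; last by have := SIN_bound (PI * t'); lra.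
  by apply: sin_incr_1; nra.
have s0 : 0 < s by apply: sin_gt_0; nra.
have s1 : s <= 1 by have := SIN_bound (PI * d); rewrite -/s; lra.
have m1 : INR N.+1 <= m by rewrite /m S_INR; have := pos_INR N; lra.
have n1 : 1 <= INR N.+1 := INRS_ge1 N.
(* Integration by parts in disguise: the added term cancels the Dirichlet kernel in the derivative,
   leaves a derivative of size [1/m], is itself of size [1/m], and vanishes at 1/2 since [m] is
   odd. *)
pose rho t' := bern2_err' N t' + 2 / (m * PI) * (cos (m * (PI * t')) / sin (PI * t')).
have hd t' : d <= t' <= 1 / 2 -> is_derive rho t'
   (- (2 / m) * (cos (m * (PI * t')) * cos (PI * t') / sin (PI * t') ^ 2)).
  move=> h; have hs' := hs t' h.
  have hne : sin (PI * t') <> 0 by lra.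
  evar_last; first apply: (@is_derive_plus R_AbsRing); first exact: is_derive_bern2_err'.
    by auto_derive; [exact: hne | reflexivity].
  by rewrite /plus /=  -/m; field; repeat split; lra.
have is2 : 0 < / s ^ 2 by apply: Rinv_0_lt_compat; apply: pow_lt.
have is1 : / s <= / s ^ 2 by apply: Rinv_le_contravar; nra.
have m0 : 0 < 2 / m by apply: Rdiv_lt_0_compat; lra.
have hrho t' : d <= t' <= 1 / 2 -> Rabs (rho t') <= / m * / s ^ 2.
  move=> h; have r0 : rho (1 / 2) = 0.
    by rewrite /rho bern2_err'_half cos_odd_half; rewrite /Rdiv; ring.
  have h' : t' <= 1 / 2 by lra.
  have := @MVT_abs_le rho _ t' (1 / 2) (2 / m * / s ^ 2) h' (fun u hu => hd u ltac:(lra)).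
  rewrite r0 Rminus_0_l Rabs_Ropp => hh.
  apply: Rle_trans (hh _) _ => [u hu|].
    have hsu := hs u ltac:(lra).
    rewrite Rabs_mult Rabs_Ropp Rabs_pos_eq; last lra.
    apply: Rmult_le_compat_l; first lra.
    rewrite /Rdiv !Rabs_mult [Rabs (/ _)]Rabs_pos_eq; last first.
      by apply: Rlt_le; apply: Rinv_0_lt_compat; apply: pow_lt; lra.
    have c1 : Rabs (cos (m * (PI * u))) <= 1 by apply: Rabs_le; have := COS_bound (m * (PI * u)); lra.
    have c2 : Rabs (cos (PI * u)) <= 1 by apply: Rabs_le; have := COS_bound (PI * u); lra.
    rewrite -[X in _ <= X]Rmult_1_l; apply: Rmult_le_compat.
    - by apply: Rmult_le_pos; exact: Rabs_pos.
    - by apply: Rlt_le; apply: Rinv_0_lt_compat; apply: pow_lt; lra.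
    - by rewrite -(Rmult_1_l 1); apply: Rmult_le_compat => //; exact: Rabs_pos.
    - by apply: Rinv_le_contravar; [apply: pow_lt | apply: pow_incr; lra].
  have e : / m * / s ^ 2 = 2 / m * / s ^ 2 * (1 / 2) by field; lra.
  by rewrite e; apply: Rmult_le_compat_l; [apply: Rmult_le_pos; lra | lra].
have hk t' : d <= t' <= 1 / 2 -> Rabs (bern2_err' N t') <= 2 * (/ m * / s ^ 2).
  move=> h; have hr := hrho t' h; have hs' := hs t' h.
  have e : bern2_err' N t' = rho t' - 2 / (m * PI) * (cos (m * (PI * t')) / sin (PI * t')).
    by rewrite /rho; ring.
  have h2 : Rabs (2 / (m * PI) * (cos (m * (PI * t')) / sin (PI * t'))) <= / m * / s ^ 2.
    rewrite Rabs_mult Rabs_pos_eq; last first.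
      by apply: Rlt_le; apply: Rdiv_lt_0_compat; nra.
    have -> : 2 / (m * PI) = / m * (2 / PI) by field; lra.
    rewrite Rmult_assoc; apply: Rmult_le_compat_l; first by apply: Rlt_le; apply: Rinv_0_lt_compat; lra.
    rewrite -[X in _ <= X]Rmult_1_l; apply: Rmult_le_compat.
    - by apply: Rlt_le; apply: Rdiv_lt_0_compat; lra.
    - exact: Rabs_pos.
    - by apply: Rdiv_leI; lra.
    apply: Rle_trans is1.
    rewrite /Rdiv Rabs_mult [Rabs (/ _)]Rabs_pos_eq; last first.
      by apply: Rlt_le; apply: Rinv_0_lt_compat; lra.
    rewrite -[X in _ <= X]Rmult_1_l; apply: Rmult_le_compat; first exact: Rabs_pos.
    - by apply: Rlt_le; apply: Rinv_0_lt_compat; lra.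
    - by apply: Rabs_le; have := COS_bound (m * (PI * t')); lra.
    - by apply: Rinv_le_contravar; lra.
  by rewrite e; have := Rabs_sub_le (rho t') (2 / (m * PI) * (cos (m * (PI * t')) / sin (PI * t'))); lra.
have h' : t <= 1 / 2 by lra.
have := @MVT_abs_le (bern2_err N) _ t (1 / 2) (2 * (/ m * / s ^ 2)) h'
   (fun u _ => is_derive_bern2_err N u) (fun u hu => hk u ltac:(lra)).
rewrite Rabs_minus_sym => h; apply: Rle_trans h _.
have im : / m <= / INR N.+1 by apply: Rinv_le_contravar; lra.
have -> : 4 / (INR N.+1 * s ^ 2) = 4 * (/ INR N.+1 * / s ^ 2) by field; lra.
have h1 : / m * / s ^ 2 <= / INR N.+1 * / s ^ 2 by apply: Rmult_le_compat_r; lra.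
have h2 : 0 <= / m * / s ^ 2.
  by apply: Rmult_le_pos; [apply: Rlt_le; apply: Rinv_0_lt_compat; lra | lra].
apply: Rle_trans (_ : 2 * (/ m * / s ^ 2) * 1 <= _); last lra.
by apply: Rmult_le_compat_l; lra.
Qed.

Lemma sum_inv_sqrt3 (N : nat) : \rsum_(h < N) (sqrt (INR h.+1) / INR h.+1 ^ 2) <= 3.
Proof.
have h := @sum_Rpower_le (1 / 2) N ltac:(lra).
have e : 1 + / (1 / 2) = 3 by field.
rewrite e in h; apply: Rle_trans h; apply: Req_le; apply: eq_bigr => i _.
have hi := INRS_gt0 i; rewrite -Rpower_sqrt // -(Rpower_natr 2) //.
rewrite /Rdiv -Rpower_Ropp -Rpower_plus; congr Rpower; rewrite /INR; lra.
Qed.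

(** Near 0 the kernel argument fails, but the series converges absolutely, and [one_sub_cos_le]
    yields a Hoelder bound with a constant independent of [N]. *)
Lemma bern2_err_origin (N : nat) (t : R) : 0 <= t <= 1 ->
  Rabs (bern2_err N t - bern2_err N 0) <= 4 * sqrt t.
Proof.
move=> ht; have hpi := PI_gt3; have hpi4 := PI_4.
have s1 : sqrt t <= 1 by rewrite -sqrt_1; apply: sqrt_le_1_alt; lra.
have s0 := sqrt_pos t; have ss := sqrt_sqrt t ltac:(lra).
have -> : bern2_err N t - bern2_err N 0 = (t ^ 2 - t) +
   (bern2_partial N 0 - bern2_partial N t) by rewrite /bern2_err /bern2; ring.
apply: Rle_trans (Rabs_triang _ _) _.
have h1 : Rabs (t ^ 2 - t) <= sqrt t by apply: Rabs_le; nra.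
suff h2 : Rabs (bern2_partial N 0 - bern2_partial N t) <= 3 * sqrt t by lra.
rewrite /bern2_partial -rsumB.
apply: Rle_trans (Rabs_rsum_le _ (G := fun h : 'I_N => sqrt t * (sqrt (INR h.+1) / INR h.+1 ^ 2)) _) _.
  move=> h _; have hh := INRS_gt0 h.
  rewrite Rmult_0_r cos_0.
  have -> : 1 / (PI ^ 2 * INR h.+1 ^ 2) - cos (2 * PI * INR h.+1 * t) / (PI ^ 2 * INR h.+1 ^ 2)
     = (1 - cos (2 * PI * INR h.+1 * t)) / PI ^ 2 / INR h.+1 ^ 2 by field; lra.
  have h2 : 0 < INR h.+1 ^ 2 by apply: pow_lt.
  have hu : 0 <= 2 * PI * INR h.+1 * t.
    by apply: Rmult_le_pos; [apply: Rmult_le_pos; lra | lra].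
  have [g1 g2] := one_sub_cos_le hu.
  have g3 : sqrt (2 * PI * INR h.+1 * t) <= 3 * (sqrt t * sqrt (INR h.+1)).
    have -> : 2 * PI * INR h.+1 * t = (2 * PI) * (INR h.+1 * t) by ring.
    rewrite (sqrt_mult (2 * PI)) ?(sqrt_mult (INR h.+1)); [|lra|lra|lra|nra].
    have : sqrt (2 * PI) <= sqrt (3 * 3) by apply: sqrt_le_1_alt; lra.
    rewrite sqrt_square; last lra.
    by move=> g; rewrite (Rmult_comm (sqrt t) (sqrt _)); apply: Rmult_le_compat_r => //;
      apply: Rmult_le_pos; exact: sqrt_pos.
  rewrite Rabs_pos_eq; last first.
    by apply: Rdiv_le_0_compat => //; apply: Rdiv_le_0_compat => //; nra.
  rewrite /Rdiv -Rmult_assoc; apply: Rmult_le_compat_r.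
    by apply: Rlt_le; apply: Rinv_0_lt_compat.
  have hp2 : 9 <= PI ^ 2 by nra.
  have g4 : 0 <= sqrt t * sqrt (INR h.+1) by apply: Rmult_le_pos; exact: sqrt_pos.
  by apply: Rdiv_leI; nra.
rewrite rsumZ Rmult_comm; apply: Rmult_le_compat_r => //; exact: sum_inv_sqrt3.
Qed.

Lemma bern2_err_sym (N : nat) (t : R) : bern2_err N (1 - t) = bern2_err N t.
Proof.
rewrite /bern2_err /bern2; congr (_ - _); first by ring.
apply: eq_bigr => h _; congr (_ / _).
have -> : 2 * PI * INR h.+1 * (1 - t) = - (2 * PI * INR h.+1 * t) + 2 * INR h.+1 * PI by ring.
by rewrite cos_period cos_neg.
Qed.

(** A primitive of the error takes equal values at 0 and 1, so the mean value theorem produces a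
    zero. This fixes the additive constant of the Fourier series without evaluating
    [\sum 1 / h^2]. *)
Lemma bern2_err_zero (N : nat) : exists2 c, 0 <= c <= 1 & bern2_err N c = 0.
Proof.
have hpi := PI_RGT_0.
pose G t := t ^ 3 / 3 - t ^ 2 / 2 + t / 6 -
  \rsum_(h < N) (sin (2 * PI * INR h.+1 * t) / (2 * PI ^ 3 * INR h.+1 ^ 3)).
have [x _|c hc e] := @MVT_is_derive G (bern2_err N) 0 1 ltac:(lra).
  apply: (@is_derive_minus R_AbsRing).
    by rewrite /bern2; auto_derive => //; rewrite INR_2 INR_3; field.
  apply: is_derive_rsum => h _; have := INRS_gt0 h => hh.
  by auto_derive => //; field; lra.
exists c => //; have {e} : G 1 - G 0 = bern2_err N c by rewrite e; ring.
move=> <-; rewrite /G !big1 => [|h _|h _]; first by rewrite /=; field.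
  by rewrite Rmult_0_r sin_0; rewrite /Rdiv; ring.
have -> : 2 * PI * INR h.+1 * 1 = 0 + 2 * INR h.+1 * PI by ring.
by rewrite sin_period sin_0; rewrite /Rdiv; ring.
Qed.

Lemma bern2_err_lim (eta : R) : 0 < eta ->
  exists N, forall t, 0 <= t <= 1 -> Rabs (bern2_err N t) <= eta.
Proof.
move=> he.
suff [N hN] : exists N, forall t, 0 <= t <= 1 / 2 ->
    Rabs (bern2_err N t - bern2_err N (1 / 2)) <= eta / 2.
  exists N => t ht; have hN' u : 0 <= u <= 1 ->
      Rabs (bern2_err N u - bern2_err N (1 / 2)) <= eta / 2.
    move=> hu; have [h|h] := Rle_dec u (1 / 2); first by apply: hN; lra.
    by rewrite -bern2_err_sym; apply: hN; lra.
  have [c hc e] := bern2_err_zero N.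
  have := Rabs_sub_le (bern2_err N t - bern2_err N (1 / 2)) (bern2_err N c - bern2_err N (1 / 2)).
  have -> : bern2_err N t - bern2_err N (1 / 2) - (bern2_err N c - bern2_err N (1 / 2)) =
    bern2_err N t by rewrite e; ring.
  by have := hN' t ht; have := hN' c hc; lra.
(* Two uses of the Hoelder bound on [[0, d]] cost [eta / 8] each; [N] below is chosen so that the
   inner estimate at [d] costs [eta / 4]. *)
pose d := Rmin (1 / 2) ((eta / 32) ^ 2).
have hd0 : 0 < d by apply: Rmin_glb_lt; [lra | apply: pow_lt; lra].
have hd1 : d <= 1 / 2 by apply: Rmin_l.
have hd2 : sqrt d <= eta / 32.
  rewrite -(sqrt_pow2 (eta / 32)); last lra.
  by apply: sqrt_le_1_alt; apply: Rmin_r.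
have hpi := PI_gt3.
have s0 : 0 < sin (PI * d) by apply: sin_gt_0; nra.
have s2 : 0 < sin (PI * d) ^ 2 by apply: pow_lt.
pose N := nat_floor (16 / (eta * sin (PI * d) ^ 2)).
have hes : 0 < eta * sin (PI * d) ^ 2 by apply: Rmult_lt_0_compat.
have hN : 4 / (INR N.+1 * sin (PI * d) ^ 2) <= eta / 4.
  have := nat_floor_gt (16 / (eta * sin (PI * d) ^ 2)); rewrite -/N -S_INR => h.
  have hN := INRS_gt0 N.
  apply: Rdiv_leI; first exact: Rmult_lt_0_compat.
  have e : 16 / (eta * sin (PI * d) ^ 2) * (eta * sin (PI * d) ^ 2) = 16 by field; lra.
  have := Rmult_lt_compat_r _ _ _ hes h; rewrite e; lra.
exists N => t ht; have [h|h] := Rle_dec d t.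
  by apply: Rle_trans (bern2_err_inner N hd0 _) _; lra.
have h1 := @bern2_err_inner N d d hd0 ltac:(lra).
have h2 := @bern2_err_origin N d ltac:(lra).
have h3 := @bern2_err_origin N t ltac:(lra).
have h4 : sqrt t <= sqrt d by apply: sqrt_le_1_alt; lra.
have -> : bern2_err N t - bern2_err N (1 / 2) = (bern2_err N t - bern2_err N 0) -
   (bern2_err N d - bern2_err N 0) + (bern2_err N d - bern2_err N (1 / 2)) by ring.
apply: Rle_trans (Rabs_triang _ _) _.
by have := Rabs_sub_le (bern2_err N t - bern2_err N 0) (bern2_err N d - bern2_err N 0); lra.
Qed.

Lemma abel_weighted_bound (w c : nat -> R) (M : R) (n : nat) :
  (forall j, (j <= n)%N -> 0 <= w j) ->
  (forall j, (j < n)%N -> w j <= w j.+1) ->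
  (forall j, (j <= n.+1)%N -> Rabs (\rsum_(b < j) c b) <= M) ->
  Rabs (\rsum_(b < n.+1) (w b * c b)) <= 2 * w n * M.
Proof.
move=> w0 wS hM.
suff h k : (k <= n)%N ->
    Rabs (\rsum_(b < k.+1) (w b * c b) - w k * \rsum_(b < k.+1) c b) <= w k * M.
  have h1 := h n (leqnn n); have h2 := hM n.+1 (leqnn _); have h3 := w0 n (leqnn _).
  have -> : \rsum_(b < n.+1) (w b * c b) =
    (\rsum_(b < n.+1) (w b * c b) - w n * \rsum_(b < n.+1) c b) + w n * \rsum_(b < n.+1) c b.
    by ring.
  apply: Rle_trans (Rabs_triang _ _) _.
  rewrite (Rabs_mult (w n)) (Rabs_pos_eq (w n)) //.
  by have := Rmult_le_compat_l _ _ _ h3 h2; lra.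
elim: k => [|k IH] hk.
  rewrite (rsum_recr _ (fun b => w b * c b)) (rsum_recr _ c) !rsum0.
  have -> : 0 + w 0%N * c 0%N - w 0%N * (0 + c 0%N) = 0 by ring.
  rewrite Rabs_R0; apply: Rmult_le_pos; first exact: w0.
  exact: Rle_trans (Rabs_pos _) (hM 0%N isT).
have {}IH := IH (ltnW hk).
rewrite (rsum_recr _ (fun b => w b * c b)) (rsum_recr k.+1 c).
set A := (\rsum_(b < k.+1) (w b * c b)) in IH *.
have hS := hM k.+1 (leqW hk); set S := (\rsum_(b < k.+1) c b) in IH hS *.
have hw := wS k hk.
rewrite [X in Rabs X](_ : _ = (A - w k * S) - (w k.+1 - w k) * S); last by rewrite /=; ring.
apply: Rle_trans (Rabs_sub_le _ _) _.
rewrite (Rabs_mult (w k.+1 - w k)) (Rabs_pos_eq (w k.+1 - w k)); last lra.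
have hw' : 0 <= w k.+1 - w k by lra.
by have := Rmult_le_compat_l _ _ _ hw' hS; lra.
Qed.

Lemma sqrt_sqr_le (a b x y : R) : 0 <= x -> 0 <= y -> 0 <= a -> 0 <= b ->
  a ^ 2 * x <= b ^ 2 * y -> a * sqrt x <= b * sqrt y.
Proof.
move=> hx hy ha hb h; apply: Rsqr_incr_0_var; last first.
  by apply: Rmult_le_pos => //; exact: sqrt_pos.
by rewrite !Rsqr_mult !Rsqr_sqrt // /Rsqr; lra.
Qed.

Lemma weighted_cos_sum_block (y : R) (P B : nat) :
  (0 < P)%N -> (B <= P)%N -> INR P ^ 2 <= y ->
  Rabs (\rsum_(b < B) (INR (P + b).+1 * cos (2 * PI * y / INR (P + b).+1))) <=
  60 * sqrt (y * INR P) * (1 + ln (INR P)).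
Proof.
move=> P0 BP hy; have p1 : 1 <= INR P by exact: INR_ge1.
have lnp : 0 <= ln (INR P) by exact: ln_ge0.
have y1 : 1 <= y by apply: Rle_trans hy; nra.
case: B BP => [|n] BP.
  by rewrite rsum0 Rabs_R0; have := sqrt_pos (y * INR P); nra.
apply: Rle_trans (@abel_weighted_bound (fun b => INR (P + b).+1)
   (fun b => cos (2 * PI * y / INR (P + b).+1)) (15 * (sqrt (y / INR P) * (1 + ln (INR P)))) n _ _ _) _.
- by move=> j _; exact: pos_INR.
- by move=> j _; apply: leq_INR; lia.
- by move=> j hj; apply: cos_reciprocal_sum => //; lia.
have h1 : INR (P + n).+1 <= 2 * INR P.
  by rewrite -INR_2 -mult_INR; apply: leq_INR; lia.
have h2 : 0 <= sqrt (y / INR P) * (1 + ln (INR P)).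
  by apply: Rmult_le_pos; [exact: sqrt_pos | lra].
have h3 : INR P * sqrt (y / INR P) <= 1 * sqrt (y * INR P).
  apply: sqrt_sqr_le; try lra; [apply: Rdiv_le_0_compat | apply: Rmult_le_pos |]; try lra.
  by apply: Req_le; field; lra.
have h4 := Rmult_le_compat_r _ _ _ h2 h1.
have h5 := Rmult_le_compat_r (1 + ln (INR P)) _ _ ltac:(lra) h3.
lra.
Qed.

(** Dyadic summation by strong induction: the upper half of the range is one block [(P, P + B]] with
    [B <= P], the lower half is the induction hypothesis. *)
Lemma weighted_cos_sum (y : R) (z : nat) : (0 < z)%N -> INR z ^ 2 <= y ->
  Rabs (\rsum_(b < z) (INR b.+1 * cos (2 * PI * y / INR b.+1))) <=
  300 * sqrt (y * INR z) * (1 + ln (INR z)).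
Proof.
elim/ltn_ind: z => z IH z0 hy.
have z1 : 1 <= INR z by exact: INR_ge1.
have y1 : 1 <= y by apply: Rle_trans hy; nra.
have lnz : 0 <= ln (INR z) by exact: ln_ge0.
case: (leqP z 1) => hz.
  have {hz z0}e : z = 1%N by lia.
  rewrite e (rsum_recr _ (fun b => INR b.+1 * cos (2 * PI * y / INR b.+1))) rsum0 INR_1 ln_1.
  rewrite Rplus_0_l Rmult_1_l; apply: Rle_trans (_ : 1 <= _).
    by apply: Rabs_le; have := COS_bound (2 * PI * y / 1); lra.
  have : sqrt 1 <= sqrt (y * 1) by apply: sqrt_le_1_alt; lra.
  by rewrite sqrt_1; lra.
pose P := uphalf z; pose B := z./2.
have hPB : z = (P + B)%N by rewrite /P /B; lia.
have P0 : (0 < P)%N by rewrite /P; lia.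
have Pz : (P < z)%N by rewrite /P; lia.
have hP : INR P <= INR z by apply: leq_INR; lia.
have p1 : 1 <= INR P by exact: INR_ge1.
have hPy : INR P ^ 2 <= y by apply: Rle_trans hy; apply: pow_incr; lra.
have h1 := IH P Pz P0 hPy.
have h2 := @weighted_cos_sum_block y P B P0 ltac:(rewrite /P /B; lia) hPy.
pose F b := INR b.+1 * cos (2 * PI * y / INR b.+1).
have -> : \rsum_(b < z) F b = \rsum_(b < P) F b + \rsum_(b < B) F (P + b)%N.
  by rewrite -rsum_split -hPB.
apply: Rle_trans (Rabs_triang _ _) _.
have lnP : ln (INR P) <= ln (INR z) by apply: ln_le; lra.
have lnP0 : 0 <= ln (INR P) by exact: ln_ge0.
(* For [z >= 2] the larger half satisfies [P <= 2 z / 3], and [360^2 * 2 / 3 <= 300^2]; so the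
   constant 300 reproduces itself after the block adds 60. *)
have h3 : 360 * sqrt (y * INR P) <= 300 * sqrt (y * INR z).
  apply: sqrt_sqr_le; try lra; try (apply: Rmult_le_pos; lra).
  have : 3 * INR P <= 2 * INR z.
    by rewrite -INR_2 -INR_3 -!mult_INR; apply: leq_INR; rewrite /P; lia.
  move=> h; have hyz : 0 <= y * INR z by apply: Rmult_le_pos; lra.
  by have := Rmult_le_compat_l y _ _ ltac:(lra) h; lra.
have s0 := sqrt_pos (y * INR P); have s1 := sqrt_pos (y * INR z).
apply: Rle_trans (_ : 360 * sqrt (y * INR P) * (1 + ln (INR P)) <= _).
  by move: (Rplus_le_compat _ _ _ _ h1 h2); rewrite /F; lra.
apply: Rmult_le_compat; lra.
Qed.

Definition frac (x : R) : R := x - INR (nat_floor x).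

Lemma frac_bounds (x : R) : 0 <= x -> 0 <= frac x < 1.
Proof.
by move=> hx; rewrite /frac; have := nat_floor_le hx; have := nat_floor_gt x; lra.
Qed.

Lemma cos_frac (h : nat) (x : R) :
  cos (2 * PI * INR h * frac x) = cos (2 * PI * INR h * x).
Proof.
have -> : 2 * PI * INR h * x = 2 * PI * INR h * frac x + 2 * INR (h * nat_floor x) * PI.
  by rewrite mult_INR /frac; ring.
by rewrite cos_period.
Qed.

Lemma bern2_sum (x : R) (z : nat) : 1 <= x -> INR z ^ 2 <= x ->
  Rabs (\rsum_(b < z) (INR b.+1 * bern2 (frac (x / INR b.+1)))) <=
  102 * sqrt (x * INR z) * (1 + ln x).
Proof.
move=> x1 hz; have lnx : 0 <= ln x by exact: ln_ge0.
have sq0 := sqrt_pos (x * INR z).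
have [->|z0] := posnP z; first by rewrite rsum0 Rabs_R0; have := sqrt_pos (x * INR 0); nra.
have z1 : 1 <= INR z by exact: INR_ge1.
have zx : INR z <= x by nra.
have hpi := PI_gt3.
apply: le_epsilon => eps he.
have hz2 : 0 < INR z * INR z by nra.
have he2 : 0 < eps / (INR z * INR z) by exact: Rdiv_lt_0_compat.
have [N hN] := bern2_err_lim he2.
have -> : \rsum_(b < z) (INR b.+1 * bern2 (frac (x / INR b.+1))) =
    \rsum_(b < z) (INR b.+1 * bern2_partial N (frac (x / INR b.+1))) +
    \rsum_(b < z) (INR b.+1 * bern2_err N (frac (x / INR b.+1))).
  by rewrite -big_split; apply: eq_bigr => b _; rewrite /bern2_err /=; ring.
apply: Rle_trans (Rabs_triang _ _) _; apply: Rplus_le_compat; last first.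
  apply: Rle_trans (Rabs_rsum_le _ (G := fun=> INR z * (eps / (INR z * INR z))) _) _.
    move=> b _; have hb := INRS_gt0 b.
    rewrite Rabs_mult (Rabs_pos_eq (INR b.+1)); last lra.
    apply: Rmult_le_compat; [lra | exact: Rabs_pos | exact: leq_INR |].
    apply: hN; have := @frac_bounds (x / INR b.+1); move=> h.
    have : 0 <= x / INR b.+1 by apply: Rdiv_le_0_compat; lra.
    by move=> /h; lra.
  by rewrite rsum_const; apply: Req_le; field; lra.
have -> : \rsum_(b < z) (INR b.+1 * bern2_partial N (frac (x / INR b.+1))) =
   \rsum_(h < N) (/ (PI ^ 2 * INR h.+1 ^ 2) *
     \rsum_(b < z) (INR b.+1 * cos (2 * PI * (INR h.+1 * x) / INR b.+1))).
  under eq_bigr => b _ do rewrite /bern2_partial big_distrr /=.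
  rewrite exchange_big; apply: eq_bigr => h _; rewrite big_distrr; apply: eq_bigr => b _ /=.
  rewrite cos_frac /Rdiv.
  have -> : 2 * PI * (INR h.+1 * x) * / INR b.+1 = 2 * PI * INR h.+1 * (x * / INR b.+1) by ring.
  ring.
apply: Rle_trans (Rabs_rsum_le _ (G := fun h : 'I_N => 34 * sqrt (x * INR z) * (1 + ln x) *
    (sqrt (INR h.+1) / INR h.+1 ^ 2)) _) _.
  move=> h _; have hh := INRS_gt0 h; have hh1 := INRS_ge1 h.
  have h2 : 0 < INR h.+1 ^ 2 by apply: pow_lt.
  have hp2 : 9 <= PI ^ 2 by nra.
  rewrite Rabs_mult Rabs_pos_eq; last first.
    by apply: Rlt_le; apply: Rinv_0_lt_compat; apply: Rmult_lt_0_compat; lra.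
  have hw := @weighted_cos_sum (INR h.+1 * x) z z0 ltac:(nra).
  have -> : 34 * sqrt (x * INR z) * (1 + ln x) * (sqrt (INR h.+1) / INR h.+1 ^ 2) =
     / (9 * INR h.+1 ^ 2) * (306 * (sqrt (INR h.+1) * sqrt (x * INR z)) * (1 + ln x)).
    by field; lra.
  apply: Rmult_le_compat; [ | exact: Rabs_pos | |].
  - by apply: Rlt_le; apply: Rinv_0_lt_compat; apply: Rmult_lt_0_compat; lra.
  - apply: Rinv_le_contravar; first by apply: Rmult_lt_0_compat; lra.
    by apply: Rmult_le_compat_r; lra.
  apply: Rle_trans hw _; rewrite (Rmult_assoc (INR h.+1)) sqrt_mult; [|lra|nra].
  have lnz : ln (INR z) <= ln x by apply: ln_le; lra.
  have lnz0 : 0 <= ln (INR z) by exact: ln_ge0.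
  have s2 : 0 <= sqrt (INR h.+1) * sqrt (x * INR z) by apply: Rmult_le_pos => //; exact: sqrt_pos.
  apply: Rmult_le_compat; lra.
rewrite rsumZ.
have h3 := sum_inv_sqrt3 N.
have h4 : 0 <= 34 * sqrt (x * INR z) * (1 + ln x) by apply: Rmult_le_pos; lra.
apply: Rle_trans (Rmult_le_compat_l _ _ _ h4 h3) _; lra.
Qed.

(** * Harmonic sums *)

(** The error is viewed as a function [psi] of the half-width [h]. It and its derivative [chi]
    vanish at [h = 0], so it suffices to bound the second derivative [chi']. *)
Lemma midpoint_rule (F f f1 f2 f3 : R -> R) (c B : R) :
  (forall t, c - 1 / 2 <= t <= c + 1 / 2 -> [/\ is_derive F t (f t), is_derive f t (f1 t),
     is_derive f1 t (f2 t) & is_derive f2 t (f3 t)]) ->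
  (forall t, c - 1 / 2 <= t <= c + 1 / 2 -> Rabs (f3 t) <= B) ->
  Rabs (f c - (F (c + 1 / 2) - F (c - 1 / 2)) + (f1 (c + 1 / 2) - f1 (c - 1 / 2)) / 24) <= B.
Proof.
move=> hd hB.
have B0 : 0 <= B by apply: Rle_trans (Rabs_pos _) (hB c _); lra.
have dcomp (g g' : R -> R) (h : R) : 0 <= h <= 1 / 2 ->
    (forall t, c - 1 / 2 <= t <= c + 1 / 2 -> is_derive g t (g' t)) ->
    is_derive (fun u => g (c + u)) h (g' (c + h)) /\ is_derive (fun u => g (c - u)) h (- g' (c - h)).
  move=> hh hg; split.
    evar_last; first apply: (is_derive_comp g (fun u => c + u)); first by apply: hg; lra.
      by auto_derive.
    by rewrite /scal /= /mult /=; ring.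
  evar_last; first apply: (is_derive_comp g (fun u => c - u)); first by apply: hg; lra.
    by auto_derive.
  by rewrite /scal /= /mult /=; ring.
pose psi h := F (c + h) - F (c - h) - 2 * h * f c - h ^ 2 / 6 * (f1 (c + h) - f1 (c - h)).
pose chi h := f (c + h) + f (c - h) - 2 * f c - h / 3 * (f1 (c + h) - f1 (c - h)) -
   h ^ 2 / 6 * (f2 (c + h) + f2 (c - h)).
pose chi' h := 2 / 3 * (f1 (c + h) - f1 (c - h)) - 2 * h / 3 * (f2 (c + h) + f2 (c - h)) -
   h ^ 2 / 6 * (f3 (c + h) - f3 (c - h)).
have dpsi h : 0 <= h <= 1 / 2 -> is_derive psi h (chi h).
  move=> hh.
  have [a1 a2] := dcomp F f h hh (fun t ht => let: And4 a _ _ _ := hd t ht in a).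
  have [b1 b2] := dcomp f1 f2 h hh (fun t ht => let: And4 _ _ a _ := hd t ht in a).
  evar_last.
    apply: (@is_derive_minus R_AbsRing); first apply: (@is_derive_minus R_AbsRing).
    - exact: (@is_derive_minus R_AbsRing _ _ _ _ _ _ a1 a2).
    - by auto_derive.
    apply: (is_derive_mult (fun u => u ^ 2 / 6) (fun u => f1 (c + u) - f1 (c - u))).
    - by auto_derive.
    - exact: (@is_derive_minus R_AbsRing _ _ _ _ _ _ b1 b2).
    - exact: Rmult_comm.
  by rewrite /minus /plus /opp /mult /= /chi INR_2; field.
have dchi h : 0 <= h <= 1 / 2 -> is_derive chi h (chi' h).
  move=> hh.
  have [a1 a2] := dcomp f f1 h hh (fun t ht => let: And4 _ a _ _ := hd t ht in a).
  have [b1 b2] := dcomp f1 f2 h hh (fun t ht => let: And4 _ _ a _ := hd t ht in a).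
  have [c1 c2] := dcomp f2 f3 h hh (fun t ht => let: And4 _ _ _ a := hd t ht in a).
  evar_last.
    apply: (@is_derive_minus R_AbsRing); first apply: (@is_derive_minus R_AbsRing);
      first apply: (@is_derive_minus R_AbsRing).
    - exact: (@is_derive_plus R_AbsRing _ _ _ _ _ _ a1 a2).
    - exact: is_derive_const.
    - apply: (is_derive_mult (fun u => u / 3) (fun u => f1 (c + u) - f1 (c - u))).
      + by auto_derive.
      + exact: (@is_derive_minus R_AbsRing _ _ _ _ _ _ b1 b2).
      + exact: Rmult_comm.
    apply: (is_derive_mult (fun u => u ^ 2 / 6) (fun u => f2 (c + u) + f2 (c - u))).
    - by auto_derive.
    - exact: (@is_derive_plus R_AbsRing _ _ _ _ _ _ c1 c2).
    - exact: Rmult_comm.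
  by rewrite /minus /plus /opp /mult /zero /= /chi' INR_2; field.
have lip2 s t : c - 1 / 2 <= s <= c + 1 / 2 -> c - 1 / 2 <= t <= c + 1 / 2 ->
    Rabs (f2 t - f2 s) <= B.
  have aux a b : a <= b -> c - 1 / 2 <= a <= c + 1 / 2 -> c - 1 / 2 <= b <= c + 1 / 2 ->
      Rabs (f2 b - f2 a) <= B.
    move=> hab ha hb; apply: Rle_trans (@MVT_abs_le f2 f3 a b B hab _ _) _.
    - by move=> x hx; have [] := hd x ltac:(lra).
    - by move=> x hx; apply: hB; lra.
    by rewrite -[X in _ <= X]Rmult_1_r; apply: Rmult_le_compat_l; lra.
  move=> hs ht; have [h|h] := Rle_dec s t; first exact: aux.
  by rewrite Rabs_minus_sym; apply: aux; lra.
have bchi' h : 0 <= h <= 1 / 2 -> Rabs (chi' h) <= B.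
  move=> hh; have hl : c - h <= c + h by lra.
  have [x hx e] := @MVT_is_derive f1 f2 (c - h) (c + h) hl
    (fun t ht => let: And4 _ _ a _ := hd t ltac:(lra) in a).
  (* Writing [f1 (c + h) - f1 (c - h) = 2 h f2 x] turns the leading terms into increments of [f2],
     which are controlled by [f3]. *)
  have -> : chi' h = 2 * h / 3 * ((f2 x - f2 (c + h)) + (f2 x - f2 (c - h))) -
     h ^ 2 / 6 * (f3 (c + h) - f3 (c - h)) by rewrite /chi' e; field.
  have l1 := lip2 (c + h) x ltac:(lra) ltac:(lra).
  have l2 := lip2 (c - h) x ltac:(lra) ltac:(lra).
  have l3 := hB (c + h) ltac:(lra); have l4 := hB (c - h) ltac:(lra).
  apply: Rle_trans (Rabs_sub_le _ _) _.
  rewrite (Rabs_mult (2 * h / 3)) (Rabs_mult (h ^ 2 / 6)).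
  rewrite (Rabs_pos_eq (2 * h / 3)); last lra.
  rewrite (Rabs_pos_eq (h ^ 2 / 6)); last by have := pow2_ge_0 h; lra.
  have m1 := Rabs_triang (f2 x - f2 (c + h)) (f2 x - f2 (c - h)).
  have m2 := Rabs_sub_le (f3 (c + h)) (f3 (c - h)).
  have n1 : 2 * h / 3 * Rabs (f2 x - f2 (c + h) + (f2 x - f2 (c - h))) <= 1 / 3 * (2 * B).
    by apply: Rmult_le_compat; try lra; exact: Rabs_pos.
  have n2 : h ^ 2 / 6 * Rabs (f3 (c + h) - f3 (c - h)) <= 1 / 24 * (2 * B).
    by apply: Rmult_le_compat; [nra | exact: Rabs_pos | nra | lra].
  lra.
have bchi h : 0 <= h <= 1 / 2 -> Rabs (chi h) <= B.
  move=> hh; have := @MVT_abs_le chi chi' 0 h B ltac:(lra) (fun x hx => dchi x ltac:(lra))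
     (fun x hx => bchi' x ltac:(lra)).
  have -> : chi 0 = 0 by rewrite /chi Rplus_0_r Rminus_0_r; field.
  rewrite Rminus_0_r => h1; apply: Rle_trans h1 _.
  by rewrite -[X in _ <= X]Rmult_1_r; apply: Rmult_le_compat_l; lra.
have := @MVT_abs_le psi chi 0 (1 / 2) B ltac:(lra) dpsi bchi.
have -> : psi 0 = 0 by rewrite /psi Rplus_0_r Rminus_0_r; field.
rewrite Rminus_0_r => h1.
rewrite -Rabs_Ropp; apply: Rle_trans (_ : Rabs (psi (1 / 2)) <= _); last lra.
by apply: Req_le; congr Rabs; rewrite /psi; field.
Qed.

Lemma Rpower_telescope (d : R) (n : nat) : 0 < d -> (0 < n)%N ->
  Rpower (INR n.+1) (- 1 - d) <= (Rpower (INR n) (- d) - Rpower (INR n.+1) (- d)) / d.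
Proof.
move=> hd n0; have hn : 0 < INR n by exact: INR_gt0.
have hy : 0 < INR n.+1 := INRS_gt0 n.
have e : INR n = INR n.+1 - 1 by rewrite S_INR; lra.
rewrite e in hn *; set y := INR n.+1 in hn hy *.
have -> : Rpower (y - 1) (- d) = Rpower y (- d) * Rpower ((y - 1) / y) (- d).
  rewrite -Rpower_mulE //; first by congr Rpower; field; lra.
  exact: Rdiv_lt_0_compat.
have h1 : 1 + d / y <= Rpower ((y - 1) / y) (- d).
  have h := exp_ineq1_le (- d * ln ((y - 1) / y)).
  apply: Rle_trans h.
  have h2 := ln_le_sub1 (Rdiv_lt_0_compat _ _ hn hy).
  have h3 : (y - 1) / y - 1 = - / y by field; lra.
  rewrite h3 in h2.
  have := Rmult_le_compat_l d _ _ (Rlt_le _ _ hd) h2; lra.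
have -> : Rpower y (- 1 - d) = Rpower y (- d) / y.
  have -> : - 1 - d = - d + (- (1)) by ring.
  by rewrite Rpower_plus [Rpower y (- (1))]Rpower_Ropp Rpower_1.
have := Rmult_le_compat_l _ _ _ (Rpower_ge0 y (- d)) h1.
set p := Rpower y (- d) => h4.
have -> : p / y = (p * (1 + d / y) - p) / d by field; lra.
by apply: Rmult_le_compat_r; [apply: Rlt_le; exact: Rinv_0_lt_compat | lra].
Qed.

(** The increments are dominated by those of [G], so the intervals of radius [G n] around [a n] meet
    pairwise; the supremum of their left ends lies in all of them. *)
Lemma Rpower_tail_limit (a : nat -> R) (A d : R) : 0 <= A -> 0 < d ->
  (forall n, (0 < n)%N -> Rabs (a n.+1 - a n) <= A * Rpower (INR n.+1) (- 1 - d)) ->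
  exists l, forall n, (0 < n)%N -> Rabs (a n - l) <= A / d * Rpower (INR n) (- d).
Proof.
move=> hA hd h; pose G n := A / d * Rpower (INR n) (- d).
have G0 n : 0 <= G n.
  by apply: Rmult_le_pos; [apply: Rdiv_le_0_compat | exact: Rpower_ge0].
have step n : (0 < n)%N -> Rabs (a n.+1 - a n) <= G n - G n.+1.
  move=> n0; apply: Rle_trans (h n n0) _.
  apply: Rle_trans (Rmult_le_compat_l _ _ _ hA (Rpower_telescope hd n0)) _.
  by apply: Req_le; rewrite /G; field; lra.
have dist n k : (0 < n)%N -> Rabs (a (n + k)%N - a n) <= G n - G (n + k)%N.
  move=> n0; elim: k => [|k IH]; first by rewrite addn0 !Rminus_diag Rabs_R0; lra.
  rewrite addnS; have h1 := step (n + k)%N ltac:(lia).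
  have -> : a (n + k).+1 - a n = (a (n + k).+1 - a (n + k)%N) + (a (n + k)%N - a n) by ring.
  by apply: Rle_trans (Rabs_triang _ _) _; lra.
have cmp m n : (0 < m)%N -> (0 < n)%N -> a n - G n <= a m + G m.
  move=> m0 n0; have [hmn|hmn] := leqP m n.
    have := dist m (n - m)%N m0; rewrite subnKC //.
    by move=> /Rabs_le_between; have := G0 n; lra.
  have := dist n (m - n)%N n0; rewrite subnKC; last exact: ltnW.
  by move=> /Rabs_le_between; have := G0 m; lra.
pose E x := exists2 n, (0 < n)%N & x = a n - G n.
have hE1 : bound E by exists (a 1%N + G 1%N) => x [n n0 ->]; exact: cmp.
have hE2 : exists x, E x by exists (a 1%N - G 1%N); exists 1%N.
have [l [hl1 hl2]] := completeness E hE1 hE2.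
exists l => n n0; apply/Rabs_le_between; rewrite -/(G n).
have h1 := hl1 _ (ex_intro2 _ _ n n0 erefl).
have h2 : l <= a n + G n.
  by apply: hl2 => x [m m0 ->]; exact: cmp.
lra.
Qed.

(** The increments of the sequence [a] are midpoint errors on unit intervals centred at integers, so
    [Rpower_tail_limit] gives the constant [l]. Evaluating at [n + 1/2] avoids the boundary term
    [f(n) / 2]. The exponent 7/2 instead of 4 leaves room for a logarithm in [f3]. *)
Lemma euler_maclaurin (F f f1 f2 f3 : R -> R) (A : R) : 0 <= A ->
  (forall t, 0 < t -> [/\ is_derive F t (f t), is_derive f t (f1 t),
     is_derive f1 t (f2 t) & is_derive f2 t (f3 t)]) ->
  (forall t, 1 / 2 <= t -> Rabs (f3 t) <= A * Rpower t (- (7 / 2))) ->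
  exists l C, 0 <= C /\ forall n, (0 < n)%N ->
    Rabs (\rsum_(k < n) f (INR k.+1) -
      (F (INR n + 1 / 2) + l - f1 (INR n + 1 / 2) / 24)) <=
    C * Rpower (INR n + 1 / 2) (- (5 / 2)).
Proof.
move=> hA hd hB.
pose a n := \rsum_(k < n) f (INR k.+1) - F (INR n + 1 / 2) + f1 (INR n + 1 / 2) / 24.
have p72 : 0 <= A * Rpower (1 / 2) (- (7 / 2)) by apply: Rmult_le_pos => //; exact: Rpower_ge0.
have mono t u e : 0 < t -> t <= u -> 0 <= e -> Rpower u (- e) <= Rpower t (- e).
  move=> ht htu he; rewrite !Rpower_Ropp; apply: Rinv_le_contravar; first exact: Rpower_gt0.
  by apply: Rpower_le_base.
have [|l hl] := @Rpower_tail_limit a (A * Rpower (1 / 2) (- (7 / 2))) (5 / 2) p72 ltac:(lra).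
  move=> n n0; rewrite /a (rsum_recr _ (fun k => f (INR k.+1))).
  set c := INR n.+1.
  have c2 : INR n = c - 1 by rewrite /c S_INR; ring.
  have c1 : 1 <= c by exact: INRS_ge1.
  have h := @midpoint_rule F f f1 f2 f3 c (A * Rpower (c - 1 / 2) (- (7 / 2))).
  have -> : INR n + 1 / 2 = c - 1 / 2 by rewrite c2; field.
  rewrite [X in Rabs X](_ : _ = f c - (F (c + 1 / 2) - F (c - 1 / 2)) +
     (f1 (c + 1 / 2) - f1 (c - 1 / 2)) / 24); last by rewrite /=; field.
  apply: Rle_trans (h _ _) _ => [t ht|t ht|].
  - by apply: hd; lra.
  - apply: Rle_trans (hB t _) _; first lra.
    by apply: Rmult_le_compat_l => //; apply: mono; lra.
  rewrite Rmult_assoc; apply: Rmult_le_compat_l => //.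
  have -> : - 1 - 5 / 2 = - (7 / 2) by field.
  by rewrite -Rpower_mulE; [apply: mono; lra | lra | lra].
exists l; exists (A * Rpower (1 / 2) (- (7 / 2)) / (5 / 2) * Rpower (1 / 2) (- (5 / 2))); split.
  apply: Rmult_le_pos; last exact: Rpower_ge0.
  by apply: Rdiv_le_0_compat => //; lra.
move=> n n0; have n1 : 1 <= INR n by exact: INR_ge1.
rewrite [X in Rabs X](_ : _ = a n - l); last by rewrite /a; ring.
apply: Rle_trans (hl n n0) _; rewrite Rmult_assoc; apply: Rmult_le_compat_l.
  by apply: Rdiv_le_0_compat => //; lra.
by rewrite -Rpower_mulE; [apply: mono; lra | lra | lra].
Qed.

Lemma Rabs_ln_le_sqrt (t : R) : 1 / 2 <= t -> Rabs (ln t) <= 2 * sqrt t.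
Proof.
move=> ht; have s0 : 0 < sqrt t by apply: sqrt_lt_R0; lra.
have ss := sqrt_sqrt t ltac:(lra).
have h1 := @ln_le_sub1 (sqrt t) s0.
have e : ln t = 2 * ln (sqrt t).
  by rewrite -{1}ss ln_mult //; ring.
have h2 := @ln_le_sub1 (/ t) ltac:(apply: Rinv_0_lt_compat; lra).
rewrite ln_Rinv in h2; last lra.
have h3 : / t <= 2 by rewrite -[X in _ <= X]Rinv_inv; apply: Rinv_le_contravar; lra.
have h4 : 1 <= 2 * sqrt t by nra.
by apply: Rabs_le; lra.
Qed.

Lemma Rpower_m72 (t : R) : 0 < t -> Rpower t (- (7 / 2)) = sqrt t / t ^ 4.
Proof.
move=> ht; rewrite -Rpower_sqrt // -(Rpower_natr 4) // /Rdiv -Rpower_Ropp -Rpower_plus.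
by congr Rpower; rewrite S_INR INR_3; field.
Qed.

(** Here [g] is Euler's constant, and in [log_harmonic_bound] it is the first Stieltjes constant.
    The error exponent 5/2 is just what is needed: [x^2 n^(-5/2)] is [x^(3/4)] for [n ~ sqrt x], and
    [T^2 n^(-5/2)] is [T^(7/6)] for [n ~ T^(1/3)]. *)
Definition harmonic_bound (g C : R) : Prop := forall n, (0 < n)%N ->
  Rabs (\rsum_(k < n) / INR k.+1 -
    (ln (INR n + 1 / 2) + g + / (24 * (INR n + 1 / 2) ^ 2))) <=
  C * Rpower (INR n + 1 / 2) (- (5 / 2)).

Definition log_harmonic_bound (g C : R) : Prop := forall n, (0 < n)%N ->
  Rabs (\rsum_(k < n) (ln (INR k.+1) / INR k.+1) -
    (ln (INR n + 1 / 2) ^ 2 / 2 + g + (ln (INR n + 1 / 2) - 1) / (24 * (INR n + 1 / 2) ^ 2))) <=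
  C * Rpower (INR n + 1 / 2) (- (5 / 2)).

Lemma harmonic_asymptotic : exists g C, 0 <= C /\ harmonic_bound g C.
Proof.
have [|||g [C [hC h]]] := @euler_maclaurin ln (fun t => / t) (fun t => - / t ^ 2)
    (fun t => 2 / t ^ 3) (fun t => - 6 / t ^ 4) 12.
- lra.
- move=> t ht; split; auto_derive => //; rewrite ?INR_2 ?INR_3; try field; try lra;
    by repeat split; apply/Rgt_not_eq; do ?apply: Rmult_lt_0_compat; lra.
- move=> t ht; rewrite Rpower_m72; last lra.
  have t4 : 0 < t ^ 4 by apply: pow_lt; lra.
  rewrite /Rdiv Rabs_mult (Rabs_pos_eq (/ _)); last by apply: Rlt_le; exact: Rinv_0_lt_compat.
  rewrite -Rmult_assoc; apply: Rmult_le_compat_r; first by apply: Rlt_le; exact: Rinv_0_lt_compat.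
  rewrite Rabs_left; last lra.
  have := sqrt_sqrt t ltac:(lra); have := sqrt_pos t; nra.
exists g, C; split => // n n0; have n1 : 1 <= INR n by exact: INR_ge1.
have -> : / (24 * (INR n + 1 / 2) ^ 2) = - (- / (INR n + 1 / 2) ^ 2) / 24 by field; lra.
have := h n n0; rewrite /Rminus /Rdiv => {}h.
by rewrite Ropp_mult_distr_l in h.
Qed.

Lemma log_harmonic_asymptotic : exists g C, 0 <= C /\ log_harmonic_bound g C.
Proof.
have [|||g [C [hC h]]] := @euler_maclaurin (fun t => ln t ^ 2 / 2) (fun t => ln t / t)
    (fun t => (1 - ln t) / t ^ 2) (fun t => (2 * ln t - 3) / t ^ 3)
    (fun t => (11 - 6 * ln t) / t ^ 4) 40.
- lra.
- move=> t ht; split; auto_derive => //; rewrite ?INR_2 ?INR_3; try field; try lra;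
    by repeat split; try apply/Rgt_not_eq; do ?apply: Rmult_lt_0_compat; lra.
- move=> t ht; rewrite Rpower_m72; last lra.
  have t4 : 0 < t ^ 4 by apply: pow_lt; lra.
  rewrite /Rdiv Rabs_mult (Rabs_pos_eq (/ _)); last by apply: Rlt_le; exact: Rinv_0_lt_compat.
  rewrite -Rmult_assoc; apply: Rmult_le_compat_r; first by apply: Rlt_le; exact: Rinv_0_lt_compat.
  have := Rabs_ln_le_sqrt ht => /Rabs_le_between hl.
  apply: Rabs_le; have := sqrt_sqrt t ltac:(lra); have := sqrt_pos t; nra.
exists g, C; split => // n n0; have n1 : 1 <= INR n by exact: INR_ge1.
have := h n n0; rewrite [X in Rabs X](_ : _ = \rsum_(k < n) (ln (INR k.+1) / INR k.+1) -
    (ln (INR n + 1 / 2) ^ 2 / 2 + g + (ln (INR n + 1 / 2) - 1) / (24 * (INR n + 1 / 2) ^ 2))) //.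
by field; lra.
Qed.

(** * Riesz means of the divisor functions *)

Lemma Rpower_le_neg (t u e : R) : 0 < t -> t <= u -> 0 <= e ->
  Rpower u (- e) <= Rpower t (- e).
Proof.
move=> ht htu he; rewrite !Rpower_Ropp; apply: Rinv_le_contravar; first exact: Rpower_gt0.
by apply: Rpower_le_base.
Qed.

Lemma third_order_bound (f f1 f2 : R -> R) (a b A : R) : a <= 0 <= b ->
  (forall t, a <= t <= b -> is_derive f t (f1 t) /\ is_derive f1 t (f2 t)) ->
  f 0 = 0 -> f1 0 = 0 -> (forall t, a <= t <= b -> Rabs (f2 t) <= A * Rabs t) ->
  forall t, a <= t <= b -> Rabs (f t) <= A * Rabs t ^ 3.
Proof.
move=> hab hd h0 h1 h2.
have seg (g g' : R -> R) t M : g 0 = 0 -> a <= t <= b ->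
    (forall u, a <= u <= b -> is_derive g u (g' u)) ->
    (forall u, a <= u <= b -> Rabs u <= Rabs t -> Rabs (g' u) <= M) ->
    Rabs (g t) <= M * Rabs t.
  move=> g0 ht hg hM; have [h|h] := Rle_dec 0 t.
    have := @MVT_abs_le g g' 0 t M h (fun u hu => hg u ltac:(lra)).
    rewrite g0 Rminus_0_r Rminus_0_r (Rabs_pos_eq t) //; apply => u hu.
    by apply: hM; [lra | rewrite !Rabs_pos_eq; lra].
  have := @MVT_abs_le g g' t 0 M ltac:(lra) (fun u hu => hg u ltac:(lra)).
  rewrite g0 Rminus_0_l Rabs_Ropp Rminus_0_l (Rabs_left t); last lra.
  apply => u hu; apply: hM; first lra.
  by rewrite (Rabs_left t) 1?Rabs_left1; lra.
move=> t ht.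
have hA : 0 <= A \/ t = 0.
  have [->|ne] := Req_dec t 0; first by right.
  left; have := h2 t ht; have := Rabs_pos (f2 t); have := Rabs_pos_lt t ne.
  by move=> p1 p2 p3; apply: (Rmult_le_reg_r (Rabs t)) => //; lra.
case: hA => [hA|->]; last by rewrite h0 Rabs_R0; lra.
have -> : A * Rabs t ^ 3 = (A * Rabs t * Rabs t) * Rabs t by ring.
apply: (seg f f1) => // [u hu|u hu hut]; first by have [] := hd u hu.
apply: Rle_trans (_ : A * Rabs t * Rabs u <= _); last first.
  by apply: Rmult_le_compat_l => //; apply: Rmult_le_pos => //; exact: Rabs_pos.
have hdu s : a <= s <= b -> is_derive f1 s (f2 s) by move=> hs; have [] := hd s hs.
apply: (seg f1 f2) => // s hs hsu; apply: Rle_trans (h2 s hs) _.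
by apply: Rmult_le_compat_l; lra.
Qed.

Lemma rsum_trunc (n N : nat) (F : nat -> R) : (n <= N)%N ->
  \rsum_(b < N) (ind (b < n)%N * F b) = \rsum_(b < n) F b.
Proof.
move=> h; rewrite -(subnKC h) (rsum_split _ _ (fun b => ind (b < n)%N * F b)).
rewrite [X in _ + X]big1 ?Rplus_0_r => [|i _].
  by apply: eq_bigr => i _; rewrite ltn_ord /ind Rmult_1_l.
by rewrite ltnNge leq_addr /ind Rmult_0_l.
Qed.

Lemma rsum_INRS (n : nat) : \rsum_(b < n) INR b.+1 = INR n * (INR n + 1) / 2.
Proof.
elim: n => [|n IH]; first by rewrite rsum0 /INR; field.
by rewrite (rsum_recr _ (fun b => INR b.+1)) IH S_INR; field.
Qed.

(** * Positive parts and the hyperbola method in two and three factors *)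

Definition pos (x : R) : R := Rmax 0 x.

Lemma pos_eq (x : R) : 0 <= x -> pos x = x.
Proof. exact: Rmax_right. Qed.

Lemma pos_eq0 (x : R) : x <= 0 -> pos x = 0.
Proof. exact: Rmax_left. Qed.

Lemma pos_scal (c x : R) : 0 <= c -> pos (c * x) = c * pos x.
Proof. by move=> hc; rewrite /pos -RmaxRmult // Rmult_0_r. Qed.

(** With [n = X - {X}] the sum is [n X - n (n + 1) / 2]; the mixed term [X {X}] cancels, and what
    remains of the fractional part is [B_2]. This cancellation is the gain of a Riesz mean over a
    plain sum. *)
Lemma rsum_pos_linear (X : R) (N : nat) : 0 <= X <= INR N ->
  \rsum_(c < N) pos (X - INR c.+1) = X ^ 2 / 2 - X / 2 + 1 / 12 - bern2 (frac X) / 2.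
Proof.
move=> hX; set n := nat_floor X.
have hn := nat_floor_le (proj1 hX); have hn' := nat_floor_gt X; rewrite -/n in hn hn'.
have nN : (n <= N)%N by apply: INR_leq; lra.
rewrite (eq_bigr (fun c : 'I_N => ind (c < n)%N * (X - INR c.+1))); last first.
  move=> c _; case: ltnP => hc; rewrite /ind; last first.
    rewrite Rmult_0_l pos_eq0 //; have := leq_INR hc; rewrite S_INR; lra.
  rewrite Rmult_1_l pos_eq //; have := leq_INR hc; lra.
rewrite (rsum_trunc (fun c => X - INR c.+1) nN) rsumB rsum_const rsum_INRS.
by rewrite /bern2 /frac -/n; field.
Qed.

Lemma rsum_pos_scaled (T m : R) (N : nat) : 0 < m -> 0 <= T / m <= INR N ->
  \rsum_(c < N) pos (T - m * INR c.+1) =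
  m * ((T / m) ^ 2 / 2 - T / m / 2 + 1 / 12 - bern2 (frac (T / m)) / 2).
Proof.
move=> hm hT; rewrite -(rsum_pos_linear hT) big_distrr; apply: eq_bigr => c _ /=.
by rewrite -pos_scal; [congr pos; field; lra | lra].
Qed.

(** For [x <= N] this is [\sum_(m <= x) (x - m)] over the divisor function. The positive part
    replaces the condition [b c <= x], so that the index set is a fixed square. *)
Definition riesz2 (N : nat) (x : R) : R :=
  \rsum_(b < N) \rsum_(c < N) pos (x - INR b.+1 * INR c.+1).

Lemma riesz2_hyperbola (x : R) (n N : nat) : INR n ^ 2 <= x < (INR n + 1) ^ 2 ->
  x <= INR N ->
  riesz2 N x = x ^ 2 * \rsum_(k < n) / INR k.+1 - x * INR n + INR n * (INR n + 1) / 12 -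
    \rsum_(b < n) (INR b.+1 * bern2 (frac (x / INR b.+1))) -
    x * INR n ^ 2 + (INR n * (INR n + 1) / 2) ^ 2.
Proof.
move=> hx hN; have n0 := pos_INR n.
have x0 : 0 <= x by apply: Rle_trans (proj1 hx); exact: pow2_ge_0.
have nN : (n <= N)%N.
  case: (posnP n) => [->//|npos]; have n1 := INR_ge1 npos.
  by apply: INR_leq; nra.
pose s b := ind (b < n)%N.
pose P b c := pos (x - INR b.+1 * INR c.+1).
have e b c : P b c = s b * P b c + s c * P b c - s b * (s c * P b c).
  rewrite /s; case: ltnP => hb; case: ltnP => hc; rewrite /ind; try ring.
  suff -> : P b c = 0 by ring.
  apply: pos_eq0; have := leq_INR hb; have := leq_INR hc; rewrite !S_INR => hc' hb'.
  have : (INR n + 1) * (INR n + 1) <= (INR b + 1) * (INR c + 1).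
    by apply: Rmult_le_compat; lra.
  lra.
have hsym : \rsum_(b < N) \rsum_(c < N) (s c * P b c) = \rsum_(b < n) \rsum_(c < N) P b c.
  rewrite exchange_big -(rsum_trunc (fun b => \rsum_(c < N) P b c) nN).
  apply: eq_bigr => b _; rewrite -big_distrr /=; congr (_ * _).
  by apply: eq_bigr => c _; rewrite /P Rmult_comm.
have h1 : riesz2 N x = 2 * \rsum_(b < n) \rsum_(c < N) P b c - \rsum_(b < n) \rsum_(c < n) P b c.
  have -> : riesz2 N x = \rsum_(b < N) (s b * \rsum_(c < N) P b c) +
      \rsum_(b < N) \rsum_(c < N) (s c * P b c) -
      \rsum_(b < N) (s b * \rsum_(c < N) (s c * P b c)).
    rewrite -big_split -rsumB; apply: eq_bigr => b _ /=.
    rewrite !big_distrr -big_split -rsumB; apply: eq_bigr => c _ /=; exact: e.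
  rewrite hsym (rsum_trunc (fun b => \rsum_(c < N) P b c) nN).
  rewrite (rsum_trunc (fun b => \rsum_(c < N) (s c * P b c)) nN).
  have -> : \rsum_(b < n) \rsum_(c < N) (s c * P b c) = \rsum_(b < n) \rsum_(c < n) P b c.
    by apply: eq_bigr => b _; rewrite (rsum_trunc (P b) nN).
  rewrite /=; ring.
rewrite h1.
have -> : \rsum_(b < n) \rsum_(c < N) P b c = x ^ 2 / 2 * \rsum_(k < n) / INR k.+1 -
    x / 2 * INR n + 1 / 12 * (INR n * (INR n + 1) / 2) -
    1 / 2 * \rsum_(b < n) (INR b.+1 * bern2 (frac (x / INR b.+1))).
  rewrite -rsum_INRS -(Rmult_comm (INR n)) -rsum_const -!rsumZ -rsumB -big_split -rsumB.
  apply: eq_bigr => b _ /=; have hb := INRS_gt0 b; have hb1 := INRS_ge1 b.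
  rewrite rsum_pos_scaled //; first by field; lra.
  split; first by apply: Rdiv_le_0_compat.
  by apply: Rdiv_leI => //; have := pos_INR N; nra.
have -> : \rsum_(b < n) \rsum_(c < n) P b c = x * INR n ^ 2 - (INR n * (INR n + 1) / 2) ^ 2.
  rewrite (eq_bigr (fun b : 'I_n => INR n * x - INR b.+1 * (INR n * (INR n + 1) / 2))).
    by rewrite rsumB rsum_const -big_distrl rsum_INRS /=; field.
  move=> b _; rewrite -rsum_INRS -rsumZ -rsum_const -rsumB; apply: eq_bigr => c _.
  rewrite /P pos_eq //; have := leq_INR (ltn_ord b); have := leq_INR (ltn_ord c).
  have := INRS_gt0 b; have := INRS_gt0 c => p1 p2 p3 p4.
  by have := Rmult_le_compat _ _ _ _ (Rlt_le _ _ p2) (Rlt_le _ _ p1) p4 p3; lra.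
field.
Qed.

Lemma Rabs_ln_le (w k : R) : 0 < k <= 1 -> k <= w -> Rabs (ln w) <= / k * Rabs (w - 1).
Proof.
move=> hk hw; have w0 : 0 < w by lra.
have h1 := ln_le_sub1 w0.
have h2 := @ln_le_sub1 (/ w) ltac:(exact: Rinv_0_lt_compat).
rewrite ln_Rinv // in h2.
have ik : 1 <= / k by rewrite -[X in X <= _]Rinv_1; apply: Rinv_le_contravar; lra.
have h3 : / w - 1 = / w * (1 - w) by field; lra.
have [h|h] := Rle_dec 1 w.
  rewrite !Rabs_pos_eq; [|lra|exact: ln_ge0].
  by have := Rmult_le_compat_r (w - 1) _ _ ltac:(lra) ik; lra.
have l0 : ln w <= 0 by rewrite -ln_1; apply: ln_le; lra.
rewrite (Rabs_left1 (ln w)) // (Rabs_left (w - 1)); last lra.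
have h4 : / w <= / k by apply: Rinv_le_contravar; lra.
by have := Rmult_le_compat_r (1 - w) _ _ ltac:(lra) h4; lra.
Qed.

(* With [w = x / (n + 1/2)^2] this is the combination of the non-harmonic terms of
   [riesz2_hyperbola] that measures the distance of [n + 1/2] to [sqrt x]. *)
Lemma sqrt_cut_bound (w : R) : 4 / 9 <= w <= 16 / 9 ->
  Rabs (- (1 / 2) * w ^ 2 * ln w + 3 / 4 * w ^ 2 - w + 1 / 4) <= 9 / 4 * Rabs (w - 1) ^ 3.
Proof.
move=> hw.
have := @third_order_bound (fun t => - (1 / 2) * (1 + t) ^ 2 * ln (1 + t) +
   3 / 4 * (1 + t) ^ 2 - (1 + t) + 1 / 4) (fun t => - (1 + t) * ln (1 + t) + t)
   (fun t => - ln (1 + t)) (- (5 / 9)) (7 / 9) (9 / 4) ltac:(lra).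
have e : 1 + (w - 1) = w by ring.
move=> /(_ _ _ _ _ (w - 1)); rewrite e; apply; last lra.
- move=> t ht; split; auto_derive; rewrite ?INR_2; try lra; field; lra.
- by rewrite !Rplus_0_r ln_1; field.
- by rewrite !Rplus_0_r ln_1; ring.
move=> t ht; rewrite Rabs_Ropp; have := @Rabs_ln_le (1 + t) (4 / 9) ltac:(lra) ltac:(lra).
have -> : 1 + t - 1 = t by ring.
have -> : / (4 / 9) = 9 / 4 by field.
by [].
Qed.

Lemma sqrt_eq_Rpower (x : R) : 0 < x -> sqrt x = Rpower x (1 / 2).
Proof. by move=> hx; rewrite -Rpower_sqrt //; congr Rpower; field. Qed.

Lemma riesz2_asymptotic (g CH : R) : 0 <= CH ->
  harmonic_bound g CH ->
  exists C, 0 <= C /\ forall x N, 1 <= x -> x <= INR N ->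
    Rabs (riesz2 N x - (x ^ 2 / 2 * ln x + (g - 3 / 4) * x ^ 2 + x / 4)) <=
    C * Rpower x (3 / 4) * (1 + ln x).
Proof.
move=> hCH hH; exists (CH * Rpower (3 / 4) (- (5 / 2)) + 102 + 20); split.
  by have := Rpower_ge0 (3 / 4) (- (5 / 2)); nra.
move=> x N x1 xN; set n := nat_floor (sqrt x).
have s1 : 1 <= sqrt x by rewrite -sqrt_1; apply: sqrt_le_1_alt.
have ss := sqrt_sqrt x ltac:(lra).
have lnx : 0 <= ln x by exact: ln_ge0.
have ns : INR n <= sqrt x by apply: nat_floor_le; lra.
have ns' : sqrt x < INR n + 1 := nat_floor_gt _.
have n1 : (0 < n)%N by apply/leq_nat_floor; rewrite ?INR_1; lra.
have n1' := INR_ge1 n1.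
have hx : INR n ^ 2 <= x < (INR n + 1) ^ 2 by nra.
rewrite (riesz2_hyperbola hx xN).
have hB := @bern2_sum x n x1 (proj1 hx).
have {}hH := hH n n1.
set B := (\rsum_(b < n) _) in hB *; set H := (\rsum_(k < n) _) in hH *.
set v := INR n + 1 / 2 in hH *.
have nv : INR n = v - 1 / 2 by rewrite /v; ring.
rewrite nv in hx ns ns' n1' *; have v0 : 3 / 2 <= v by lra.
set eH := H - _ in hH; have HE : H = ln v + g + / (24 * v ^ 2) + eH by rewrite /eH; ring.
set w := x / v ^ 2; have v2 : 0 < v ^ 2 by apply: pow_lt; lra.
have xw : x = w * v ^ 2 by rewrite /w; field; lra.
have w1 : 4 / 9 <= w by apply: Rle_divI => //; nra.
have w2 : w <= 16 / 9 by apply: Rdiv_leI => //; nra.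
(* From [|sqrt x - v| <= 1/2] one gets [|x - v^2| <= v + 1/4], and [1/4 <= v / 6] because
   [v >= 3/2]. *)
have dw : Rabs (w - 1) <= 7 / 6 / v.
  have -> : w - 1 = (x - v ^ 2) / v / v by rewrite /w; field; lra.
  rewrite /Rdiv Rabs_mult (Rabs_pos_eq (/ v)); last by apply: Rlt_le; apply: Rinv_0_lt_compat; lra.
  apply: Rmult_le_compat_r; first by apply: Rlt_le; apply: Rinv_0_lt_compat; lra.
  apply: Rabs_le; split.
    by apply: Rle_divI; [lra | nra].
  by apply: Rdiv_leI; [lra | nra].
have lnw : ln x = ln w + 2 * ln v.
  rewrite xw ln_mult //; last lra.
  by rewrite -(Rpower_natr 2) ?ln_exp ?INR_2 //; lra.
(* In the variables [v] and [w] everything except the two error sums is [v^4] times the function of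
   [sqrt_cut_bound], which is [O(v^-3)], plus terms that are [O(v)]. *)
have key : x ^ 2 * H - x * (v - 1 / 2) + (v - 1 / 2) * (v - 1 / 2 + 1) / 12 - B -
    x * (v - 1 / 2) ^ 2 + ((v - 1 / 2) * (v - 1 / 2 + 1) / 2) ^ 2 -
    (x ^ 2 / 2 * ln x + (g - 3 / 4) * x ^ 2 + x / 4) =
    x ^ 2 * eH - B +
    (v ^ 4 * (- (1 / 2) * w ^ 2 * ln w + 3 / 4 * w ^ 2 - w + 1 / 4) +
     (v ^ 2 * (w ^ 2 - 1) / 24 - 1 / 192)).
  by rewrite HE lnw xw; field; lra.
rewrite key.
have px : Rpower x (1 / 2) = sqrt x by rewrite sqrt_eq_Rpower //; lra.
have px1 : sqrt x <= Rpower x (3 / 4).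
  by rewrite -px; apply: Rpower_le_exp; lra.
have p0 := Rpower_ge0 x (3 / 4).
have b1 : Rabs (x ^ 2 * eH) <= CH * Rpower (3 / 4) (- (5 / 2)) * Rpower x (3 / 4).
  rewrite Rabs_mult Rabs_pos_eq; last exact: pow2_ge_0.
  apply: Rle_trans (Rmult_le_compat_l _ _ _ (pow2_ge_0 x) hH) _.
  have h1 : Rpower v (- (5 / 2)) <= Rpower (3 / 4) (- (5 / 2)) * Rpower (sqrt x) (- (5 / 2)).
    rewrite -Rpower_mulE; [|lra|lra]; apply: Rpower_le_neg; try lra.
  have h2 : x ^ 2 * Rpower (sqrt x) (- (5 / 2)) = Rpower x (3 / 4).
    rewrite -px Rpower_mult -(Rpower_natr 2); last lra.
    by rewrite -Rpower_plus INR_2; congr Rpower; field.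
  rewrite -h2; have q0 := Rpower_ge0 (3 / 4) (- (5 / 2)).
  have h3 := Rmult_le_compat_l _ _ _ (Rmult_le_pos _ _ (pow2_ge_0 x) hCH) h1; lra.
have b2 : Rabs B <= 102 * Rpower x (3 / 4) * (1 + ln x).
  apply: Rle_trans hB _; apply: Rmult_le_compat_r; first lra.
  apply: Rmult_le_compat_l; first lra.
  have -> : Rpower x (3 / 4) = sqrt (x * sqrt x).
    rewrite sqrt_eq_Rpower; last by apply: Rmult_lt_0_compat; lra.
    rewrite Rpower_mulE; [|lra|lra]; rewrite -px Rpower_mult -Rpower_plus.
    by congr Rpower; field.
  by apply: sqrt_le_1_alt; apply: Rmult_le_compat_l; rewrite ?nv; lra.
have v4 : 0 < v ^ 4 by apply: pow_lt; lra.
have b3 : Rabs (v ^ 4 * (- (1 / 2) * w ^ 2 * ln w + 3 / 4 * w ^ 2 - w + 1 / 4)) <= 4 * v.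
  rewrite Rabs_mult Rabs_pos_eq; last lra.
  have h1 := @sqrt_cut_bound w (conj w1 w2).
  have h2 : Rabs (w - 1) ^ 3 <= (7 / 6 / v) ^ 3.
    by apply: pow_incr; split => //; exact: Rabs_pos.
  apply: Rle_trans (Rmult_le_compat_l _ _ (9 / 4 * (7 / 6 / v) ^ 3) (Rlt_le _ _ v4) _) _; first lra.
  have -> : v ^ 4 * (9 / 4 * (7 / 6 / v) ^ 3) = 9 / 4 * (7 / 6) ^ 3 * v by field; lra.
  lra.
have b4 : Rabs (v ^ 2 * (w ^ 2 - 1) / 24 - 1 / 192) <= v.
  have h1 : Rabs (v ^ 2 * (w ^ 2 - 1) / 24) <= 7 / 36 * v.
    have -> : v ^ 2 * (w ^ 2 - 1) / 24 = (w - 1) * (v ^ 2 * (w + 1) / 24) by field.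
    rewrite Rabs_mult (Rabs_pos_eq (v ^ 2 * _ / _)); last by nra.
    apply: Rle_trans (Rmult_le_compat _ (7 / 6 / v) _ (v ^ 2 * (16 / 9 + 1) / 24) (Rabs_pos _) _ dw _) _.
    - by nra.
    - by nra.
    have -> : 7 / 6 / v * (v ^ 2 * (16 / 9 + 1) / 24) = 7 / 6 * (25 / 9) / 24 * v by field; lra.
    lra.
  apply: Rle_trans (Rabs_sub_le _ _) _; rewrite (Rabs_pos_eq (1 / 192)); lra.
have vs : v <= 3 / 2 * sqrt x by lra.
apply: Rle_trans (Rabs_triang _ _) _.
have t1 := Rabs_sub_le (x ^ 2 * eH) B.
have t2 := Rabs_triang (v ^ 4 * (- (1 / 2) * w ^ 2 * ln w + 3 / 4 * w ^ 2 - w + 1 / 4))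
   (v ^ 2 * (w ^ 2 - 1) / 24 - 1 / 192).
have q0 := Rmult_le_pos _ _ hCH (Rpower_ge0 (3 / 4) (- (5 / 2))).
have q1 := Rmult_le_pos _ _ p0 lnx.
have q2 := Rmult_le_pos _ _ q0 q1.
set D := CH * Rpower (3 / 4) (- (5 / 2)) in b1 q0 q2 *.
nra.
Qed.

Lemma exp_le (x y : R) : x <= y -> exp x <= exp y.
Proof. by move=> [h|->]; [apply: Rlt_le; exact: exp_increasing | lra]. Qed.

Definition riesz3 (N : nat) (T : R) : R :=
  \rsum_(a < N) \rsum_(b < N) \rsum_(c < N) pos (T - INR a.+1 * INR b.+1 * INR c.+1).

(** Three factors above [n] have a product above [T], so inclusion-exclusion over which factors are
    at most [n] is exact; by symmetry only the number of small factors matters. Fixing one factor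
    [a] leaves a scaled [riesz2] at [T / a]. *)
Lemma riesz3_hyperbola (T : R) (n N : nat) : INR n ^ 3 <= T < (INR n + 1) ^ 3 ->
  T <= INR N ->
  riesz3 N T = 3 * \rsum_(a < n) (INR a.+1 * riesz2 N (T / INR a.+1)) -
    3 * \rsum_(a < n) \rsum_(b < n) \rsum_(c < N) pos (T - INR a.+1 * INR b.+1 * INR c.+1) +
    (T * INR n ^ 3 - (INR n * (INR n + 1) / 2) ^ 3).
Proof.
move=> hT hN; have n0 := pos_INR n.
have T0 : 0 <= T by apply: Rle_trans (proj1 hT); exact: pow_le.
have nN : (n <= N)%N.
  case: (posnP n) => [->//|npos]; have n1 := INR_ge1 npos.
  apply: INR_leq; have : INR n <= INR n ^ 3 by nra.
  lra.
pose s b := ind (b < n)%N.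
pose P a b c := pos (T - INR a.+1 * INR b.+1 * INR c.+1).
pose S (f : nat -> nat -> nat -> R) := \rsum_(a < N) \rsum_(b < N) \rsum_(c < N) f a b c.
have Sext f g : (forall a b c, f a b c = g a b c) -> S f = S g.
  by move=> h; do 3 (apply: eq_bigr => ? _).
have SD f g : S (fun a b c => f a b c + g a b c) = S f + S g.
  by rewrite /S -big_split; do 2 (apply: eq_bigr => ? _; rewrite -big_split).
have SN f : S (fun a b c => - f a b c) = - S f.
  by rewrite /S -rsumN; do 2 (apply: eq_bigr => ? _; rewrite -rsumN).
have sw12 f : S (fun a b c => f b a c) = S f by rewrite /S exchange_big.
have sw23 f : S (fun a b c => f a c b) = S f by apply: eq_bigr => a _; rewrite exchange_big.
have P12 a b c : P b a c = P a b c by rewrite /P; congr pos; ring.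
have P23 a b c : P a c b = P a b c by rewrite /P; congr pos; ring.
pose T1 := \rsum_(a < n) \rsum_(b < N) \rsum_(c < N) P a b c.
pose T2 := \rsum_(a < n) \rsum_(b < n) \rsum_(c < N) P a b c.
pose T3 := \rsum_(a < n) \rsum_(b < n) \rsum_(c < n) P a b c.
have e1 : S (fun a b c => s a * P a b c) = T1.
  rewrite /T1 -(rsum_trunc (fun a => \rsum_(b < N) \rsum_(c < N) P a b c) nN).
  apply: eq_bigr => a _; rewrite big_distrr; apply: eq_bigr => b _ /=.
  by rewrite big_distrr.
have e2 : S (fun a b c => s a * (s b * P a b c)) = T2.
  rewrite /T2 -(rsum_trunc (fun a => \rsum_(b < n) \rsum_(c < N) P a b c) nN).
  apply: eq_bigr => a _; rewrite -(rsum_trunc (fun b => \rsum_(c < N) P a b c) nN).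
  rewrite big_distrr; apply: eq_bigr => b _ /=.
  by rewrite !big_distrr.
have e3 : S (fun a b c => s a * (s b * (s c * P a b c))) = T3.
  rewrite /T3 -(rsum_trunc (fun a => \rsum_(b < n) \rsum_(c < n) P a b c) nN).
  apply: eq_bigr => a _; rewrite -(rsum_trunc (fun b => \rsum_(c < n) P a b c) nN).
  rewrite big_distrr; apply: eq_bigr => b _ /=.
  by rewrite -(rsum_trunc (P a b) nN) !big_distrr.
have f1 : S (fun a b c => s b * P a b c) = T1.
  by rewrite -e1 -sw12; apply: Sext => a b c; rewrite P12.
have g1 : S (fun a b c => s c * P a b c) = T1.
  by rewrite -f1 -sw23; apply: Sext => a b c; rewrite P23.
have f2 : S (fun a b c => s a * (s c * P a b c)) = T2.
  by rewrite -e2 -sw23; apply: Sext => a b c; rewrite P23.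
have g2 : S (fun a b c => s b * (s c * P a b c)) = T2.
  by rewrite -f2 -sw12; apply: Sext => a b c; rewrite P12.
have split : riesz3 N T = 3 * T1 - 3 * T2 + T3.
  have -> : riesz3 N T = S (fun a b c => ((((((s a * P a b c) + (s b * P a b c)) + s c * P a b c) +
      - (s a * (s b * P a b c))) + - (s a * (s c * P a b c))) + - (s b * (s c * P a b c))) +
      s a * (s b * (s c * P a b c))).
    rewrite -[riesz3 N T]/(S P); apply: Sext => a b c; rewrite /s.
    case: ltnP => ha; case: ltnP => hb; case: ltnP => hc; rewrite /ind; try ring.
    have -> : P a b c = 0; last ring.
    apply: pos_eq0; have := leq_INR ha; have := leq_INR hb; have := leq_INR hc.
    rewrite !S_INR => hc' hb' ha'.
    have h1 : (INR n + 1) * (INR n + 1) <= (INR a + 1) * (INR b + 1).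
      by apply: Rmult_le_compat; lra.
    have h2 : (INR n + 1) * (INR n + 1) * (INR n + 1) <= (INR a + 1) * (INR b + 1) * (INR c + 1).
      by apply: Rmult_le_compat; nra.
    lra.
  rewrite !SD !SN e1 f1 g1 e2 f2 g2 e3; ring.
rewrite split; congr (_ - _ + _).
  congr (_ * _); apply: eq_bigr => a _; rewrite /riesz2 big_distrr; apply: eq_bigr => b _ /=.
  rewrite big_distrr; apply: eq_bigr => c _ /=; have ha := INRS_gt0 a.
  by rewrite -pos_scal; [rewrite /P; congr pos; field; lra | lra].
have -> : T3 = \rsum_(a < n) \rsum_(b < n) (INR n * T - INR a.+1 * INR b.+1 * (INR n * (INR n + 1) / 2)).
  apply: eq_bigr => a _; apply: eq_bigr => b _.
  rewrite -rsum_INRS -rsumZ -rsum_const -rsumB; apply: eq_bigr => c _.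
  rewrite /P pos_eq //; have := leq_INR (ltn_ord a); have := leq_INR (ltn_ord b).
  have := leq_INR (ltn_ord c).
  have := INRS_gt0 a; have := INRS_gt0 b; have := INRS_gt0 c => p1 p2 p3 p4 p5 p6.
  have h1 := Rmult_le_compat _ _ _ _ (Rlt_le _ _ p3) (Rlt_le _ _ p2) p6 p5.
  have p7 := Rmult_lt_0_compat _ _ p3 p2.
  have h2 := Rmult_le_compat _ _ _ _ (Rlt_le _ _ p7) (Rlt_le _ _ p1) h1 p4.
  lra.
rewrite (eq_bigr (fun a : 'I_n => INR n * (INR n * T) - INR a.+1 * (INR n * (INR n + 1) / 2) ^ 2)).
  by rewrite rsumB rsum_const -big_distrl rsum_INRS /=; field.
move=> a _; rewrite rsumB rsum_const; congr (_ - _).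
have -> : INR a.+1 * (INR n * (INR n + 1) / 2) ^ 2 =
   INR a.+1 * (INR n * (INR n + 1) / 2) * (INR n * (INR n + 1) / 2) by ring.
by rewrite -{2}rsum_INRS -rsumZ big_distrl.
Qed.

(* With [e = ln (T / (n + 1/2)^3)] this is the combination of the non-harmonic terms of
   [riesz3_hyperbola] that measures the distance of [n + 1/2] to the cube root of [T]. *)
Lemma cbrt_cut_bound (e : R) : ln (8 / 27) <= e <= ln (64 / 27) ->
  Rabs (- e ^ 2 / 4 + 3 / 4 * e + exp (- e) - exp (- e) ^ 2 / 8 - 7 / 8) <= 6 * Rabs e ^ 3.
Proof.
have l1 : ln (8 / 27) < 0 by rewrite -ln_1; apply: ln_increasing; lra.
have l2 : 0 < ln (64 / 27) by rewrite -ln_1; apply: ln_increasing; lra.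
move=> he; apply: (@third_order_bound (fun e => - e ^ 2 / 4 + 3 / 4 * e + exp (- e) -
   exp (- e) ^ 2 / 8 - 7 / 8) (fun e => - e / 2 + 3 / 4 - exp (- e) + exp (- e) ^ 2 / 4)
   (fun e => - (1 - exp (- e)) ^ 2 / 2) (ln (8 / 27)) (ln (64 / 27)) 6) => //.
- lra.
- by move=> t _; split; auto_derive => //; rewrite ?INR_2; field.
- by rewrite Ropp_0 exp_0; field.
- by rewrite Ropp_0 exp_0; field.
move=> t ht.
have e1 : exp (- t) <= 27 / 8.
  have -> : 27 / 8 = exp (- ln (8 / 27)).
    rewrite exp_Ropp exp_ln; [by field | lra].
  by apply: exp_le; lra.
have e0 := exp_pos (- t).
have h1 : 1 - exp (- t) <= t by have := exp_ineq1_le (- t); lra.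
have h2 : exp (- t) - 1 <= 27 / 8 * Rabs t /\ 1 - exp (- t) <= 27 / 8 * Rabs t.
  split; last by have := Rle_abs t; have := Rabs_pos t; lra.
  have h3 : exp (- t) * (1 + t) <= 1.
    apply: Rle_trans (Rmult_le_compat_l _ _ _ (Rlt_le _ _ e0) (exp_ineq1_le t)) _.
    by rewrite -exp_plus Rplus_opp_l exp_0; lra.
  have h4 : - t <= Rabs t by have := Rle_abs (- t); rewrite Rabs_Ropp.
  have h5 : exp (- t) * (- t) <= 27 / 8 * Rabs t.
    apply: Rle_trans (_ : exp (- t) * Rabs t <= _); first by apply: Rmult_le_compat_l; lra.
    by apply: Rmult_le_compat_r; [exact: Rabs_pos | lra].
  lra.
set u := 1 - exp (- t) in h1 h2 *.
have hu : Rabs u <= 27 / 8 * Rabs t by apply: Rabs_le; move: h2; rewrite /u; lra.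
have hu2 : Rabs u <= 3 by apply: Rabs_le; rewrite /u; lra.
have -> : - u ^ 2 / 2 = - (1 / 2 * (u * u)) by field.
rewrite Rabs_Ropp (Rabs_mult (1 / 2)) (Rabs_mult u) (Rabs_pos_eq (1 / 2)); last lra.
have := Rmult_le_compat _ _ _ _ (Rabs_pos u) (Rabs_pos u) hu hu2.
by have := Rabs_pos t; lra.
Qed.

(** For [a, n <= T^(1/3)] both [a (T / a)^(3/4)] and [a sqrt (T n / a)] are at most [T^(5/6)], and
    at most [T^(1/3)] values of [a] are summed. The cut also gives [n^2 <= T / a], as [bern2_sum]
    requires. *)
Lemma riesz3_remainders (T C : R) (n N : nat) (rho : nat -> R) : 0 <= C -> 1 <= T ->
  INR n <= Rpower T (1 / 3) ->
  (forall a, (a < n)%N -> Rabs (rho a) <= C * Rpower (T / INR a.+1) (3 / 4) * (1 + ln (T / INR a.+1))) ->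
  Rabs (\rsum_(a < n) (INR a.+1 * rho a)) <= C * Rpower T (7 / 6) * (1 + ln T) /\
  Rabs (\rsum_(a < n) (INR a.+1 * \rsum_(b < n) (INR b.+1 * bern2 (frac (T / INR a.+1 / INR b.+1))))) <=
    102 * Rpower T (7 / 6) * (1 + ln T).
Proof.
move=> hC T1 hn hrho; set y := Rpower T (1 / 3) in hn.
have y1 : 1 <= y by apply: Rpower_ge1; lra.
have y3 : y ^ 3 = T.
  by rewrite /y -Rpower_natr ?Rpower_mult; [rewrite INR_3 -{2}(Rpower_1 T); [congr Rpower; field | lra] | exact: Rpower_gt0].
have lnT : 0 <= ln T by exact: ln_ge0.
have n0 := pos_INR n.
have p16 : Rpower T (7 / 6) = y * (Rpower T (5 / 6)) by rewrite /y -Rpower_plus; congr Rpower; field.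
have hA a : (a < n)%N -> [/\ 1 <= INR a.+1, INR a.+1 <= y & 0 <= 1 + ln (T / INR a.+1) <= 1 + ln T].
  move=> ha; have a1 := INRS_ge1 a; have ay : INR a.+1 <= y.
    by apply: Rle_trans hn; exact: leq_INR.
  have aT : INR a.+1 <= T by rewrite -y3; nra.
  split => //; rewrite ln_div; try lra.
  have := ln_le (INR a.+1) T ltac:(lra) aT; have := ln_ge0 a1; lra.
have fin (c : R) (F : nat -> R) : 0 <= c ->
   (forall a, (a < n)%N -> Rabs (F a) <= c * Rpower T (5 / 6) * (1 + ln T)) ->
   Rabs (\rsum_(a < n) F a) <= c * Rpower T (7 / 6) * (1 + ln T).
  move=> hc hF; apply: Rle_trans (Rabs_rsum_le _ (G := fun=> c * Rpower T (5 / 6) * (1 + ln T)) _) _.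
    by move=> a _; exact: hF.
  rewrite rsum_const p16.
  have p0 := Rpower_ge0 T (5 / 6).
  have : 0 <= c * Rpower T (5 / 6) * (1 + ln T) by apply: Rmult_le_pos; [exact: Rmult_le_pos | lra].
  by move=> h; have := Rmult_le_compat_r _ _ _ h hn; lra.
split.
  apply: (fin C (fun a => INR a.+1 * rho a)) => // a ha; have [a1 ay [l0 l1]] := hA a ha.
  rewrite Rabs_mult Rabs_pos_eq; last lra.
  apply: Rle_trans (Rmult_le_compat_l _ _ _ _ (hrho a ha)) _; first lra.
  rewrite -Rmult_assoc; apply: Rmult_le_compat => //.
    by apply: Rmult_le_pos; [lra | apply: Rmult_le_pos => //; exact: Rpower_ge0].
  rewrite -Rmult_assoc (Rmult_comm _ C) Rmult_assoc; apply: Rmult_le_compat_l => //.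
  rewrite Rpower_div; try lra.
  have -> : INR a.+1 * (Rpower T (3 / 4) * Rpower (INR a.+1) (- (3 / 4))) =
     Rpower (INR a.+1) (1 / 4) * Rpower T (3 / 4).
    rewrite -{1}(Rpower_1 (INR a.+1)); last lra.
    rewrite (Rmult_comm (Rpower T _)) -Rmult_assoc -Rpower_plus; congr (Rpower _ _ * _); field.
  have -> : Rpower T (5 / 6) = Rpower y (1 / 4) * Rpower T (3 / 4).
    by rewrite /y Rpower_mult -Rpower_plus; congr Rpower; field.
  apply: Rmult_le_compat_r; first exact: Rpower_ge0.
  by apply: Rpower_le_base; lra.
apply: (fin 102 (fun a => INR a.+1 * \rsum_(b < n) (INR b.+1 * bern2 (frac (T / INR a.+1 / INR b.+1))))).
  lra.
move=> a ha; have [a1 ay [l0 l1]] := hA a ha.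
rewrite Rabs_mult Rabs_pos_eq; last lra.
have hq : INR n ^ 2 <= T / INR a.+1.
  apply: Rle_divI; first lra.
  rewrite -y3; have -> : y ^ 3 = y ^ 2 * y by ring.
  by apply: Rmult_le_compat; [exact: pow2_ge_0 | lra | apply: pow_incr | ].
have hT1 : 1 <= T / INR a.+1 by apply: Rle_divI; [lra | rewrite -y3; nra].
apply: Rle_trans (Rmult_le_compat_l _ _ _ _ (bern2_sum hT1 hq)) _; first lra.
rewrite -Rmult_assoc; apply: Rmult_le_compat => //.
  by apply: Rmult_le_pos; [lra | apply: Rmult_le_pos; [lra | exact: sqrt_pos]].
rewrite -Rmult_assoc (Rmult_comm _ 102) Rmult_assoc; apply: Rmult_le_compat_l; first lra.
have -> : Rpower T (5 / 6) = sqrt (T * (y * y)).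
  rewrite sqrt_eq_Rpower; last by nra.
  rewrite /y -Rpower_plus Rpower_mulE; [|lra|exact: Rpower_gt0].
  by rewrite Rpower_mult -Rpower_plus; congr Rpower; field.
rewrite -{1}(sqrt_square (INR a.+1)); last lra.
rewrite -sqrt_mult; [|nra|]; last first.
  by apply: Rmult_le_pos => //; lra.
apply: sqrt_le_1_alt.
have -> : INR a.+1 * INR a.+1 * (T / INR a.+1 * INR n) = T * (INR a.+1 * INR n) by field; lra.
by apply: Rmult_le_compat_l; [lra | apply: Rmult_le_compat; lra].
Qed.

(** With [L = ln T], [T^2] times this is the residue of [zeta(s)^3 T^(s+1) / (s (s+1))] at 1 when
    [zeta(1 + u) = 1/u + g - g1 u + ...]. *)
Definition riesz3_poly (g g1 L : R) : R :=
  L ^ 2 / 4 + (3 / 2 * g - 3 / 4) * L +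
  (- (3 / 2) * g1 + 3 * (g - 3 / 4) * g - 3 / 2 * g ^ 2 + 7 / 8).

Definition riesz3_bound (g g1 : R) : Prop := exists C, 0 <= C /\ forall T N, 1 <= T -> T <= INR N ->
  Rabs (riesz3 N T - T ^ 2 * riesz3_poly g g1 (ln T)) <= C * Rpower T (7 / 6) * (1 + ln T).

(** The sums over [a <= n] of the two-factor asymptotics produce the harmonic sum and its
    logarithmic analogue, which are then expanded at [v = n + 1/2]; the proof checks that the
    dependence on [v] disappears up to the permitted error. *)
Lemma riesz3_asymptotic (g CH g1 CK : R) : 0 <= CH -> 0 <= CK ->
  harmonic_bound g CH ->
  log_harmonic_bound g1 CK ->
  riesz3_bound g g1.
Proof.
move=> hCH hCK hH hK; have [C2 [hC2 h2]] := riesz2_asymptotic hCH hH.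
set c := g - 3 / 4.
pose D := (3 / 2 * CH + 3 / 2 * CK + 3 * Rabs c * CH + 3 / 2 * (2 * (2 + Rabs g) * CH + CH ^ 2)) *
   Rpower (3 / 4) (- (5 / 2)).
have D0 : 0 <= D.
  apply: Rmult_le_pos; last exact: Rpower_ge0.
  have := Rabs_pos c; have := Rabs_pos g; have := pow2_ge_0 CH; nra.
exists (D + 3 * C2 + 153 + 6000); split; first lra.
move=> T N T1 TN; set y := Rpower T (1 / 3); set n := nat_floor y.
have y1 : 1 <= y by apply: Rpower_ge1; lra.
have y3 : y ^ 3 = T.
  by rewrite /y -Rpower_natr ?Rpower_mult; [rewrite INR_3 -{2}(Rpower_1 T); [congr Rpower; field | lra] | exact: Rpower_gt0].
have lnT : 0 <= ln T by exact: ln_ge0.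
have ns : INR n <= y by apply: nat_floor_le; lra.
have ns' : y < INR n + 1 := nat_floor_gt _.
have n1 : (0 < n)%N by apply/leq_nat_floor; rewrite ?INR_1; lra.
have n1' := INR_ge1 n1.
have hT : INR n ^ 3 <= T < (INR n + 1) ^ 3.
  rewrite -y3; split; first by apply: pow_incr; lra.
  by have : y * y < (INR n + 1) * (INR n + 1); nra.
rewrite (riesz3_hyperbola hT TN).
pose rho a := riesz2 N (T / INR a.+1) - ((T / INR a.+1) ^ 2 / 2 * ln (T / INR a.+1) +
   c * (T / INR a.+1) ^ 2 + T / INR a.+1 / 4).
have [hR hB] := @riesz3_remainders T C2 n N rho hC2 T1 ns (fun a ha => h2 (T / INR a.+1) N
   ltac:(apply: Rle_divI; [exact: INRS_gt0 | rewrite Rmult_1_l -y3; have := leq_INR ha; have := INRS_ge1 a; nra])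
   ltac:(apply: Rdiv_leI; [exact: INRS_gt0 | have := INRS_ge1 a; nra])).
have {}hH := hH n n1; have {}hK := hK n n1.
set H := (\rsum_(k < n) / INR k.+1) in hH.
set K := (\rsum_(k < n) (ln (INR k.+1) / INR k.+1)) in hK.
set Rho := (\rsum_(a < n) (INR a.+1 * rho a)) in hR.
set Bt := (\rsum_(a < n) (INR a.+1 * \rsum_(b < n) _)) in hB.
have -> : \rsum_(a < n) (INR a.+1 * riesz2 N (T / INR a.+1)) =
    T ^ 2 / 2 * (ln T * H - K) + c * T ^ 2 * H + T / 4 * INR n + Rho.
  have -> : T ^ 2 / 2 * (ln T * H - K) + c * T ^ 2 * H + T / 4 * INR n + Rho =
    (T ^ 2 / 2 * ln T + c * T ^ 2) * H - T ^ 2 / 2 * K + INR n * (T / 4) + Rho by field.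
  rewrite -rsum_const -!rsumZ -rsumB -!big_split.
  apply: eq_bigr => a _; have ha := INRS_gt0 a.
  by rewrite /rho /= ln_div; [field; lra | lra | lra].
have -> : \rsum_(a < n) \rsum_(b < n) \rsum_(c < N) pos (T - INR a.+1 * INR b.+1 * INR c.+1) =
    T ^ 2 / 2 * H ^ 2 - T / 2 * INR n ^ 2 + (INR n * (INR n + 1) / 2) ^ 2 / 12 - Bt / 2.
  have hr (a : nat) : \rsum_(b < n) (T ^ 2 / 2 * (/ INR a.+1 * / INR b.+1) - T / 2 +
       INR a.+1 * INR b.+1 / 12) = T ^ 2 / 2 * (/ INR a.+1 * H) - INR n * (T / 2) +
       INR a.+1 * (INR n * (INR n + 1) / 2) / 12.
    rewrite -rsum_INRS -!rsumZ -rsum_const -rsumB /Rdiv big_distrl -big_split.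
    by [].
  rewrite (eq_bigr (fun a : 'I_n => (T ^ 2 / 2 * (/ INR a.+1 * H) - INR n * (T / 2) +
       INR a.+1 * (INR n * (INR n + 1) / 2) / 12) - 1 / 2 * (INR a.+1 *
       \rsum_(b < n) (INR b.+1 * bern2 (frac (T / INR a.+1 / INR b.+1)))))); last first.
    move=> a _; rewrite -hr -!rsumZ -rsumB; apply: eq_bigr => b _.
    have ha := INRS_gt0 a; have hb := INRS_gt0 b; have ha1 := INRS_ge1 a; have hb1 := INRS_ge1 b.
    have e : T / (INR a.+1 * INR b.+1) = T / INR a.+1 / INR b.+1 by field; lra.
    rewrite rsum_pos_scaled ?e; first by field; lra.
    - exact: Rmult_lt_0_compat.
    - split; first by apply: Rdiv_le_0_compat => //; apply: Rdiv_le_0_compat => //; lra.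
      rewrite -e; apply: Rdiv_leI; first exact: Rmult_lt_0_compat.
      have : 1 <= INR a.+1 * INR b.+1 by nra.
      by have := pos_INR N; nra.
  have X1 : \rsum_(a < n) (T ^ 2 / 2 * (/ INR a.+1 * H)) = T ^ 2 / 2 * (H * H).
    by rewrite rsumZ -big_distrl.
  have X2 : \rsum_(a < n) (INR a.+1 * (INR n * (INR n + 1) / 2) / 12) =
      (INR n * (INR n + 1) / 2) ^ 2 / 12.
    rewrite (eq_bigr (fun a : 'I_n => INR a.+1 * (INR n * (INR n + 1) / 2 / 12))).
      by rewrite -big_distrl rsum_INRS /=; field.
    by move=> a _; field.
  by rewrite rsumB rsumZ -/Bt big_split rsumB rsum_const X1 X2 /=; field.
move: hR hB hH hK; move: Rho Bt H K => Rho Bt H K hR hB hH hK.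
set v := INR n + 1 / 2 in hH hK *.
have nv : INR n = v - 1 / 2 by rewrite /v; ring.
rewrite nv in hT ns ns' n1' *; have v0 : 3 / 2 <= v by lra.
set e1 := H - _ in hH; have HE : H = ln v + g + / (24 * v ^ 2) + e1 by rewrite /e1; ring.
set e2 := K - _ in hK.
have KE : K = ln v ^ 2 / 2 + g1 + (ln v - 1) / (24 * v ^ 2) + e2 by rewrite /e2; ring.
set w := T / v ^ 3; have v3 : 0 < v ^ 3 by apply: pow_lt; lra.
have v2 : 0 < v ^ 2 by apply: pow_lt; lra.
have Tw : T = w * v ^ 3 by rewrite /w; field; lra.
have w1 : 8 / 27 <= w.
  apply: Rle_divI => //; apply: Rle_trans (proj1 hT).
  have -> : 8 / 27 * v ^ 3 = (2 / 3 * v) ^ 3 by field.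
  by apply: pow_incr; lra.
have w2 : w <= 64 / 27.
  apply: Rdiv_leI => //; apply: Rle_trans (Rlt_le _ _ (proj2 hT)) _.
  have -> : 64 / 27 * v ^ 3 = (4 / 3 * v) ^ 3 by field.
  by apply: pow_incr; lra.
(* The cube root of [T] is within 1/2 of [v >= 3/2], so [|T - v^3| <= (v + 1/2)^3 - v^3 <= 2.1 v^2].
   The constant 71/10 below is 21/10 times 27/8, rounded up. *)
have dw : Rabs (w - 1) <= 21 / 10 / v.
  have -> : w - 1 = (T - v ^ 3) / v ^ 2 / v by rewrite /w; field; lra.
  rewrite /Rdiv Rabs_mult (Rabs_pos_eq (/ v)); last by apply: Rlt_le; apply: Rinv_0_lt_compat; lra.
  apply: Rmult_le_compat_r; first by apply: Rlt_le; apply: Rinv_0_lt_compat; lra.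
  apply: Rabs_le; split.
    by apply: Rle_divI; [lra | nra].
  by apply: Rdiv_leI; [lra | nra].
set eta := ln w.
have deta : Rabs eta <= 71 / 10 / v.
  apply: Rle_trans (@Rabs_ln_le w (8 / 27) ltac:(lra) w1) _.
  have -> : 71 / 10 / v = / (8 / 27) * (8 / 27 * (71 / 10) / v) by field; lra.
  apply: Rmult_le_compat_l; first lra.
  apply: Rle_trans dw _; apply: Rmult_le_compat_r; last lra.
  by apply: Rlt_le; apply: Rinv_0_lt_compat; lra.
have hcut : Rabs (- eta ^ 2 / 4 + 3 / 4 * eta + exp (- eta) - exp (- eta) ^ 2 / 8 - 7 / 8) <=
    6 * Rabs eta ^ 3 by apply: cbrt_cut_bound; split; apply: ln_le; lra.
have ew : exp (- eta) = / w by rewrite exp_Ropp /eta exp_ln //; lra.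
rewrite ew in hcut.
have LE : ln T = eta + 3 * ln v.
  rewrite Tw ln_mult //; last lra.
  by rewrite -(Rpower_natr 3) ?ln_exp ?INR_3 //; lra.
set h := - eta ^ 2 / 4 + 3 / 4 * eta + / w - (/ w) ^ 2 / 8 - 7 / 8 in hcut.
set H0 := ln v + g + / (24 * v ^ 2) in HE.
pose err := 3 / 2 * (ln T * e1 - e2) + 3 * c * e1 - 3 / 2 * (2 * H0 * e1 + e1 ^ 2).
(* [err] collects the errors of the two harmonic expansions, [Rho] and [Bt] are the sums of
   [riesz3_remainders], and the last bracket is [O(T)] because [h] vanishes to third order in
   [eta = O(1/v)]. *)
rewrite [X in Rabs X](_ : _ = T ^ 2 * err + 3 * Rho + 3 / 2 * Bt +
   (T ^ 2 * h - v ^ 4 / 32 * (w ^ 2 - 1) + T ^ 2 * eta / (16 * v ^ 2) - T ^ 2 / (384 * v ^ 4)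
     - T / 8 + v ^ 2 / 128 - 1 / 512)); last first.
  rewrite /err /h HE KE /H0 /riesz3_poly -/c LE.
  have -> : g = c + 3 / 4 by rewrite /c; ring.
  rewrite Tw; field; lra.
have T76 : T <= Rpower T (7 / 6) by rewrite -{1}(Rpower_1 T); [apply: Rpower_le_exp; lra | lra].
set p := Rpower v (- (5 / 2)) in hH hK.
have p0 : 0 <= p := Rpower_ge0 _ _.
have p1 : p <= 1 by rewrite -(Rpower_base1 (- (5 / 2))); apply: Rpower_le_neg; lra.
have Tp : T ^ 2 * p <= Rpower (3 / 4) (- (5 / 2)) * Rpower T (7 / 6).
  have q1 : p <= Rpower (3 / 4) (- (5 / 2)) * Rpower y (- (5 / 2)).
    by rewrite -Rpower_mulE; [apply: Rpower_le_neg; lra | lra | lra].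
  have -> : Rpower T (7 / 6) = T ^ 2 * Rpower y (- (5 / 2)).
    rewrite /y Rpower_mult -(Rpower_natr 2); last lra.
    by rewrite -Rpower_plus INR_2; congr Rpower; field.
  by have := Rmult_le_compat_l _ _ _ (pow2_ge_0 T) q1; lra.
have lv : 0 <= ln v by apply: ln_ge0; lra.
have lv2 : ln v <= 1 + ln T.
  have hyT : y <= T by rewrite -y3; nra.
  have h32 := @ln_le_sub1 (3 / 2) ltac:(lra).
  have : ln v <= ln (3 / 2 * T) by apply: ln_le; lra.
  by rewrite ln_mult; lra.
have hH0 : Rabs H0 <= (2 + Rabs g) * (1 + ln T).
  have i24 : 0 < / (24 * v ^ 2) <= 1.
    split; first by apply: Rinv_0_lt_compat; lra.
    by rewrite -[X in _ <= X]Rinv_1; apply: Rinv_le_contravar; nra.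
  have := Rabs_pos g; have := Rle_abs g; have := Rle_abs (- g); rewrite Rabs_Ropp => g1' g2' g3'.
  by apply: Rabs_le; rewrite /H0; nra.
have he1 : Rabs e1 <= CH by apply: Rle_trans hH _; nra.
have hp1 : 0 <= CH * p by exact: Rmult_le_pos.
have hp2 : 0 <= CK * p by exact: Rmult_le_pos.
have herr : Rabs err <= (3 / 2 * CH + 3 / 2 * CK + 3 * Rabs c * CH +
    3 / 2 * (2 * (2 + Rabs g) * CH + CH ^ 2)) * p * (1 + ln T).
  have a1 : Rabs (3 / 2 * (ln T * e1 - e2)) <= 3 / 2 * (CH * p + CK * p) * (1 + ln T).
    rewrite Rabs_mult Rabs_pos_eq; last lra.
    rewrite Rmult_assoc; apply: Rmult_le_compat_l; first lra.
    apply: Rle_trans (Rabs_sub_le _ _) _; rewrite Rabs_mult (Rabs_pos_eq (ln T)) //.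
    by have := Rmult_le_compat_l _ _ _ lnT hH; nra.
  have a2 : Rabs (3 * c * e1) <= 3 * Rabs c * (CH * p) * (1 + ln T).
    rewrite !Rabs_mult (Rabs_pos_eq 3); last lra.
    have := Rabs_pos c => c0; have c3 : 0 <= 3 * Rabs c by lra.
    have := Rmult_le_compat_l _ _ _ c3 hH; have := Rmult_le_pos _ _ c3 hp1; nra.
  have a3 : Rabs (2 * H0 * e1 + e1 ^ 2) <= (2 * (2 + Rabs g) * (CH * p) + CH * (CH * p)) * (1 + ln T).
    apply: Rle_trans (Rabs_triang _ _) _.
    have -> : e1 ^ 2 = e1 * e1 by ring.
    rewrite !Rabs_mult (Rabs_pos_eq 2); last lra.
    have b1 := Rmult_le_compat _ _ _ _ (Rabs_pos H0) (Rabs_pos e1) hH0 hH.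
    have b2 := Rmult_le_compat _ _ _ _ (Rabs_pos e1) (Rabs_pos e1) he1 hH.
    by have := Rmult_le_pos _ _ hCH hp1; nra.
  apply: Rle_trans (Rabs_sub_le _ _) _.
  have := Rabs_triang (3 / 2 * (ln T * e1 - e2)) (3 * c * e1).
  rewrite (Rabs_mult (3 / 2) (2 * H0 * e1 + e1 ^ 2)) (Rabs_pos_eq (3 / 2)); lra.
have hTerr : Rabs (T ^ 2 * err) <= D * Rpower T (7 / 6) * (1 + ln T).
  rewrite Rabs_mult Rabs_pos_eq; last exact: pow2_ge_0.
  apply: Rle_trans (Rmult_le_compat_l _ _ _ (pow2_ge_0 T) herr) _.
  rewrite /D; set M := (_ + _ + _ + _).
  have M0 : 0 <= M.
    rewrite /M; have := Rabs_pos c; have := Rabs_pos g; have := pow2_ge_0 CH; nra.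
  have := Rmult_le_compat_l _ _ _ M0 Tp => t1.
  by have := Rmult_le_compat_r (1 + ln T) _ _ ltac:(lra) t1; lra.
have iv : 0 < / v ^ 3 by exact: Rinv_0_lt_compat.
have Tv : T ^ 2 * / v ^ 3 = T * w by rewrite /w; field; lra.
have Tv3 : v ^ 3 <= 27 / 8 * T.
  have : 8 / 27 * v ^ 3 <= w * v ^ 3 by apply: Rmult_le_compat_r; lra.
  by rewrite -Tw; lra.
have TTw : T * w <= 64 / 27 * T by rewrite Rmult_comm; apply: Rmult_le_compat_r; lra.
have c1 : Rabs (T ^ 2 * h) <= 5200 * T.
  rewrite Rabs_mult Rabs_pos_eq; last exact: pow2_ge_0.
  have : Rabs eta ^ 3 <= (71 / 10 / v) ^ 3 by apply: pow_incr; split => //; exact: Rabs_pos.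
  have -> : (71 / 10 / v) ^ 3 = (71 / 10) ^ 3 * / v ^ 3 by field; lra.
  move=> t1; apply: Rle_trans (Rmult_le_compat_l _ _ (6 * ((71 / 10) ^ 3 * / v ^ 3)) (pow2_ge_0 T) _) _; first lra.
  have -> : T ^ 2 * (6 * ((71 / 10) ^ 3 * / v ^ 3)) = 6 * (71 / 10) ^ 3 * (T * w) by rewrite -Tv; ring.
  lra.
have c2 : Rabs (v ^ 4 / 32 * (w ^ 2 - 1)) <= T.
  have -> : v ^ 4 / 32 * (w ^ 2 - 1) = v ^ 4 / 32 * (w + 1) * (w - 1) by field.
  have v4 : 0 < v ^ 4 by apply: pow_lt; lra.
  rewrite Rabs_mult Rabs_pos_eq; last by apply: Rmult_le_pos; lra.
  apply: Rle_trans (_ : v ^ 4 / 32 * (64 / 27 + 1) * (21 / 10 / v) <= _).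
    apply: Rmult_le_compat => //; [by apply: Rmult_le_pos; lra | exact: Rabs_pos |].
    by apply: Rmult_le_compat_l; lra.
  have -> : v ^ 4 / 32 * (64 / 27 + 1) * (21 / 10 / v) = / 32 * (64 / 27 + 1) * (21 / 10) * v ^ 3 by field; lra.
  lra.
have c3 : Rabs (T ^ 2 * eta / (16 * v ^ 2)) <= 2 * T.
  have -> : T ^ 2 * eta / (16 * v ^ 2) = T ^ 2 / (16 * v ^ 2) * eta by field; lra.
  have q0 : 0 <= T ^ 2 / (16 * v ^ 2) by apply: Rdiv_le_0_compat; [exact: pow2_ge_0 | lra].
  rewrite Rabs_mult Rabs_pos_eq //; apply: Rle_trans (Rmult_le_compat_l _ _ _ q0 deta) _.
  have -> : T ^ 2 / (16 * v ^ 2) * (71 / 10 / v) = 71 / 160 * (T ^ 2 * / v ^ 3) by field; lra.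
  lra.
have c4 : 0 <= T ^ 2 / (384 * v ^ 4) <= T.
  have v4 : 0 < v ^ 4 by apply: pow_lt; lra.
  split; first by apply: Rdiv_le_0_compat; [exact: pow2_ge_0 | lra].
  apply: Rdiv_leI; first lra.
  have : T <= 64 / 27 * v ^ 3 by rewrite Tw; apply: Rmult_le_compat_r; lra.
  have : v ^ 3 <= v ^ 4 by have -> : v ^ 4 = v * v ^ 3; [ring | nra].
  nra.
have c5 : 0 <= v ^ 2 <= 27 / 8 * T by split; [lra | apply: Rle_trans Tv3; nra].
have big : Rabs (T ^ 2 * h - v ^ 4 / 32 * (w ^ 2 - 1) + T ^ 2 * eta / (16 * v ^ 2) -
    T ^ 2 / (384 * v ^ 4) - T / 8 + v ^ 2 / 128 - 1 / 512) <= 6000 * T.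
  move: c1 c2 c3 => /Rabs_le_between c1 /Rabs_le_between c2 /Rabs_le_between c3.
  by apply: Rabs_le; lra.
have z0 : 0 <= Rpower T (7 / 6) by exact: Rpower_ge0.
have big2 : 6000 * T <= 6000 * Rpower T (7 / 6) * (1 + ln T) by nra.
apply: Rle_trans (Rabs_triang _ _) _.
have s1 := Rabs_triang (T ^ 2 * err + 3 * Rho) (3 / 2 * Bt).
have s2 := Rabs_triang (T ^ 2 * err) (3 * Rho).
rewrite (Rabs_mult 3) (Rabs_pos_eq 3) in s2; last lra.
rewrite (Rabs_mult (3 / 2)) (Rabs_pos_eq (3 / 2)) in s1; last lra.
lra.
Qed.

(** * Arithmetic of the ternary divisor function *)

Lemma sum_ffun3 (T : finType) (F : T -> T -> T -> nat) :
  (\sum_(f : {ffun 'I_3 -> T}) F (f ord0) (f (lift ord0 ord0)) (f (lift ord0 (lift ord0 ord0))) =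
   \sum_a \sum_b \sum_c F a b c)%N.
Proof.
under [RHS]eq_bigr => a _ do rewrite pair_bigA /=.
rewrite pair_bigA /=.
pose h (x : T * (T * T)) := [ffun i : 'I_3 => tnth [tuple x.1; x.2.1; x.2.2] i].
rewrite (reindex h) /=.
  by apply: eq_bigr => -[a [b c]] _; rewrite !ffunE /= !(tnth_nth a).
exists (fun f : {ffun 'I_3 -> T} => (f ord0, (f (lift ord0 ord0), f (lift ord0 (lift ord0 ord0))))).
  by move=> [a [b c]] _; rewrite !ffunE /= !(tnth_nth a).
move=> f _; apply/ffunP => i; rewrite ffunE (tnth_nth (f ord0)) /=.
by case: i => [[|[|[|//]]] hi] /=; congr (f _); apply: val_inj.
Qed.

Lemma sum_ord_shift (m N : nat) (F : nat -> nat) : (m <= N)%N -> F 0%N = 0%N ->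
  (forall a, (m < a)%N -> F a = 0%N) ->
  (\sum_(a < m.+1) F a = \sum_(a < N) F a.+1)%N.
Proof.
move=> mN h0 hF; rewrite big_ord_recl h0 add0n -(subnKC mN) big_split_ord /=.
by rewrite [X in (_ = _ + X)%N]big1 ?addn0 // => i _; apply: hF; lia.
Qed.

(** Factors of [m] never exceed [m], so the index range may be enlarged to any common [N];
    positivity is absorbed by the shift to successors. A range independent of [m] is what allows
    summation over [m] to be exchanged. *)
Lemma tau3_box (m N : nat) : (0 < m)%N -> (m <= N)%N ->
  (tau 3 m = \sum_(a < N) \sum_(b < N) \sum_(c < N) (a.+1 * b.+1 * c.+1 == m))%N.
Proof.
move=> m0 mN.
pose F (a b c : nat) : nat := [&& 0 < a, 0 < b, 0 < c & a * b * c == m]%N.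
have -> : tau 3 m = (\sum_(a < m.+1) \sum_(b < m.+1) \sum_(c < m.+1) F a b c)%N.
  rewrite -(sum_ffun3 (fun a b c : 'I_m.+1 => F a b c)) /tau -sum1_card.
  rewrite big_mkcond; apply: eq_bigr => f _; rewrite inE /F.
  have -> : [forall i, 0 < f i]%N = [&& 0 < f ord0, 0 < f (lift ord0 ord0) &
      0 < f (lift ord0 (lift ord0 ord0))]%N.
    apply/forallP/and3P => [h|[h1 h2 h3] i]; first by split; exact: h.
    by case: i => [[|[|[|//]]] hi]; [move: h1 | move: h2 | move: h3];
      congr (0 < nat_of_ord (f _))%N; apply: val_inj.
  by rewrite !big_ord_recl big_ord0 muln1 mulnA -!andbA; case: (_ && _).
have big a b c : (m < a)%N || (m < b)%N || (m < c)%N -> F a b c = 0%N.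
  move=> h; apply/eqP; rewrite eqb0; apply/negP => /and4P [a0 b0 c0 /eqP e].
  have : (a <= m)%N by apply: dvdn_leq => //; rewrite -e -mulnA dvdn_mulr.
  have : (b <= m)%N by apply: dvdn_leq => //; rewrite -e mulnAC dvdn_mull.
  have : (c <= m)%N by apply: dvdn_leq => //; rewrite -e dvdn_mull.
  by move: h; lia.
rewrite (@sum_ord_shift m N (fun a => \sum_(b < m.+1) \sum_(c < m.+1) F a b c)%N) //.
- apply: eq_bigr => a _.
  rewrite (@sum_ord_shift m N (fun b => \sum_(c < m.+1) F a.+1 b c)%N) //.
  + apply: eq_bigr => b _.
    rewrite (@sum_ord_shift m N (fun c => F a.+1 b.+1 c)) //.
    by move=> c hc; apply: big; rewrite hc !orbT.
  + by apply: big1.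
  + by move=> b hb; apply: big1 => c _; apply: big; rewrite hb orbT.
- by apply: big1 => b _; apply: big1.
- by move=> a ha; apply: big1 => b _; apply: big1 => c _; apply: big; rewrite ha.
Qed.

Lemma sum_divisors (m N : nat) (F : nat -> nat) : (0 < m)%N -> (m <= N)%N ->
  (\sum_(a < N) (a.+1 %| m) * F a.+1 = \sum_(d <- divisors m) F d)%N.
Proof.
move=> m0 mN.
have -> : (\sum_(a < N) (a.+1 %| m) * F a.+1 = \sum_(d <- [seq i.+1 | i <- iota 0 N] | d %| m) F d)%N.
  have -> : iota 0 N = index_iota 0 N by rewrite /index_iota subn0.
  rewrite big_map big_mkord [RHS]big_mkcond /=.
  by apply: eq_bigr => i _; case: (_ %| _); rewrite ?mul1n ?mul0n.
rewrite -big_filter; apply: perm_big; apply: uniq_perm.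
- by rewrite filter_uniq // map_inj_uniq ?iota_uniq // => i j [].
- exact: divisors_uniq.
move=> d; rewrite mem_filter -dvdn_divisors //.
case hd: (d %| m)%N => //=.
apply/mapP; exists d.-1; rewrite ?mem_iota ?add0n /=.
  by have := dvdn_leq m0 hd; have := dvdn_gt0 m0 hd; lia.
by rewrite prednK // (dvdn_gt0 m0 hd).
Qed.

Definition numdiv (n : nat) : nat := size (divisors n).

Lemma tau3_divisors (m : nat) : (0 < m)%N ->
  tau 3 m = (\sum_(a <- divisors m) numdiv (m %/ a))%N.
Proof.
move=> m0; rewrite (tau3_box m0 (leqnn m)) -(sum_divisors _ m0 (leqnn m)).
apply: eq_bigr => a _; case ha: (a.+1 %| m)%N; last first.
  rewrite mul0n; apply: big1 => b _; apply: big1 => c _.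
  apply/eqP; rewrite eqb0; apply/eqP => e.
  have : (a.+1 %| a.+1 * b.+1 * c.+1)%N by rewrite -mulnA dvdn_mulr.
  by rewrite e ha.
set q := (m %/ a.+1)%N; have hq : m = (a.+1 * q)%N by rewrite /q muln_divA // mulKn.
have q0 : (0 < q)%N by move: m0; rewrite hq muln_gt0.
have qm : (q <= m)%N by rewrite hq leq_pmull.
rewrite mul1n /numdiv -sum1_size -(sum_divisors (fun=> 1%N) q0 qm).
apply: eq_bigr => b _; rewrite muln1.
have hc c : (a.+1 * b.+1 * c == m)%N = (b.+1 * c == q)%N.
  by rewrite [X in _ == X]hq -mulnA eqn_pmul2l.
under eq_bigr => c _ do rewrite hc.
case hb: (b.+1 %| q)%N; last first.
  apply: big1 => c _; apply/eqP; rewrite eqb0; apply/eqP => e; move: hb.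
  by rewrite -e dvdn_mulr.
have [k hk] := dvdnP hb; have k0 : (0 < k)%N by move: q0; rewrite hk muln_gt0 => /andP[].
have hkm : (k.-1 < m)%N by move: qm; rewrite hk; nia.
rewrite (bigD1 (Ordinal hkm)) //= prednK // hk mulnC eqxx big1 ?addn0 // => c hc'.
apply/eqP; rewrite eqb0; apply: contra hc' => /eqP e; apply/eqP/val_inj => /=.
move: e; rewrite mulnC => /eqP; rewrite eqn_pmul2r // => /eqP <-.
by [].
Qed.

Lemma divisors_coprime_perm (p a m : nat) : prime p -> ~~ (p %| m)%N -> (0 < m)%N ->
  perm_eq (divisors (p ^ a * m)) [seq p ^ j * d | j <- iota 0 a.+1, d <- divisors m]%N.
Proof.
move=> pp pm m0; have p0 := prime_gt0 pp.
have cop d : (d %| m)%N -> coprime p d.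
  by move=> hd; rewrite prime_coprime //; apply: contra pm => /dvdn_trans; apply.
apply: uniq_perm; first exact: divisors_uniq.
- apply: allpairs_uniq; [exact: iota_uniq | exact: divisors_uniq |].
  move=> z1 z2 h1 h2; case/allpairsP: h1 => -[j1 d1] [_ /= hd ->].
  case/allpairsP: h2 => -[j2 d2] [_ /= hd' ->] /= e.
  rewrite -!dvdn_divisors // in hd hd'.
  have hl i d0 : (d0 %| m)%N -> logn p (p ^ i * d0) = i.
    move=> h; rewrite lognM ?expn_gt0 ?p0 ?(dvdn_gt0 m0 h) // pfactorK //.
    by rewrite (logn_coprime (cop _ h)) addn0.
  have ej : j1 = j2 by rewrite -(hl j1 d1 hd) e hl.
  by move: e; rewrite ej => /eqP; rewrite eqn_pmul2l ?expn_gt0 ?p0 // => /eqP ->.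
move=> e; have pam0 : (0 < p ^ a * m)%N by rewrite muln_gt0 expn_gt0 p0.
rewrite -dvdn_divisors //; apply/idP/allpairsP => [he|[[j d] /= [hj hd ->]]].
  have e0 := dvdn_gt0 pam0 he.
  have [d cd ed] := pfactor_coprime pp e0.
  exists (logn p e, d) => /=; split; last by rewrite mulnC.
    rewrite -[0%N :: _]/(iota 0 a.+1) mem_iota add0n ltnS /= -(dvdn_Pexp2l _ _ (prime_gt1 pp)).
    rewrite -(@Gauss_dvdl _ _ m); last by apply: coprimeXl; exact: cop.
    by apply: dvdn_trans he; rewrite [X in (_ %| X)%N]ed dvdn_mull.
  rewrite -dvdn_divisors // -(@Gauss_dvdr d (p ^ a)); last by apply: coprimeXr; rewrite coprime_sym.
  by apply: dvdn_trans he; rewrite ed dvdn_mulr.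
rewrite -[0%N :: _]/(iota 0 a.+1) mem_iota add0n ltnS /= in hj; rewrite -dvdn_divisors // in hd.
by rewrite dvdn_mul // dvdn_exp2l.
Qed.

Lemma big_divisors_coprime (R : Type) (idx : R) (op : Monoid.com_law idx) (F : nat -> R)
    (p a m : nat) : prime p -> ~~ (p %| m)%N -> (0 < m)%N ->
  \big[op/idx]_(e <- divisors (p ^ a * m)) F e =
  \big[op/idx]_(j < a.+1) \big[op/idx]_(d <- divisors m) F (p ^ j * d)%N.
Proof.
move=> pp pm m0; rewrite (perm_big _ (divisors_coprime_perm a pp pm m0)) big_allpairs_dep.
by rewrite -[iota 0 a.+1]/(index_iota 0 a.+1) big_mkord.
Qed.

Lemma numdiv_coprime (p a m : nat) : prime p -> ~~ (p %| m)%N -> (0 < m)%N ->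
  numdiv (p ^ a * m) = (a.+1 * numdiv m)%N.
Proof.
move=> pp pm m0; rewrite /numdiv -sum1_size big_divisors_coprime // sum1_size.
by rewrite sum_nat_const card_ord.
Qed.

Lemma divn_pfactor (p a j m d : nat) : (0 < p)%N -> (j <= a)%N -> (d %| m)%N -> (0 < d)%N ->
  ((p ^ a * m) %/ (p ^ j * d) = p ^ (a - j) * (m %/ d))%N.
Proof.
move=> p0 ja /dvdnP[k ->] d0; rewrite mulnK // -{1}(subnK ja) expnD.
have -> : (p ^ (a - j) * p ^ j * (k * d) = p ^ (a - j) * k * (p ^ j * d))%N by lia.
by rewrite mulnK // muln_gt0 expn_gt0 p0.
Qed.

(** The value of [tau 3] at a prime power [p^a], that is, the coefficient of [X^a] in
    [(1 - X)^(-3)]. *)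
Definition tri (a : nat) : nat := (\sum_(j < a.+1) j.+1)%N.

Lemma tau3_coprime (p a m : nat) : prime p -> ~~ (p %| m)%N -> (0 < m)%N ->
  tau 3 (p ^ a * m) = (tri a * tau 3 m)%N.
Proof.
move=> pp pm m0; have p0 := prime_gt0 pp.
have pam0 : (0 < p ^ a * m)%N by rewrite muln_gt0 expn_gt0 p0.
rewrite !tau3_divisors // big_divisors_coprime // /tri big_distrl [RHS](reindex_inj rev_ord_inj) /=.
apply: eq_bigr => j _; rewrite big_distrr /=; apply: eq_big_seq => d.
rewrite -dvdn_divisors // => hd; have d0 := dvdn_gt0 m0 hd.
have md0 : (0 < m %/ d)%N by rewrite divn_gt0 // dvdn_leq.
have pmd : ~~ (p %| m %/ d)%N.
  by apply: contra pm => h; rewrite -(divnK hd) dvdn_mulr.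
rewrite divn_pfactor //; last by rewrite -ltnS.
by rewrite numdiv_coprime //; congr (_ * _)%N; have := ltn_ord j; lia.
Qed.

Lemma tau3_1 : tau 3 1 = 1%N.
Proof. by rewrite tau3_divisors // big_cons big_nil. Qed.

(** * Divisor bounds and the Dirichlet inverse of the ternary divisor function *)

Lemma rprod_Rpower (I : Type) (s : seq I) (P : pred I) (F : I -> R) (a : R) :
  (forall i, P i -> 0 < F i) ->
  Rpower (\rprod_(i <- s | P i) F i) a = \rprod_(i <- s | P i) Rpower (F i) a.
Proof.
move=> h; elim: s => [|i s IH]; first by rewrite !big_nil Rpower_base1.
rewrite !big_cons; case Pi: (P i) => //.
by rewrite Rpower_mulE ?IH //; [exact: h | exact: rprod_gt0].
Qed.

Lemma INR_expn (a b : nat) : INR (a ^ b)%N = INR a ^ b.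
Proof. by elim: b => [|b IH]; rewrite ?INR_1 // expnS mult_INR IH. Qed.

Lemma pfactor_split (p n : nat) : prime p -> (0 < n)%N ->
  exists m, [/\ (0 < m)%N, ~~ (p %| m)%N & n = (p ^ logn p n * m)%N].
Proof.
move=> pp n0; have [m cm e] := pfactor_coprime pp n0; exists m; split.
- by move: n0; rewrite e muln_gt0 => /andP[].
- by rewrite -prime_coprime.
- by rewrite mulnC.
Qed.

Lemma sqr_le_exp2 (eta : R) : 0 < eta -> exists C, 1 <= C /\
  forall a, (INR a + 1) ^ 2 <= C * Rpower 2 (INR a * eta).
Proof.
move=> he; pose c := Rmin 1 (eta / 4).
have c0 : 0 < c by apply: Rmin_glb_lt; lra.
have c1 : c <= 1 by exact: Rmin_l.
have c2 : c <= eta / 4 by exact: Rmin_r.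
exists (/ c ^ 2); split.
  by rewrite -[X in X <= _]Rinv_1; apply: Rinv_le_contravar; nra.
move=> a; have a0 := pos_INR a.
have h : c * (INR a + 1) <= Rpower 2 (INR a * eta / 2).
  rewrite /Rpower; have h1 := exp_ineq1_le (INR a * eta / 2 * ln 2).
  have h2 := ln_lt_2.
  have h3 : 0 <= INR a * eta by nra.
  nra.
have -> : Rpower 2 (INR a * eta) = Rpower 2 (INR a * eta / 2) ^ 2.
  by rewrite -Rpower_natr ?Rpower_mult ?INR_2; [congr Rpower; field | exact: Rpower_gt0].
have h3 : (c * (INR a + 1)) ^ 2 <= Rpower 2 (INR a * eta / 2) ^ 2 by apply: pow_incr; nra.
have e : (INR a + 1) ^ 2 = / c ^ 2 * (c * (INR a + 1)) ^ 2 by field; lra.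
rewrite e; apply: Rmult_le_compat_l h3; apply: Rlt_le; apply: Rinv_0_lt_compat; exact: pow_lt.
Qed.

(** One property shared by [t3], [numdiv] and [mu3], so that a single divisor bound with a single
    constant serves all three. *)
Definition submultiplicative_bound (f : nat -> R) : Prop :=
  Rabs (f 1%N) <= 1 /\
  forall p a m, prime p -> ~~ (p %| m)%N -> (0 < m)%N ->
    Rabs (f (p ^ a * m)%N) <= (INR a + 1) ^ 2 * Rabs (f m).

(** Once [p^eta >= 4], the factor [(a + 1)^2 <= 4^a] is absorbed by [p^(a eta)] at no cost. Each of
    the finitely many smaller primes costs one factor [C]. *)
Lemma divisor_bound (eta : R) : 0 < eta -> exists C, 1 <= C /\
  forall f, submultiplicative_bound f ->
  forall n, (0 < n)%N -> Rabs (f n) <= C * Rpower (INR n) eta.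
Proof.
move=> he; have [C [C1 hC]] := sqr_le_exp2 he.
pose P0 := (nat_floor (Rpower 4 (/ eta))).+1.
have hP0 p a : (P0 <= p)%N -> (INR a + 1) ^ 2 <= Rpower (INR (p ^ a)) eta.
  move=> hp; have p4 : 4 <= Rpower (INR p) eta.
    have -> : 4 = Rpower (Rpower 4 (/ eta)) eta.
      by rewrite Rpower_mult Rinv_l ?Rpower_1; lra.
    apply: Rpower_le_base; last lra.
    split; first exact: Rpower_gt0.
    have := nat_floor_gt (Rpower 4 (/ eta)); rewrite -S_INR => h.
    by apply: Rle_trans (Rlt_le _ _ h) _; exact: leq_INR.
  have p0 : 0 < INR p by apply: INR_gt0; apply: leq_trans hp.
  have -> : Rpower (INR (p ^ a)) eta = Rpower (INR p) eta ^ a.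
    rewrite INR_expn -Rpower_natr // -(Rpower_natr _ (Rpower_gt0 _ _)) !Rpower_mult.
    by congr Rpower; ring.
  elim: a => [|a IH]; first by rewrite /INR /=; lra.
  rewrite S_INR /= -/(pow _ _); have a0 := pos_INR a.
  have : 4 * (INR a + 1) ^ 2 <= Rpower (INR p) eta * Rpower (INR p) eta ^ a.
    by apply: Rmult_le_compat => //; [lra | exact: pow2_ge_0].
  nra.
exists (C ^ P0); split; first exact: pow_R1_Rle.
move=> f [f1 hf].
have base n : (0 < n)%N -> (forall q, prime q -> (q %| n)%N -> (P0 <= q)%N) ->
    Rabs (f n) <= Rpower (INR n) eta.
  elim/ltn_ind: n => n IH n0 hq.
  case: (leqP n 1) => hn.
    have -> : n = 1%N by lia.
    by rewrite INR_1 Rpower_base1.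
  have pp := pdiv_prime hn; set p := pdiv n in pp.
  have [m [m0 pm e]] := pfactor_split pp n0.
  have a0 : (0 < logn p n)%N by rewrite logn_gt0 mem_primes pp n0 pdiv_dvd.
  set a := logn p n in e a0.
  have mn : (m < n)%N.
    rewrite e -[X in (X < _)%N]mul1n ltn_pmul2r // -(expn0 p) ltn_exp2l //; exact: prime_gt1.
  rewrite {1}e; apply: Rle_trans (hf p a m pp pm m0) _.
  rewrite e mult_INR Rpower_mulE; last 2 first.
  - by apply: INR_gt0; rewrite expn_gt0 prime_gt0.
  - exact: INR_gt0.
  apply: Rmult_le_compat; [exact: pow2_ge_0 | exact: Rabs_pos | |].
  - by apply: hP0; apply: hq => //; exact: pdiv_dvd.
  - by apply: IH => // q pq qm; apply: hq => //; rewrite e dvdn_mull.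
(* Induction on how far below [P0] prime factors are allowed: the only new candidate is [k], and
   splitting off its full power returns to the previous case. *)
have step j n : (j <= P0)%N -> (0 < n)%N ->
    (forall q, prime q -> (q %| n)%N -> (P0 - j <= q)%N) ->
    Rabs (f n) <= C ^ j * Rpower (INR n) eta.
  elim: j n => [|j IH] n hj n0 hq.
    by rewrite /= Rmult_1_l; apply: base => // q pq qn; have := hq q pq qn; rewrite subn0.
  set k := (P0 - j.+1)%N in hq.
  have p0 := Rpower_ge0 (INR n) eta; have Cj : 1 <= C ^ j by exact: pow_R1_Rle.
  case hk: (prime k && (k %| n)%N); last first.
    apply: Rle_trans (IH n (ltnW hj) n0 _) _.
      move=> q pq qn; have := hq q pq qn; rewrite /k => h.
      have : q <> k by move=> e; move: hk; rewrite -e pq qn.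
      by rewrite /k; lia.
    by apply: Rmult_le_compat_r => //=; nra.
  move/andP: hk => [pk kn].
  have [m [m0 km e]] := pfactor_split pk n0; set a := logn k n in e.
  rewrite {1}e; apply: Rle_trans (hf k a m pk km m0) _.
  have k2 : 2 <= INR k by rewrite -INR_2; apply: leq_INR; exact: prime_gt1.
  have -> : Rpower (INR n) eta = Rpower (INR k) (INR a * eta) * Rpower (INR m) eta.
    rewrite e mult_INR INR_expn Rpower_mulE; [|by apply: pow_lt; lra|exact: INR_gt0].
    by rewrite -Rpower_natr ?Rpower_mult; [|lra].
  have hm : Rabs (f m) <= C ^ j * Rpower (INR m) eta.
    apply: IH => //; first exact: ltnW.
    move=> q pq qm; have := hq q pq; rewrite e => h.
    have : q <> k by move=> ek; move: km; rewrite -ek qm.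
    by have := h (dvdn_mull _ qm); rewrite /k; lia.
  have ha : (INR a + 1) ^ 2 <= C * Rpower (INR k) (INR a * eta).
    apply: Rle_trans (hC a) _; apply: Rmult_le_compat_l; first lra.
    by apply: Rpower_le_base; [lra | apply: Rmult_le_pos; [exact: pos_INR | lra]].
  have := Rmult_le_compat _ _ _ _ (pow2_ge_0 _) (Rabs_pos _) ha hm.
  by rewrite /=; lra.
move=> n n0; apply: step => // q _ _; lia.
Qed.

Definition t3 (n : nat) : R := INR (tau 3 n).

Lemma t3_ge0 (n : nat) : 0 <= t3 n.
Proof. exact: pos_INR. Qed.

Lemma triE (a : nat) : INR (tri a) = (INR a + 1) * (INR a + 2) / 2.
Proof.
rewrite /tri INR_sum; elim: a => [|a IH].
  by rewrite (rsum_recr _ (fun j => INR j.+1)) rsum0 INR_1 /INR; field.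
by rewrite (rsum_recr _ (fun j => INR j.+1)) IH !S_INR; field.
Qed.

Lemma t3_coprime (p a m : nat) : prime p -> ~~ (p %| m)%N -> (0 < m)%N ->
  t3 (p ^ a * m) = INR (tri a) * t3 m.
Proof. by move=> pp pm m0; rewrite /t3 tau3_coprime // mult_INR. Qed.

Lemma t3_submultiplicative : submultiplicative_bound t3.
Proof.
split=> [|p a m pp pm m0]; first by rewrite /t3 tau3_1 INR_1 Rabs_R1; lra.
rewrite t3_coprime // Rabs_mult; apply: Rmult_le_compat_r; first exact: Rabs_pos.
by rewrite triE Rabs_pos_eq; have := pos_INR a; nra.
Qed.

Lemma numdiv_submultiplicative : submultiplicative_bound (fun n => INR (numdiv n)).
Proof.
split=> [|p a m pp pm m0]; first by rewrite /numdiv /= INR_1 Rabs_R1; lra.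
rewrite numdiv_coprime // mult_INR Rabs_mult; apply: Rmult_le_compat_r; first exact: Rabs_pos.
by rewrite S_INR Rabs_pos_eq; have := pos_INR a; nra.
Qed.

(* The coefficients of [(1 - X) ^ 3]. *)
Definition cube_coef (a : nat) : R :=
  match a with 0%N => 1 | 1%N => -3 | 2%N => 3 | 3%N => -1 | _ => 0 end.

(* The Dirichlet inverse of [t3]. *)
Definition mu3 (n : nat) : R := \rprod_(p <- primes n) cube_coef (logn p n).

Lemma mu3_coprime (p a m : nat) : prime p -> ~~ (p %| m)%N -> (0 < m)%N ->
  mu3 (p ^ a * m) = cube_coef a * mu3 m.
Proof.
move=> pp pm m0; have p0 := prime_gt0 pp.
case: a => [|a]; first by rewrite expn0 mul1n /= Rmult_1_l.
have cpm : coprime p m by rewrite prime_coprime.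
have hperm : perm_eq (primes (p ^ a.+1 * m)) (p :: primes m).
  apply: uniq_perm; rewrite ?primes_uniq //=.
    by rewrite primes_uniq andbT mem_primes pp m0.
  move=> q; rewrite primesM ?expn_gt0 ?p0 // primesX // inE (primes_prime pp) inE //.
rewrite /mu3 (perm_big _ hperm) big_cons; congr (_ * _).
  by rewrite lognM ?expn_gt0 ?p0 // pfactorK // (logn_coprime cpm) addn0.
apply: eq_big_seq => q; rewrite mem_primes => /and3P[pq _ qm].
rewrite lognM ?expn_gt0 ?p0 // lognX logn_prime //.
have /negbTE -> : q != p by apply: contraNneq pm => <-.
by rewrite muln0.
Qed.

Lemma mu3_submultiplicative : submultiplicative_bound mu3.
Proof.
split=> [|p a m pp pm m0]; first by rewrite /mu3 big_nil Rabs_R1; lra.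
rewrite mu3_coprime // Rabs_mult; apply: Rmult_le_compat_r; first exact: Rabs_pos.
have a0 := pos_INR a; case: a a0 => [|[|[|[|a]]]] /= a0; rewrite ?INR_1 ?INR_2 ?INR_3.
- by rewrite Rabs_R1; nra.
- by rewrite Rabs_left; lra.
- by rewrite Rabs_pos_eq; lra.
- by rewrite Rabs_left; lra.
- by rewrite Rabs_R0; nra.
Qed.

(** The coefficient of [X^a] in [(1 - X)^3 (1 - X)^(-3) = 1]. *)
Lemma cube_coef_conv (a : nat) : (0 < a)%N ->
  \rsum_(j < a.+1) (cube_coef (a - j) * INR (tri j)) = 0.
Proof.
move=> a0; rewrite (reindex_inj rev_ord_inj) /=.
rewrite (eq_bigr (fun j : 'I_a.+1 => cube_coef j * INR (tri (a - j)))); last first.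
  by move=> j _; rewrite subSS; congr (cube_coef _ * _); have := ltn_ord j; lia.
case: a a0 => [//|[|[|a]]] _.
- rewrite !(rsum_recr _ (fun j => cube_coef j * INR (tri (1 - j)))) rsum0 /= !triE.
  by rewrite subn0 subnn INR_1 /INR; field.
- rewrite !(rsum_recr _ (fun j => cube_coef j * INR (tri (2 - j)))) rsum0 /= !triE.
  by rewrite subn0 subnn subSS subn0 INR_1 INR_2 /INR; field.
have -> : a.+4 = (4 + a)%N by rewrite addnC !addnS addn0.
rewrite (rsum_split _ _ (fun j => cube_coef j * INR (tri (a.+3 - j)))).
rewrite [X in _ + X]big1 ?Rplus_0_r; last by move=> j _; rewrite /= Rmult_0_l.
rewrite !(rsum_recr _ (fun j => cube_coef j * INR (tri (a.+3 - j)))) rsum0 /= !triE.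
rewrite !subSS !subn0 !S_INR; field.
Qed.

(** The local factor at [p] splits off and is the vanishing sum of [cube_coef_conv]; a cofactor [m]
    prime to [p] does not interfere. The case [m = 1] is Dirichlet inversion, the general case gives
    the support of [gcoef]. *)
Lemma mu3_t3_shifted (p n m : nat) : prime p -> (p %| n)%N -> ~~ (p %| m)%N ->
  (0 < n)%N -> (0 < m)%N ->
  \rsum_(e <- divisors n) (mu3 (n %/ e) * t3 (e * m)) = 0.
Proof.
move=> pp pn pm n0 m0; have [n' [n'0 pn' e]] := pfactor_split pp n0.
have a0 : (0 < logn p n)%N by rewrite logn_gt0 mem_primes pp n0.
set a := logn p n in e a0; rewrite e big_divisors_coprime //.
rewrite (eq_bigr (fun j : 'I_a.+1 => cube_coef (a - j) * INR (tri j) *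
   \rsum_(d <- divisors n') (mu3 (n' %/ d) * t3 (d * m)))).
  by rewrite -big_distrl cube_coef_conv //= Rmult_0_l.
move=> j _; rewrite big_distrr; apply: eq_big_seq => d; rewrite -dvdn_divisors // => hd.
have d0 := dvdn_gt0 n'0 hd.
have md0 : (0 < n' %/ d)%N by rewrite divn_gt0 // dvdn_leq.
have pmd : ~~ (p %| n' %/ d)%N.
  by apply: contra pn' => h; rewrite -(divnK hd) dvdn_mulr.
have ja : (j <= a)%N by rewrite -ltnS.
rewrite divn_pfactor ?(prime_gt0 pp) // mu3_coprime // -mulnA t3_coprime ?muln_gt0 ?d0 //=; first ring.
rewrite Euclid_dvdM // negb_or pm andbT; apply: contra pn' => h; exact: dvdn_trans hd.
Qed.

Lemma mu3_t3 (n : nat) : (0 < n)%N ->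
  \rsum_(e <- divisors n) (mu3 (n %/ e) * t3 e) = ind (n == 1%N).
Proof.
move=> n0; case: (leqP n 1) => hn.
  have -> : n = 1%N by lia.
  by rewrite big_cons big_nil /mu3 big_nil /t3 tau3_1 INR_1 /ind /=; ring.
have -> : (n == 1%N) = false by lia.
rewrite -[RHS](@mu3_t3_shifted (pdiv n) n 1) ?pdiv_prime ?pdiv_dvd //.
  by apply: eq_bigr => e _; rewrite muln1.
by rewrite dvdn1; apply/eqP => h; have := prime_gt1 (pdiv_prime hn); rewrite h.
Qed.

(** A prime exponent [a >= k] of [n] becomes [b = a %/ k >= 1] in [m], and then
    [b k <= a < (b + 1) k <= 2 b k]. *)
Lemma kfull_root (k : nat) : (0 < k)%N -> forall n, (0 < n)%N ->
  (forall p, prime p -> (p %| n)%N -> (k <= logn p n)%N) ->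
  exists m, [/\ (0 < m)%N, (m ^ k %| n)%N & (n %| m ^ (2 * k))%N].
Proof.
move=> k0; elim/ltn_ind => n IH n0 hn.
case: (leqP n 1) => h1.
  by exists 1%N; split => //; rewrite exp1n ?dvd1n // dvdn1; lia.
have pp := pdiv_prime h1; set p := pdiv n in pp.
have p0 := prime_gt0 pp; have p1 := prime_gt1 pp.
have [n' [n'0 pn' e]] := pfactor_split pp n0.
have ka := hn p pp (pdiv_dvd n); set a := logn p n in e ka.
have n'n : (n' < n)%N.
  rewrite e -[X in (X < _)%N]mul1n ltn_pmul2r // -(expn0 p) ltn_exp2l //; lia.
have [q pq qn'|m' [m'0 h2 h3]] := IH n' n'n n'0.
  have := hn q pq; rewrite e => h; have := h (dvdn_mull _ qn').
  rewrite lognM ?expn_gt0 ?p0 // lognX (logn_prime _ pp).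
  have /negbTE -> : q != p by apply: contraNneq pn' => <-.
  by rewrite muln0.
have b1 : (0 < a %/ k)%N by rewrite divn_gt0.
exists (p ^ (a %/ k) * m')%N; split; first by rewrite muln_gt0 expn_gt0 p0.
  rewrite expnMn -expnM e dvdn_mul // dvdn_exp2l //; exact: leq_trunc_div.
rewrite expnMn -expnM {1}e dvdn_mul // dvdn_exp2l //.
have := divn_eq a k; have := ltn_pmod a k0; nia.
Qed.

(** * Divisor sums over a box and Dirichlet inversion on tuples *)

Lemma rsum_divisors_ord (m N : nat) (F : nat -> R) : (0 < m)%N -> (m <= N)%N ->
  \rsum_(a < N) (ind (a.+1 %| m)%N * F a.+1) = \rsum_(d <- divisors m) F d.
Proof.
move=> m0 mN.
have e : iota 0 N = index_iota 0 N by rewrite /index_iota subn0.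
have -> : \rsum_(a < N) (ind (a.+1 %| m)%N * F a.+1) =
    \rsum_(d <- [seq i.+1 | i <- iota 0 N] | (d %| m)%N) F d.
  rewrite big_map e big_mkord [RHS]big_mkcond.
  by apply: eq_bigr => i _; rewrite /ind; case: (_ %| _)%N; ring.
rewrite -big_filter; apply: perm_big; apply: uniq_perm.
- by rewrite filter_uniq // map_inj_uniq ?iota_uniq // => i j [].
- exact: divisors_uniq.
move=> d; rewrite mem_filter -dvdn_divisors //.
case hd: (d %| m)%N => //=.
apply/mapP; exists d.-1; rewrite ?mem_iota ?add0n /=.
  by have := dvdn_leq m0 hd; have := dvdn_gt0 m0 hd; lia.
by rewrite prednK // (dvdn_gt0 m0 hd).
Qed.

Lemma rsum_divisors_rev (q : nat) (F : nat -> R) : (0 < q)%N ->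
  \rsum_(f <- divisors q) F (q %/ f)%N = \rsum_(f <- divisors q) F f.
Proof.
move=> q0; rewrite -(big_map (fun f => q %/ f)%N xpredT F).
apply: perm_big; apply: uniq_perm; last 1 first.
- move=> d; rewrite -dvdn_divisors //; apply/mapP/idP => [[f]|hd].
    by rewrite -dvdn_divisors // => hf ->; rewrite -{2}(divnK hf) dvdn_mulr.
  exists (q %/ d)%N; first by rewrite -dvdn_divisors // -{2}(divnK hd) dvdn_mulr.
  by rewrite divnA // mulKn.
- rewrite map_inj_in_uniq ?divisors_uniq // => a b.
  rewrite -!dvdn_divisors // => ha hb e.
  have qb0 : (0 < q %/ b)%N by rewrite divn_gt0 ?(dvdn_gt0 q0 hb) // dvdn_leq.
  by apply/eqP; rewrite -(eqn_pmul2l qb0) (divnK hb) -e (divnK ha).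
- exact: divisors_uniq.
Qed.

Lemma rsum_divisors_multiples (E q : nat) (F : nat -> R) : (0 < E)%N -> (0 < q)%N ->
  \rsum_(d <- divisors (E * q) | (E %| d)%N) F d = \rsum_(f <- divisors q) F (E * f)%N.
Proof.
move=> E0 q0; have Eq0 : (0 < E * q)%N by rewrite muln_gt0 E0.
rewrite -(big_map (fun f => E * f)%N xpredT F) -big_filter.
apply: perm_big; apply: uniq_perm.
- by rewrite filter_uniq ?divisors_uniq.
- rewrite map_inj_uniq ?divisors_uniq // => a b /eqP.
  by rewrite eqn_pmul2l // => /eqP.
move=> d; rewrite mem_filter -dvdn_divisors //; apply/andP/mapP => [[/dvdnP[f ->]]|[f]].
  rewrite mulnC dvdn_pmul2l // => hf; exists f => //; by rewrite -dvdn_divisors.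
by rewrite -dvdn_divisors // => hf ->; rewrite dvdn_mulr // dvdn_pmul2l.
Qed.

Definition kmu (a e : nat) : R := ind (e.+1 %| a.+1)%N * mu3 (a.+1 %/ e.+1).
Definition kt (n a : nat) : R := ind (a.+1 %| n.+1)%N * t3 (n.+1 %/ a.+1).

(** The divisibility matrices of [mu3] and [t3] are inverse to each other: only multiples
    [(e + 1) f] dividing [n + 1] contribute, and their sum is [mu3_t3] at the quotient. All such
    divisors lie in the box. *)
Lemma kmu_kt (B n e : nat) : (n < B)%N ->
  \rsum_(a < B) (kmu a e * kt n a) = ind (n == e).
Proof.
move=> nB.
rewrite (eq_bigr (fun a : 'I_B => ind (a.+1 %| n.+1)%N *
   (ind (e.+1 %| a.+1)%N * (mu3 (a.+1 %/ e.+1) * t3 (n.+1 %/ a.+1))))); last first.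
  by move=> a _; rewrite /kmu /kt; ring.
rewrite (rsum_divisors_ord (fun d => ind (e.+1 %| d)%N * (mu3 (d %/ e.+1) * t3 (n.+1 %/ d)))) //.
have -> : \rsum_(d <- divisors n.+1) (ind (e.+1 %| d)%N * (mu3 (d %/ e.+1) * t3 (n.+1 %/ d))) =
    \rsum_(d <- divisors n.+1 | (e.+1 %| d)%N) (mu3 (d %/ e.+1) * t3 (n.+1 %/ d)).
  rewrite [RHS]big_mkcond; apply: eq_bigr => d _.
  by rewrite /ind; case: (_ %| _)%N; ring.
case he: (e.+1 %| n.+1)%N; last first.
  rewrite big1_seq => [|d /andP[hed]]; last first.
    by rewrite -dvdn_divisors // => hd; move: he; rewrite (dvdn_trans hed hd).
  by case: eqP => // h; move: he; rewrite h dvdnn.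
have [q hq] := dvdnP he; rewrite mulnC in hq.
have q0 : (0 < q)%N by case: q hq => //; rewrite muln0.
rewrite hq rsum_divisors_multiples //.
rewrite (eq_big_seq (fun f => mu3 f * t3 (q %/ f))); last first.
  move=> f; rewrite -dvdn_divisors // => hf; rewrite mulKn // divnMl //.
have -> : \rsum_(f <- divisors q) (mu3 f * t3 (q %/ f)) =
    \rsum_(f <- divisors q) (mu3 (q %/ f) * t3 (q %/ (q %/ f))).
  by rewrite (rsum_divisors_rev (fun f => mu3 f * t3 (q %/ f))).
rewrite (eq_big_seq (fun f => mu3 (q %/ f) * t3 f)).
  rewrite mu3_t3 //; congr ind; move: hq => /eqP.
  case: q q0 => [//|[|q]] _ /eqP hq; first by move: hq; rewrite muln1 => -[->]; rewrite !eqxx.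
  by apply/esym/eqP => h; move: hq; rewrite h; nia.
move=> f; rewrite -dvdn_divisors // => hf; congr (_ * t3 _).
by rewrite divnA // mulKn.
Qed.

(** Exchanging coordinate [i0] of [e] with [x] is an involution on pairs [(e, x)]. It turns [|T|]
    copies of the full sum into a sum of the vanishing one-coordinate sums. *)
Lemma rsum_ffun_eq0 (I T : finType) (i0 : I) (F : {ffun I -> T} -> R) :
  (forall e : {ffun I -> T},
     \rsum_(x : T) F [ffun i => if i == i0 then x else e i] = 0) ->
  \rsum_(e : {ffun I -> T}) F e = 0.
Proof.
move=> h; pose up (e : {ffun I -> T}) x : {ffun I -> T} := [ffun i => if i == i0 then x else e i].
case: (pickP (fun _ : T => true)) => [x0 _|hT]; last first.
  by apply: big1 => e _; have := hT (e i0).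
have e1 : \rsum_(e : {ffun I -> T}) \rsum_(x : T) F e = 0.
  rewrite pair_bigA /=.
  rewrite (reindex_inj (h := fun z : {ffun I -> T} * T => (up z.1 z.2, z.1 i0))) /=.
    by rewrite -(pair_bigA _ (fun e x => F (up e x))) /=; apply: big1 => e _; exact: h.
  apply: inv_inj => -[e x] /=; rewrite /up !ffunE eqxx; congr (_, _).
  by apply/ffunP => i; rewrite !ffunE; case: eqP => [->|].
have e2 : \rsum_(e : {ffun I -> T}) \rsum_(x : T) F e = INR #|T| * \rsum_(e : {ffun I -> T}) F e.
  rewrite big_distrr; apply: eq_bigr => e _ /=.
  rewrite -sum1_card INR_sum big_distrl; apply: eq_bigr => x _ /=.
  by rewrite INR_1 Rmult_1_l.
have T0 : 0 < INR #|T| by apply: INR_gt0; apply/card_gt0P; exists x0.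
by move: e1; rewrite e2 => /Rmult_integral [|] //; lra.
Qed.

Section Tuples.
Variables (r B : nat).
Implicit Types d e n : {ffun 'I_r -> 'I_B}.

Definition tprod d : nat := (\prod_(i < r) (d i).+1)%N.

(* The Dirichlet convolution of [t3 (n_1 ... n_r)] with [mu3] in each variable;
   a tuple [d] encodes [(d_1 + 1, ..., d_r + 1)]. *)
Definition gcoef d : R :=
  \rsum_(e : {ffun 'I_r -> 'I_B}) (t3 (tprod e) * \rprod_(i < r) kmu (d i) (e i)).

Lemma tprod_gt0 d : (0 < tprod d)%N.
Proof. by rewrite prodn_gt0. Qed.

(** The inversion acts coordinatewise, so the product over [i] of [kmu_kt] selects [e = n]; it is
    exact for every box size. *)
Lemma gcoef_inversion n :
  t3 (tprod n) =
  \rsum_(d : {ffun 'I_r -> 'I_B}) (gcoef d * \rprod_(i < r) kt (n i) (d i)).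
Proof.
rewrite (eq_bigr (fun d : {ffun 'I_r -> 'I_B} => \rsum_(e : {ffun 'I_r -> 'I_B})
   (t3 (tprod e) * \rprod_(i < r) (kmu (d i) (e i) * kt (n i) (d i))))); last first.
  move=> d _; rewrite /gcoef big_distrl; apply: eq_bigr => e _ /=.
  by rewrite Rmult_assoc -big_split.
rewrite exchange_big (eq_bigr (fun e : {ffun 'I_r -> 'I_B} =>
   t3 (tprod e) * \rprod_(i < r) ind (nat_of_ord (n i) == e i))); last first.
  move=> e _; rewrite -big_distrr; congr (_ * _).
  rewrite -(bigA_distr_bigA (fun i (a : 'I_B) => kmu a (e i) * kt (n i) a)).
  by apply: eq_bigr => i _; rewrite kmu_kt.
rewrite (bigD1 n) //= [X in _ + X]big1 ?Rplus_0_r => [|e].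
  by rewrite big1 ?Rmult_1_r // => i _; rewrite eqxx.
move=> hne; have [i hi] : exists i, n i != e i.
  apply/existsP; apply: contraR hne; rewrite negb_exists => /forallP h.
  by apply/eqP/ffunP => i; have /negPn/eqP := h i.
rewrite (bigD1 i) //= /ind.
have /negbTE -> : nat_of_ord (n i) != e i by [].
by rewrite Rmult_0_l Rmult_0_r.
Qed.

(** The coordinates other than [i0] are fixed. Either one of them fails to divide and its [kmu]
    vanishes, or their product is prime to [p] and the sum over coordinate [i0] is zero by
    [mu3_t3_shifted]. *)
Lemma gcoef_support d (i0 : 'I_r) (p : nat) : prime p -> (p %| (d i0).+1)%N ->
  (forall j, j != i0 -> ~~ (p %| (d j).+1)%N) -> gcoef d = 0.
Proof.
move=> pp pd hp; apply: (@rsum_ffun_eq0 _ _ i0) => e.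
case he: [forall (j | j != i0), ((e j).+1 %| (d j).+1)%N]; last first.
  move/negbT: he; rewrite negb_forall => /existsP[j]; rewrite negb_imply => /andP[ji hj].
  apply: big1 => x _; rewrite [X in _ * X](bigD1 j) //= ffunE (negbTE ji).
  by rewrite /kmu /ind (negbTE hj) !Rmult_0_l Rmult_0_r.
move/forall_inP: he => he.
pose m := (\prod_(j < r | j != i0) (e j).+1)%N.
have m0 : (0 < m)%N by rewrite prodn_cond_gt0.
have pm : ~~ (p %| m)%N.
  rewrite /m; apply: (big_ind (fun k => ~~ (p %| k)%N)) => [|a b ha hb|j hj].
  - by rewrite dvdn1; apply/eqP => h; move: (prime_gt1 pp); rewrite h.
  - by rewrite Euclid_dvdM // negb_or ha.
  - by apply: contra (hp j hj) => h; apply: dvdn_trans h _; exact: he.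
pose c := \rprod_(j < r | j != i0) kmu (d j) (e j).
rewrite (eq_bigr (fun x : 'I_B => c * (ind (x.+1 %| (d i0).+1)%N *
   (mu3 ((d i0).+1 %/ x.+1) * t3 (x.+1 * m))))).
  rewrite -big_distrr.
  rewrite (rsum_divisors_ord (fun x => mu3 ((d i0).+1 %/ x) * t3 (x * m))) //.
  by rewrite (mu3_t3_shifted pp) //= Rmult_0_r.
move=> x _; rewrite /tprod (bigD1 i0) //= [X in _ * X](bigD1 i0) //= !ffunE eqxx.
have -> : (\prod_(i < r | i != i0) ([ffun i1 => if i1 == i0 then x else e i1] i).+1 = m)%N.
  by apply: eq_bigr => j hj; rewrite ffunE (negbTE hj).
have -> : \rprod_(i < r | i != i0) kmu (d i) ([ffun i1 => if i1 == i0 then x else e i1] i) = c.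
  by apply: eq_bigr => j hj; rewrite ffunE (negbTE hj).
by rewrite /kmu; ring.
Qed.

End Tuples.

Lemma INR_tprod (r B : nat) (d : {ffun 'I_r -> 'I_B}) :
  INR (tprod d) = \rprod_(i < r) INR (d i).+1.
Proof. by rewrite INR_prod. Qed.

Lemma rsum_ind_divisors_le (M B : nat) : (0 < M)%N ->
  \rsum_(x < B) ind (x.+1 %| M)%N <= INR (numdiv M).
Proof.
move=> M0.
have -> : INR (numdiv M) = \rsum_(x < B + M) ind (x.+1 %| M)%N.
  rewrite /numdiv -sum1_size INR_sum.
  rewrite -(rsum_divisors_ord (fun=> INR 1) M0 (leq_addl B M)).
  by apply: eq_bigr => x _; rewrite INR_1 Rmult_1_r.
rewrite (rsum_split _ _ (fun x => ind (x.+1 %| M)%N)).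
have : 0 <= \rsum_(i < M) ind ((B + i).+1 %| M)%N.
  by apply: rsum_ge0 => i _; rewrite /ind; case: (_ %| _)%N; lra.
by rewrite /=; lra.
Qed.

Lemma rprod_const (r : nat) (c : R) : \rprod_(i < r) c = c ^ r.
Proof. by rewrite big_const card_ord; elim: r => //= r ->. Qed.

(** The divisor bound is used with [eta / 3] three times: for [t3] of the product, for the values of
    [mu3], and for the number of tuples of divisors. *)
Lemma gcoef_bound (r : nat) (eta : R) : 0 < eta -> exists C, 0 <= C /\
  forall B (d : {ffun 'I_r -> 'I_B}),
    Rabs (gcoef d) <= C * \rprod_(i < r) Rpower (INR (d i).+1) eta.
Proof.
move=> he; have he3 : 0 < eta / 3 by lra.
have [C [C1 hC]] := divisor_bound he3.
exists (C * (C ^ r * C ^ r)); split.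
  by have := pow_R1_Rle C r C1; nra.
move=> B d; pose W (i : 'I_r) := Rpower (INR (d i).+1) (eta / 3).
have W0 i : 0 < W i by exact: Rpower_gt0.
apply: Rle_trans (Rabs_rsum_le _ (G := fun e : {ffun 'I_r -> 'I_B} =>
   C * \rprod_(i < r) W i * \rprod_(i < r) (ind ((e i).+1 %| (d i).+1)%N * (C * W i))) _) _.
  move=> e _; rewrite Rabs_mult rprod_Rabs.
  case he': [forall i, ((e i).+1 %| (d i).+1)%N]; last first.
    move/negbT: he'; rewrite negb_forall => /existsP[i hi].
    rewrite (bigD1 i) //= /kmu /ind (negbTE hi) Rmult_0_l Rabs_R0 Rmult_0_l Rmult_0_r.
    rewrite [X in _ * X](bigD1 i) //= (negbTE hi) !Rmult_0_l Rmult_0_r; lra.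
  move/forallP: he' => he'.
  apply: Rmult_le_compat; [exact: Rabs_pos | by apply: rprod_ge0 => i _; exact: Rabs_pos | |].
    apply: Rle_trans (hC t3 t3_submultiplicative _ (tprod_gt0 e)) _.
    apply: Rmult_le_compat_l; first lra.
    rewrite INR_tprod rprod_Rpower; last by move=> i _; exact: INRS_gt0.
    apply: (proj2 (rprod_le _ _)) => i _; split; first exact: Rpower_ge0.
    apply: Rpower_le_base; last lra.
    by split; [exact: INRS_gt0 | apply: leq_INR; apply: dvdn_leq].
  apply: (proj2 (rprod_le _ _)) => i _; split; first exact: Rabs_pos.
  rewrite /kmu Rabs_mult Rabs_pos_eq; last by rewrite /ind he'; lra.
  apply: Rmult_le_compat_l; first by rewrite /ind he'; lra.
  have q0 : (0 < (d i).+1 %/ (e i).+1)%N by rewrite divn_gt0 // dvdn_leq.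
  apply: Rle_trans (hC mu3 mu3_submultiplicative _ q0) _.
  apply: Rmult_le_compat_l; first lra.
  apply: Rpower_le_base; last lra.
  by split; [exact: INR_gt0 | apply: leq_INR; apply: leq_div].
rewrite -big_distrr -(bigA_distr_bigA (fun i (x : 'I_B) => ind (x.+1 %| (d i).+1)%N * (C * W i))) /=.
have hp : 0 <= \rprod_(i < r) W i by apply: rprod_ge0 => i _; apply: Rlt_le.
have -> : C * (C ^ r * C ^ r) * \rprod_(i < r) Rpower (INR (d i).+1) eta =
   C * \rprod_(i < r) W i * \rprod_(i < r) (C * W i * (C * W i)).
  rewrite -!rprod_const.
  have -> : \rprod_(i < r) Rpower (INR (d i).+1) eta = \rprod_(i < r) (W i * (W i * W i)).
    by apply: eq_bigr => i _; rewrite /W -!Rpower_plus; congr Rpower; field.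
  rewrite !big_split /=; ring.
apply: Rmult_le_compat_l; first by apply: Rmult_le_pos; [lra | exact: hp].
apply: (proj2 (rprod_le _ _)) => i _; split.
  apply: rsum_ge0 => x _; apply: Rmult_le_pos; first by rewrite /ind; case: (_ %| _)%N; lra.
  by apply: Rmult_le_pos; [lra | apply: Rlt_le].
rewrite -big_distrl /=; apply: Rmult_le_compat_r.
  by apply: Rmult_le_pos; [lra | apply: Rlt_le].
apply: Rle_trans (rsum_ind_divisors_le _ (ltn0Sn _)) _.
have := hC _ numdiv_submultiplicative _ (ltn0Sn (d i)).
by rewrite Rabs_pos_eq; [| exact: pos_INR].
Qed.

(* By [gcoef_support] the integer [\prod (d_i + 1) ^ c_i] is k-full on the support of
   [gcoef]; it lies between [m ^ k] and [m ^ (2 k)] for some [m] with all [d_i + 1]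
   dividing [m ^ (2 k)], so few tuples share a given [m]. *)
Lemma gcoef_summable (r k : nat) (c : 'I_r -> nat) (s : R) :
  (0 < k)%N -> (forall i, 0 < c i)%N -> (forall i j, i != j -> (k <= c i + c j)%N) ->
  0 < s -> 1 < INR k * s ->
  exists K, 0 <= K /\ forall B,
    \rsum_(d : {ffun 'I_r -> 'I_B})
       (Rabs (gcoef d) * \rprod_(i < r) Rpower (INR (d i).+1) (- (INR (c i) * s))) <= K.
Proof.
move=> k0 c0 hck s0 ks.
pose delta := (INR k * s - 1) / 2; have dl0 : 0 < delta by rewrite /delta; lra.
have k1 := INR_ge1 k0; have r0 := pos_INR r.
(* Each [d_i + 1] divides [m^(2k)], so the size of [gcoef] and the number of tuples each cost
   [m^(2 k r eta)]. Together this is at most [m^delta], and [k s = 1 + 2 delta] leaves the exponent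
   [-1 - delta]. *)
pose eta := delta / (4 * INR k * (INR r + 1)).
have kr0 : 0 < 4 * INR k * (INR r + 1) by apply: Rmult_lt_0_compat; lra.
have eta0 : 0 < eta by exact: Rdiv_lt_0_compat.
have heta : 4 * INR k * INR r * eta <= delta.
  have -> : delta = 4 * INR k * (INR r + 1) * eta by rewrite /eta; field; lra.
  by apply: Rmult_le_compat_r; lra || nra.
have [C1 [hC1 hG]] := gcoef_bound r eta0.
have [C2 [hC2 hD]] := divisor_bound eta0.
have C2r := pow_R1_Rle C2 r hC2.
exists (C1 * C2 ^ r * (1 + / delta)); split.
  have := Rinv_0_lt_compat _ dl0 => i0.
  by apply: Rmult_le_pos; [apply: Rmult_le_pos | ]; lra.
move=> B; pose N (d : {ffun 'I_r -> 'I_B}) := (\prod_(i < r) (d i).+1 ^ c i)%N.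
pose MM := (\max_(d : {ffun 'I_r -> 'I_B}) N d)%N.
have N0 d : (0 < N d)%N by rewrite prodn_gt0 // => i; rewrite expn_gt0.
have dN (d : {ffun 'I_r -> 'I_B}) (i : 'I_r) : ((d i).+1 %| N d)%N.
  by rewrite /N (bigD1 i) //= dvdn_mulr // dvdn_exp.
pose term m (d : {ffun 'I_r -> 'I_B}) := C1 * Rpower (INR m.+1) (2 * INR k * INR r * eta - INR k * s) *
   \rprod_(i < r) ind ((d i).+1 %| m.+1 ^ (2 * k))%N.
have term0 m d : 0 <= term m d.
  apply: Rmult_le_pos; first by apply: Rmult_le_pos; [| exact: Rpower_ge0].
  by apply: rprod_ge0 => i _; rewrite /ind; case: (_ %| _)%N; lra.
have key (d : {ffun 'I_r -> 'I_B}) : Rabs (gcoef d) * \rprod_(i < r) Rpower (INR (d i).+1) (- (INR (c i) * s)) <=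
    \rsum_(m < MM) term m d.
  have [->|g0] := Req_dec (gcoef d) 0.
    by rewrite Rabs_R0 Rmult_0_l; apply: rsum_ge0.
  have full p : prime p -> (p %| N d)%N -> (k <= logn p (N d))%N.
    move=> pp pN; have [i hi] : exists i, (p %| (d i).+1)%N.
      apply/existsP; apply: contraLR pN; rewrite negb_exists => /forallP h.
      rewrite /N; apply: (big_ind (fun q => ~~ (p %| q)%N)) => [|a b ha hb|j _].
      - by rewrite dvdn1; apply/eqP => e; move: (prime_gt1 pp); rewrite e.
      - by rewrite Euclid_dvdM // negb_or ha.
      - by rewrite Euclid_dvdX // negb_and (h j).
    have [j ji hj] : exists2 j, j != i & (p %| (d j).+1)%N.
      case h: [exists (j | j != i), (p %| (d j).+1)%N]; first by move/exists_inP: h.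
      move/negbT: h; rewrite negb_exists => /forallP h; case: g0.
      apply: (gcoef_support pp hi) => j ji; have := h j.
      by rewrite negb_and negbK (negbTE ji).
    rewrite /N (bigD1 i) //= (bigD1 j) //=.
    have q0 : (0 < \prod_(i0 < r | (i0 != i) && (i0 != j)) (d i0).+1 ^ c i0)%N.
      by rewrite prodn_cond_gt0 // => i1 _; rewrite expn_gt0.
    rewrite !lognM ?muln_gt0 ?expn_gt0 ?q0 // !lognX.
    have li : (0 < logn p (d i).+1)%N by rewrite logn_gt0 mem_primes pp hi.
    have lj : (0 < logn p (d j).+1)%N by rewrite logn_gt0 mem_primes pp hj.
    have := hck i j; rewrite eq_sym => /(_ ji) h.
    apply: leq_trans h _; rewrite addnA; apply: leq_trans (leq_addr _ _).
    by apply: leq_add; rewrite leq_pmulr.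
  have [m [m0 mN Nm]] := kfull_root k0 (N0 d) full.
  have mMM : (m.-1 < MM)%N.
    have h1 : (m <= N d)%N.
      apply: leq_trans (dvdn_leq (N0 d) mN).
      by rewrite -{1}(expn1 m) leq_pexp2l.
    have h2 : (N d <= MM)%N by apply: (leq_bigmax d).
    by rewrite prednK //; apply: leq_trans h1 h2.
  rewrite (bigD1 (Ordinal mMM)) //=.
  have rest : 0 <= \big[Rplus/0]_(i < MM | i != Ordinal mMM) term i d.
    by apply: rsum_ge0 => i _; exact: term0.
  suff : Rabs (gcoef d) * \rprod_(i < r) Rpower (INR (d i).+1) (- (INR (c i) * s)) <= term m.-1 d.
    by move=> h; apply: Rle_trans h _; rewrite -[X in X <= _]Rplus_0_r; apply: Rplus_le_compat_l.
  have m1 := INR_ge1 m0.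
  have dm i : ((d i).+1 %| m ^ (2 * k))%N by apply: dvdn_trans Nm.
  rewrite /term prednK //.
  have -> : \rprod_(i < r) ind ((d i).+1 %| m ^ (2 * k))%N = 1.
    by apply: big1 => i _; rewrite dm.
  rewrite Rmult_1_r.
  have b1 : \rprod_(i < r) Rpower (INR (d i).+1) (- (INR (c i) * s)) <= Rpower (INR m) (- (INR k * s)).
    have -> : \rprod_(i < r) Rpower (INR (d i).+1) (- (INR (c i) * s)) = Rpower (INR (N d)) (- s).
      rewrite INR_prod rprod_Rpower; last by move=> i _; apply: INR_gt0; rewrite expn_gt0.
      apply: eq_bigr => i _; rewrite INR_expn -Rpower_natr; last exact: INRS_gt0.
      by rewrite Rpower_mult; congr Rpower; ring.
    have -> : Rpower (INR m) (- (INR k * s)) = Rpower (INR (m ^ k)) (- s).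
      by rewrite INR_expn -Rpower_natr ?Rpower_mult; [congr Rpower; ring | lra].
    rewrite !Rpower_Ropp; apply: Rinv_le_contravar; first exact: Rpower_gt0.
    apply: Rpower_le_base; last lra.
    split; first by apply: INR_gt0; rewrite expn_gt0 m0.
    by apply: leq_INR; apply: dvdn_leq.
  have b2 : Rabs (gcoef d) <= C1 * Rpower (INR m) (2 * INR k * INR r * eta).
    apply: Rle_trans (hG B d) _; apply: Rmult_le_compat_l => //.
    have -> : Rpower (INR m) (2 * INR k * INR r * eta) = \rprod_(i < r) Rpower (INR (m ^ (2 * k))) eta.
      rewrite rprod_const -Rpower_natr; last exact: Rpower_gt0.
      rewrite INR_expn -Rpower_natr; last lra.
      by rewrite !Rpower_mult mult_INR INR_2; congr Rpower; ring.
    apply: (proj2 (rprod_le _ _)) => i _; split; first exact: Rpower_ge0.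
    apply: Rpower_le_base; last lra.
    split; first exact: INRS_gt0.
    by apply: leq_INR; apply: dvdn_leq; rewrite ?expn_gt0 ?m0.
  rewrite /Rminus Rpower_plus -Rmult_assoc; apply: Rmult_le_compat => //; first exact: Rabs_pos.
  by apply: rprod_ge0 => i _; exact: Rpower_ge0.
apply: Rle_trans (rsum_le _ (fun d _ => key d)) _.
rewrite exchange_big /=.
apply: Rle_trans (rsum_le _ (G := fun m : 'I_MM => C1 * C2 ^ r * Rpower (INR m.+1) (- 1 - delta)) _) _.
  move=> m _; rewrite /term -big_distrr.
  rewrite -(bigA_distr_bigA (fun i (x : 'I_B) => ind (x.+1 %| m.+1 ^ (2 * k))%N)) /=.
  have m1 := INRS_ge1 m; set M := (m.+1 ^ (2 * k))%N.
  have M0 : (0 < M)%N by rewrite expn_gt0.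
  have h1 : \rprod_(i < r) \rsum_(x < B) ind (x.+1 %| M)%N <=
      C2 ^ r * Rpower (INR m.+1) (2 * INR k * INR r * eta).
    apply: Rle_trans (_ : \rprod_(i < r) (C2 * Rpower (INR M) eta) <= _).
      apply: (proj2 (rprod_le _ _)) => i _; split.
        by apply: rsum_ge0 => x _; rewrite /ind; case: (_ %| _)%N; lra.
      apply: Rle_trans (rsum_ind_divisors_le _ M0) _.
      have := hD _ numdiv_submultiplicative _ M0.
      by rewrite Rabs_pos_eq; [| exact: pos_INR].
    rewrite rprod_const Rpow_mult_distr; apply: Req_le; congr (_ * _).
    rewrite -Rpower_natr; last exact: Rpower_gt0.
    rewrite INR_expn -Rpower_natr; last lra.
    by rewrite !Rpower_mult mult_INR INR_2; congr Rpower; ring.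
  have p0 := Rpower_ge0 (INR m.+1) (2 * INR k * INR r * eta - INR k * s).
  apply: Rle_trans (Rmult_le_compat_l _ _ _ (Rmult_le_pos _ _ hC1 p0) h1) _.
  have -> : C1 * Rpower (INR m.+1) (2 * INR k * INR r * eta - INR k * s) *
     (C2 ^ r * Rpower (INR m.+1) (2 * INR k * INR r * eta)) =
     C1 * C2 ^ r * (Rpower (INR m.+1) (2 * INR k * INR r * eta - INR k * s) *
     Rpower (INR m.+1) (2 * INR k * INR r * eta)) by ring.
  rewrite -Rpower_plus; apply: Rmult_le_compat_l; first by apply: Rmult_le_pos; lra.
  by apply: Rpower_le_exp => //; rewrite /delta in heta *; lra.
rewrite rsumZ; apply: Rmult_le_compat_l; first by apply: Rmult_le_pos; lra.
exact: sum_Rpower_le.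
Qed.

(** * The remainder of the ternary divisor problem *)

Definition dsum (y : R) : R := INR (tau_sum 3 y).

Lemma dsumE (y : R) : dsum y = \rsum_(n < nat_floor y) t3 n.+1.
Proof. by rewrite /dsum /tau_sum big_add1 /= INR_sum big_mkord. Qed.

Definition riesz (y : R) : R := \rsum_(n < nat_floor y) (t3 n.+1 * (y - INR n.+1)).

Lemma riesz_pos (y : R) (N : nat) : 0 <= y -> y <= INR N ->
  riesz y = \rsum_(n < N) (t3 n.+1 * pos (y - INR n.+1)).
Proof.
move=> y0 yN; have h1 := nat_floor_le y0; have h2 := nat_floor_gt y.
have hN : (nat_floor y <= N)%N by apply: INR_leq; lra.
rewrite /riesz -(rsum_trunc (fun n => t3 n.+1 * (y - INR n.+1)) hN).
apply: eq_bigr => n _; case: ltnP => hn; rewrite /ind.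
  by rewrite pos_eq ?Rmult_1_l //; have := leq_INR hn; lra.
rewrite pos_eq0 ?Rmult_0_l ?Rmult_0_r //.
by have := leq_INR hn; rewrite S_INR; lra.
Qed.

Lemma riesz_riesz3 (y : R) (N : nat) : 0 <= y -> y <= INR N -> riesz y = riesz3 N y.
Proof.
move=> y0 yN; rewrite (riesz_pos y0 yN) /riesz3.
pose e a b c n := ind ((a.+1 * b.+1 * c.+1)%N == n.+1).
rewrite (eq_bigr (fun n : 'I_N => \rsum_(a < N) \rsum_(b < N) \rsum_(c < N)
   (e a b c n * pos (y - INR n.+1)))); last first.
  move=> n _; rewrite /t3 (tau3_box (ltn0Sn n) (ltn_ord n)) INR_sum big_distrl.
  apply: eq_bigr => a _ /=; rewrite INR_sum big_distrl.
  apply: eq_bigr => b _ /=; rewrite INR_sum big_distrl.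
  apply: eq_bigr => c _ /=; congr (_ * _).
  by rewrite /e /ind; case: eqP; rewrite ?INR_1.
rewrite exchange_big; apply: eq_bigr => a _; rewrite exchange_big; apply: eq_bigr => b _.
rewrite exchange_big; apply: eq_bigr => c _.
set m := (a.+1 * b.+1 * c.+1)%N; have m0 : (0 < m)%N by rewrite !muln_gt0.
have hm : INR a.+1 * INR b.+1 * INR c.+1 = INR m by rewrite /m !mult_INR.
have hE n : e a b c n = ind (m == n.+1) by [].
rewrite hm; clearbody m; clear hm; under eq_bigr => n _ do rewrite hE.
case: (leqP m N) => mN.
  have mN' : (m.-1 < N)%N by lia.
  rewrite (bigD1 (Ordinal mN')) //= [X in _ + X]big1 ?Rplus_0_r.
    by rewrite prednK // eqxx /ind Rmult_1_l.
  move=> n hn; rewrite /ind; case: eqP => h; last by rewrite Rmult_0_l.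
  by case/eqP: hn; apply: val_inj => /=; rewrite h.
rewrite pos_eq0; last by have := leq_INR (ltnW mN); lra.
apply: big1 => n _; rewrite /ind; case: eqP => h; last by rewrite Rmult_0_l.
by have := ltn_ord n; rewrite -ltnS -h ltnS leqNgt mN.
Qed.

(** [riesz] is a primitive of the nondecreasing step function [dsum], so its mean slope lies between
    the end values. This is how bounds for the mean become pointwise bounds. *)
Lemma riesz_increment (a b : R) : 0 <= a <= b ->
  dsum a * (b - a) <= riesz b - riesz a <= dsum b * (b - a).
Proof.
move=> hab; pose N := (nat_floor b).+1.
have bN : b <= INR N by rewrite /N S_INR; have := nat_floor_gt b; lra.
rewrite (@riesz_pos b N) ?(@riesz_pos a N); try lra.
have hd y : 0 <= y <= b -> dsum y = \rsum_(n < N) (ind (n < nat_floor y)%N * t3 n.+1).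
  move=> hy; rewrite dsumE -(rsum_trunc (fun n => t3 n.+1) (N := N)) //.
  have h1 := @nat_floor_le y ltac:(lra); apply: INR_leq; lra.
rewrite !hd; try lra.
rewrite -rsumB !big_distrl /=; split; apply: rsum_le => n _; have t0 := t3_ge0 n.+1.
  case: ltnP => hn; rewrite /ind; last first.
    rewrite !Rmult_0_l /pos; have := Rmax_r 0 (b - INR n.+1) => h1.
    have : Rmax 0 (a - INR n.+1) <= Rmax 0 (b - INR n.+1) by apply: Rle_max_compat_l; lra.
    by move=> h2; have := Rmult_le_compat_l _ _ _ t0 h2; lra.
  have h := leq_INR hn; have := @nat_floor_le a ltac:(lra) => h2.
  by rewrite !pos_eq; lra.
case: ltnP => hn; rewrite /ind; last first.
  have h := leq_INR hn; have h2 := nat_floor_gt b.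
  by rewrite [INR n.+1]S_INR !pos_eq0; lra.
have hp : pos (b - INR n.+1) - pos (a - INR n.+1) <= b - a.
  have h := leq_INR hn; have := @nat_floor_le b ltac:(lra) => h2.
  rewrite (pos_eq (x := b - _)); last lra.
  by rewrite /pos; have := Rmax_r 0 (a - INR n.+1); lra.
by have := Rmult_le_compat_l _ _ _ t0 hp; lra.
Qed.

Definition quad (a b c : R) (L : R) : R := a * L ^ 2 + b * L + c.

(** Both signs of the exponent occur because the argument will be [x / d], which may lie below 1. *)
Lemma quad_ln_bound (a b c eta : R) : 0 < eta -> exists K, 0 <= K /\
  forall y, 0 < y -> Rabs (quad a b c (ln y)) <= K * (Rpower y eta + Rpower y (- eta)).
Proof.
move=> he; pose h := eta / 2; have h0 : 0 < h by rewrite /h; lra.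
have ih := Rinv_0_lt_compat _ h0.
exists ((Rabs a + Rabs b) * (2 / h ^ 2) + Rabs b + Rabs c); split.
  have := Rabs_pos a; have := Rabs_pos b; have := Rabs_pos c.
  have : 0 < 2 / h ^ 2 by apply: Rdiv_lt_0_compat; [lra | exact: pow_lt].
  nra.
move=> y y0; set S := Rpower y eta + Rpower y (- eta).
have p1 := Rpower_gt0 y h; have p2 := Rpower_gt0 y (- h).
have pp : Rpower y h * Rpower y (- h) = 1.
  by rewrite -Rpower_plus Rplus_opp_r Rpower_O.
have e1 : Rpower y eta = Rpower y h ^ 2.
  by rewrite -Rpower_natr // Rpower_mult INR_2; congr Rpower; rewrite /h; field.
have e2 : Rpower y (- eta) = Rpower y (- h) ^ 2.
  by rewrite -Rpower_natr // Rpower_mult INR_2; congr Rpower; rewrite /h; field.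
have S1 : 1 <= S by rewrite /S e1 e2; nra.
have l1 := ln_le_Rpower y0 h0.
have l2 := @ln_le_Rpower (/ y) h (Rinv_0_lt_compat _ y0) h0.
rewrite ln_Rinv // Rpower_inv // in l2.
have hL : Rabs (ln y) <= (Rpower y h + Rpower y (- h)) / h.
  apply: Rabs_le; rewrite Rdiv_plus_distr.
  have := Rdiv_lt_0_compat _ _ p1 h0; have := Rdiv_lt_0_compat _ _ p2 h0; lra.
have hL2 : ln y ^ 2 <= 2 / h ^ 2 * S.
  rewrite -(pow2_abs (ln y)).
  have := pow_incr _ _ 2 (conj (Rabs_pos (ln y)) hL).
  have -> : ((Rpower y h + Rpower y (- h)) / h) ^ 2 = (Rpower y h + Rpower y (- h)) ^ 2 / h ^ 2 by field; lra.
  move=> g; apply: Rle_trans g _.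
  have -> : 2 / h ^ 2 * S = (2 * S) / h ^ 2 by field; lra.
  apply: Rmult_le_compat_r; first by apply: Rlt_le; apply: Rinv_0_lt_compat; exact: pow_lt.
  by rewrite /S e1 e2; have := pow2_ge_0 (Rpower y h - Rpower y (- h)); lra.
have hL1 : Rabs (ln y) <= 1 + ln y ^ 2.
  by rewrite -(pow2_abs (ln y)); have := Rabs_pos (ln y); nra.
rewrite /quad; apply: Rle_trans (Rabs_triang _ _) _.
have := Rabs_triang (a * ln y ^ 2) (b * ln y).
rewrite (Rabs_mult a) (Rabs_mult b) (Rabs_pos_eq (ln y ^ 2)) => [g1|]; last exact: pow2_ge_0.
have a0 := Rabs_pos a; have b0 := Rabs_pos b; have c0 := Rabs_pos c.
have q1 := Rmult_le_compat_l _ _ _ a0 hL2.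
have q2 := Rmult_le_compat_l _ _ _ b0 hL1.
have q3 := Rmult_le_compat_l _ _ _ b0 hL2.
have q4 := Rmult_le_compat_l _ _ _ b0 S1.
have q5 := Rmult_le_compat_l _ _ _ c0 S1.
lra.
Qed.

(** A two-term bound in [y = x / d] separates the variables: the larger exponent governs the growth
    in [x], the smaller one the decay in [d]. *)
Lemma scaled_power_bound (F : R -> R) (C a e : R) : 0 <= C -> 0 <= e ->
  (forall y, 0 < y -> Rabs (F y) <= C * (Rpower y (a + e) + Rpower y a)) ->
  forall x d, 1 <= x -> 1 <= d -> Rabs (F (x / d)) <= 2 * C * (Rpower x (a + e) * Rpower d (- a)).
Proof.
move=> hC he hF x d x1 d1; apply: Rle_trans (hF _ _) _.
  by apply: Rdiv_lt_0_compat; lra.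
rewrite !Rpower_div; try lra.
have px := Rpower_ge0 x (a + e); have pd := Rpower_ge0 d (- a).
have h1 : Rpower x (a + e) * Rpower d (- (a + e)) <= Rpower x (a + e) * Rpower d (- a).
  by apply: Rmult_le_compat_l => //; apply: Rpower_le_exp; lra.
have h2 : Rpower x a * Rpower d (- a) <= Rpower x (a + e) * Rpower d (- a).
  by apply: Rmult_le_compat_r => //; apply: Rpower_le_exp; lra.
have := Rmult_le_compat_l _ _ _ hC h1; have := Rmult_le_compat_l _ _ _ hC h2; lra.
Qed.

Section Constants.
Variables (g g1 : R).

(* [y * mainQ (ln y)] is the residue of [zeta(s)^3 y^s / s] at 1 when
   [zeta(1 + u) = 1/u + g - g1 u + ...]. *)
Definition mainQ (L : R) : R := quad (1 / 2) (3 * g - 1) (3 * g ^ 2 - 3 * g - 3 * g1 + 1) L.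
Definition mainQ' (L : R) : R := L + (3 * g - 1).
Definition main3 (y : R) : R := y * mainQ (ln y).
Definition main3' (y : R) : R := mainQ (ln y) + mainQ' (ln y).
Definition delta3 (y : R) : R := dsum y - main3 y.
Definition rieszI (y : R) : R := riesz y - y ^ 2 * riesz3_poly g g1 (ln y).

Lemma is_derive_main3 (y : R) : 0 < y -> is_derive main3 y (main3' y).
Proof.
move=> hy; rewrite /main3 /main3' /mainQ /mainQ' /quad; auto_derive; first by [].
by rewrite INR_2; field; lra.
Qed.

Lemma is_derive_riesz_main (y : R) : 0 < y ->
  is_derive (fun y => y ^ 2 * riesz3_poly g g1 (ln y)) y (main3 y).
Proof.
move=> hy; rewrite /main3 /mainQ /quad /riesz3_poly; auto_derive; first by [].
by rewrite INR_2; field; lra.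
Qed.

Lemma main3_bound (eta : R) : 0 < eta -> exists K, 0 <= K /\ forall y, 0 < y ->
  Rabs (main3 y) <= K * (Rpower y (1 - eta + 2 * eta) + Rpower y (1 - eta)).
Proof.
move=> he; have [K [K0 hK]] := quad_ln_bound (1 / 2) (3 * g - 1) (3 * g ^ 2 - 3 * g - 3 * g1 + 1) he.
exists K; split => // y hy; rewrite /main3 Rabs_mult Rabs_pos_eq; last lra.
apply: Rle_trans (Rmult_le_compat_l _ _ _ (Rlt_le _ _ hy) (hK y hy)) _.
have -> : 1 - eta + 2 * eta = 1 + eta by ring.
by rewrite /Rminus !Rpower_plus Rpower_1 //; lra.
Qed.

Lemma main3'_bound (eta : R) : 0 < eta -> exists K, 0 <= K /\ forall y, 0 < y ->
  Rabs (main3' y) <= K * (Rpower y (- eta + 2 * eta) + Rpower y (- eta)).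
Proof.
move=> he.
have [K [K0 hK]] := quad_ln_bound (1 / 2) (3 * g - 1 + 1) (3 * g ^ 2 - 3 * g - 3 * g1 + 1 + (3 * g - 1)) he.
exists K; split => // y hy.
have -> : - eta + 2 * eta = eta by ring.
by apply: Rle_trans (hK y hy); apply: Req_le; congr Rabs; rewrite /main3' /mainQ /mainQ' /quad; ring.
Qed.

Hypothesis riesz3_asymp : riesz3_bound g g1.

Lemma rieszI_bound (eta : R) : 0 < eta -> exists C, 0 <= C /\ forall y, 0 < y ->
  Rabs (rieszI y) <= C * (Rpower y (7 / 6 + eta) + Rpower y (7 / 6)).
Proof.
move=> he; have [C [C0 hC]] := riesz3_asymp.
have [K [K0 hK]] := quad_ln_bound (1 / 4) (3 / 2 * g - 3 / 4)
   (- (3 / 2) * g1 + 3 * (g - 3 / 4) * g - 3 / 2 * g ^ 2 + 7 / 8) (eta := 1 / 2) ltac:(lra).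
have ie := Rinv_0_lt_compat _ he.
exists (C * (1 + / eta) + 2 * K); split; first by nra.
move=> y hy; have p0 := Rpower_ge0 y (7 / 6); have q0 := Rpower_ge0 y (7 / 6 + eta).
have c1 : 0 <= C * (1 + / eta) by nra.
have [h|h] := Rle_dec 1 y.
  pose N := (nat_floor y).+1.
  have yN : y <= INR N by rewrite /N S_INR; have := nat_floor_gt y; lra.
  rewrite /rieszI (@riesz_riesz3 y N) //; last lra.
  apply: Rle_trans (hC y N h yN) _.
  have l1 := ln_le_Rpower hy he.
  have e1 : Rpower y (7 / 6 + eta) = Rpower y (7 / 6) * Rpower y eta by rewrite Rpower_plus.
  have h1 := Rpower_ge1 h (Rlt_le _ _ he).
  have h2 : 1 + ln y <= (1 + / eta) * Rpower y eta by rewrite Rmult_plus_distr_r; rewrite /Rdiv in l1; lra.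
  have h3 := Rmult_le_compat_l _ _ _ (Rmult_le_pos _ _ C0 p0) h2.
  have h4 : 0 <= 2 * K * (Rpower y (7 / 6 + eta) + Rpower y (7 / 6)) by nra.
  have h5 : 0 <= C * (1 + / eta) * Rpower y (7 / 6) by nra.
  rewrite Rmult_plus_distr_r; rewrite e1 in h4 q0 *; nra.
(* Below 1 only the main term survives; [y^2] times [y^(1/2)] or [y^(-1/2)] is at most [y^(7/6)]
   there. *)
have -> : rieszI y = - (y ^ 2 * quad (1 / 4) (3 / 2 * g - 3 / 4)
   (- (3 / 2) * g1 + 3 * (g - 3 / 4) * g - 3 / 2 * g ^ 2 + 7 / 8) (ln y)).
  rewrite /rieszI /riesz; have -> : nat_floor y = 0%N by apply: nat_floor_unique; rewrite /INR; lra.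
  by rewrite rsum0 /riesz3_poly /quad; field.
rewrite Rabs_Ropp Rabs_mult Rabs_pos_eq; last exact: pow2_ge_0.
apply: Rle_trans (Rmult_le_compat_l _ _ _ (pow2_ge_0 y) (hK y hy)) _.
have anti u v : u <= v -> Rpower y v <= Rpower y u.
  move=> huv; have -> : v = u + (v - u) by ring.
  rewrite Rpower_plus -[X in _ <= X]Rmult_1_r; apply: Rmult_le_compat_l; first exact: Rpower_ge0.
  by rewrite -(Rpower_base1 (v - u)); apply: Rpower_le_base; lra.
have e2 : y ^ 2 = Rpower y 2 by rewrite -(Rpower_natr 2) // INR_2.
have t1 : y ^ 2 * Rpower y (1 / 2) <= Rpower y (7 / 6) by rewrite e2 -Rpower_plus; apply: anti; lra.
have t2 : y ^ 2 * Rpower y (- (1 / 2)) <= Rpower y (7 / 6) by rewrite e2 -Rpower_plus; apply: anti; lra.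
have := Rmult_le_compat_l _ _ _ K0 t1; have := Rmult_le_compat_l _ _ _ K0 t2; nra.
Qed.

(** Monotonicity over a window of length [H] on either side of [y] gives an error [H y^eta] from the
    variation of the main term plus [y^(7/6 + eta) / H] from [rieszI]. *)
Lemma delta3_bound (eta : R) : 0 < eta <= 1 / 4 -> exists C, 0 <= C /\ forall y, 0 < y ->
  Rabs (delta3 y) <= C * (Rpower y (7 / 12 + eta) + Rpower y (7 / 12)).
Proof.
move=> he; have [C [C0 hC]] := rieszI_bound (proj1 he).
have [K [K0 hK]] := main3'_bound (proj1 he).
have [K1 [K10 hK1]] := main3_bound (eta := 1 / 4) ltac:(lra).
exists (8 * K + 64 * C + 2 * K1); split; first lra.
move=> y hy; have p0 := Rpower_ge0 y (7 / 12); have q0 := Rpower_ge0 y (7 / 12 + eta).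
have [h|h] := Rle_dec 1 y; last first.
  have -> : delta3 y = - main3 y.
    rewrite /delta3 dsumE; have -> : nat_floor y = 0%N by apply: nat_floor_unique; rewrite /INR; lra.
    by rewrite rsum0; ring.
  rewrite Rabs_Ropp; apply: Rle_trans (hK1 y hy) _.
  have anti u v : u <= v -> Rpower y v <= Rpower y u.
    move=> huv; have -> : v = u + (v - u) by ring.
    rewrite Rpower_plus -[X in _ <= X]Rmult_1_r; apply: Rmult_le_compat_l; first exact: Rpower_ge0.
    by rewrite -(Rpower_base1 (v - u)); apply: Rpower_le_base; lra.
  have t1 := anti (7 / 12) (1 - 1 / 4 + 2 * (1 / 4)) ltac:(lra).
  have t2 := anti (7 / 12) (1 - 1 / 4) ltac:(lra).
  nra.
suff : Rabs (delta3 y) <= (8 * K + 64 * C) * Rpower y (7 / 12 + eta) by nra.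
(* The exponent 7/12 balances the two errors; the factor 1/2 keeps the window inside
   [[y / 2, 2 y]]. *)
pose H := Rpower y (7 / 12) / 2.
have pge : 1 <= Rpower y (7 / 12) by apply: Rpower_ge1; lra.
have ple : Rpower y (7 / 12) <= y by rewrite -[X in _ <= X](Rpower_1 y) //; apply: Rpower_le_exp; lra.
have H0 : 0 < H by rewrite /H; lra.
have Hy : H <= y / 2 by rewrite /H; lra.
have p2 z : y / 2 <= z <= 2 * y -> forall a, 0 <= a <= 2 -> Rpower z a <= 4 * Rpower y a.
  move=> hz a ha; apply: Rle_trans (_ : Rpower (2 * y) a <= _); first by apply: Rpower_le_base; lra.
  rewrite Rpower_mulE; [|lra|lra]; apply: Rmult_le_compat_r; first exact: Rpower_ge0.
  have : Rpower 2 a <= Rpower 2 2 by apply: Rpower_le_exp; lra.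
  have -> : Rpower 2 2 = 4 by rewrite -{2}INR_2 Rpower_natr; [ring | lra].
  by [].
have bM' z : y / 2 <= z <= 2 * y -> Rabs (main3' z) <= 8 * K * Rpower y eta.
  move=> hz; apply: Rle_trans (hK z _) _; first lra.
  have t1 : Rpower z (- eta + 2 * eta) <= 4 * Rpower y eta.
    have -> : - eta + 2 * eta = eta by ring.
    by apply: p2; lra.
  have t2 : Rpower z (- eta) <= 4 * Rpower y eta.
    have hy1 : 1 <= Rpower y eta by apply: Rpower_ge1; lra.
    apply: Rle_trans (_ : Rpower (1 / 2) (- eta) <= _).
      by apply: Rpower_le_neg; lra.
    have -> : 1 / 2 = / 2 by field.
    rewrite Rpower_inv ?Ropp_involutive; last lra.
    have : Rpower 2 eta <= Rpower 2 1 by apply: Rpower_le_exp; lra.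
    by rewrite Rpower_1; lra.
  have := Rmult_le_compat_l _ _ _ K0 t1; have := Rmult_le_compat_l _ _ _ K0 t2; lra.
have bI z : y / 2 <= z <= 2 * y -> Rabs (rieszI z) <= 8 * C * Rpower y (7 / 6 + eta).
  move=> hz; apply: Rle_trans (hC z _) _; first lra.
  have t1 := p2 z hz (7 / 6 + eta) ltac:(lra).
  have t2 := p2 z hz (7 / 6) ltac:(lra).
  have t3 : Rpower y (7 / 6) <= Rpower y (7 / 6 + eta) by apply: Rpower_le_exp; lra.
  have := Rmult_le_compat_l _ _ _ C0 t1; have := Rmult_le_compat_l _ _ _ C0 t2.
  have := Rmult_le_compat_l _ _ _ C0 t3; lra.
pose MP z := z ^ 2 * riesz3_poly g g1 (ln z).
have bMP a b : y / 2 <= a -> a <= b -> b <= 2 * y -> b - a = H -> a = y \/ b = y ->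
    Rabs (MP b - MP a - H * main3 y) <= H * H * (8 * K * Rpower y eta).
  move=> ha hab hb hH hy'.
  have [z hz e] := @MVT_is_derive MP main3 a b hab (fun t ht => is_derive_riesz_main (y := t) ltac:(lra)).
  rewrite e hH; have -> : main3 z * H - H * main3 y = H * (main3 z - main3 y) by ring.
  rewrite Rabs_mult Rabs_pos_eq; last lra.
  rewrite Rmult_assoc; apply: Rmult_le_compat_l; first lra.
  have lip u v : u <= v -> y / 2 <= u -> v <= 2 * y -> v - u <= H ->
      Rabs (main3 v - main3 u) <= H * (8 * K * Rpower y eta).
    move=> huv hu hv huv'.
    apply: Rle_trans (@MVT_abs_le main3 main3' u v (8 * K * Rpower y eta) huv _ _) _.
    - by move=> t ht; apply: is_derive_main3; lra.
    - by move=> t ht; apply: bM'; lra.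
    rewrite Rmult_comm; apply: Rmult_le_compat_r => //.
    by have := Rpower_ge0 y eta; nra.
  have [hzy|hzy] := Rle_dec z y; last by apply: lip; lra.
  by rewrite Rabs_minus_sym; apply: lip; lra.
have hbig : H * (8 * K * Rpower y eta) + 16 * C * Rpower y (7 / 6 + eta) / H <=
   (8 * K + 64 * C) * Rpower y (7 / 12 + eta).
  have e1 : Rpower y (7 / 12 + eta) = Rpower y (7 / 12) * Rpower y eta by rewrite Rpower_plus.
  have e2 : Rpower y (7 / 6 + eta) = Rpower y (7 / 12) * Rpower y (7 / 12) * Rpower y eta.
    by rewrite -!Rpower_plus; congr Rpower; field.
  rewrite e2 /H e1; set P := Rpower y (7 / 12) in pge *; set E := Rpower y eta.
  have -> : 16 * C * (P * P * E) / (P / 2) = 32 * C * P * E by field; lra.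
  have E0 : 0 <= E := Rpower_ge0 _ _.
  have : 0 <= P * E by apply: Rmult_le_pos; lra.
  move=> PE; have := Rmult_le_pos _ _ K0 PE; have := Rmult_le_pos _ _ C0 PE; nra.
have fin X : H * X <= H * H * (8 * K * Rpower y eta) + 16 * C * Rpower y (7 / 6 + eta) ->
    X <= (8 * K + 64 * C) * Rpower y (7 / 12 + eta).
  move=> hX; apply: Rle_trans hbig; apply: (Rmult_le_reg_l H) => //.
  apply: Rle_trans hX _; apply: Req_le; field; lra.
have rE z : riesz z = MP z + rieszI z by rewrite /rieszI /MP; ring.
apply: Rabs_le; split.
  apply: Ropp_le_cancel; rewrite Ropp_involutive; apply: fin.
  have [_ h1] := @riesz_increment (y - H) y ltac:(lra).
  have /Rabs_le_between h2 := bMP (y - H) y ltac:(lra) ltac:(lra) ltac:(lra) ltac:(lra) (or_intror erefl).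
  have /Rabs_le_between h3 := bI y ltac:(lra).
  have /Rabs_le_between h4 := bI (y - H) ltac:(lra).
  rewrite !rE in h1; have e : y - (y - H) = H by ring.
  rewrite e in h1; rewrite /delta3; lra.
apply: fin.
have [h1 _] := @riesz_increment y (y + H) ltac:(lra).
have /Rabs_le_between h2 := bMP y (y + H) ltac:(lra) ltac:(lra) ltac:(lra) ltac:(lra) (or_introl erefl).
have /Rabs_le_between h3 := bI y ltac:(lra).
have /Rabs_le_between h4 := bI (y + H) ltac:(lra).
rewrite !rE in h1; have e : y + H - y = H by ring.
rewrite e in h1; rewrite /delta3; lra.
Qed.

Lemma delta3_scaled (eta : R) : 0 < eta <= 1 / 4 -> exists C, 1 <= C /\
  forall x d, 1 <= x -> 1 <= d ->
  [/\ Rabs (delta3 (x / d)) <= C * (Rpower x (7 / 12 + eta) * Rpower d (- (7 / 12))),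
      Rabs (rieszI (x / d)) <= C * (Rpower x (7 / 6 + eta) * Rpower d (- (7 / 6))),
      Rabs (main3 (x / d)) <= C * (Rpower x (1 + eta) * Rpower d (- (1 - eta))) &
      Rabs (main3' (x / d)) <= C * (Rpower x eta * Rpower d eta)].
Proof.
move=> he.
have [C1 [C10 h1]] := delta3_bound he; have [C2 [C20 h2]] := rieszI_bound (proj1 he).
have [C3 [C30 h3]] := main3_bound (proj1 he); have [C4 [C40 h4]] := main3'_bound (proj1 he).
exists (1 + 2 * C1 + 2 * C2 + 2 * C3 + 2 * C4); split; first lra.
move=> x d x1 d1.
have s1 := @scaled_power_bound delta3 C1 (7 / 12) eta C10 ltac:(lra) h1 x d x1 d1.
have s2 := @scaled_power_bound rieszI C2 (7 / 6) eta C20 ltac:(lra) h2 x d x1 d1.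
have s3 := @scaled_power_bound main3 C3 (1 - eta) (2 * eta) C30 ltac:(lra) h3 x d x1 d1.
have s4 := @scaled_power_bound main3' C4 (- eta) (2 * eta) C40 ltac:(lra) h4 x d x1 d1.
have e3 : 1 - eta + 2 * eta = 1 + eta by ring.
have e4 : - eta + 2 * eta = eta by ring.
rewrite e3 in s3; rewrite e4 Ropp_involutive in s4.
split; [apply: Rle_trans s1 _ | apply: Rle_trans s2 _ | apply: Rle_trans s3 _ | apply: Rle_trans s4 _];
  (apply: Rmult_le_compat_r; [by apply: Rmult_le_pos; exact: Rpower_ge0 | lra]).
Qed.

End Constants.

(** * Multivariable sums *)

Lemma rsum_multiples (N a : nat) (F : nat -> R) : (0 < a)%N ->
  \rsum_(n < N) (ind (a %| n.+1)%N * F (n.+1 %/ a)%N) = \rsum_(m < N %/ a) F m.+1.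
Proof.
move=> a0; elim: N => [|N IH]; first by rewrite div0n !rsum0.
rewrite (rsum_recr _ (fun n => ind (a %| n.+1)%N * F (n.+1 %/ a)%N)) IH divnS //.
case: (a %| N.+1)%N; rewrite /ind ?add0n ?add1n; last by ring.
by rewrite (rsum_recr _ (fun m => F m.+1)); ring.
Qed.

Lemma nat_floor_div (n a : nat) (x : R) : (0 < a)%N -> INR n <= x < INR n + 1 ->
  nat_floor (x / INR a) = (n %/ a)%N.
Proof.
move=> a0 hx; have ha := INR_gt0 a0; apply: nat_floor_unique.
have h1 : INR (n %/ a) * INR a <= INR n by rewrite -mult_INR; apply: leq_INR; exact: leq_trunc_div.
have h2 : INR n + 1 <= (INR (n %/ a) + 1) * INR a.
  by rewrite -!S_INR -mult_INR; apply: leq_INR; exact: ltn_ceil.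
split; first by apply: Rle_divI; lra.
by apply: (Rmult_lt_reg_r (INR a)) => //; rewrite /Rdiv Rmult_assoc Rinv_l; lra.
Qed.

(** After [gcoef_inversion] the sum over [n] factors into coordinates, and the multiples of [d_i] up
    to [x] contribute a divisor sum up to [x / d_i]. The condition on [B] puts every [n_i <= x] into
    the box. *)
Lemma multi_sumE (r B : nat) (x : R) : 1 <= x -> x < INR B + 1 ->
  INR (tau_multi_sum r 3 x) =
  \rsum_(d : {ffun 'I_r -> 'I_B}) (gcoef d * \rprod_(i < r) dsum (x / INR (d i).+1)).
Proof.
move=> x1 xB; have hN := @nat_floor_le x ltac:(lra); have hN' := nat_floor_gt x.
have N1 : (0 < nat_floor x)%N by apply/leq_nat_floor; rewrite ?INR_1; lra.
have NB : (nat_floor x <= B)%N by rewrite -ltnS; apply: INR_ltn; rewrite S_INR; lra.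
rewrite /tau_multi_sum; move: hN hN' N1 NB; case: (nat_floor x) => [//|N] hN hN' _ NB.
have -> : INR (\sum_(f : {ffun 'I_r -> 'I_N.+1}) tau 3 (\prod_(i < r) (f i).+1)) =
    \rsum_(n : {ffun 'I_r -> 'I_B}) (\rprod_(i < r) ind (n i < N.+1)%N * t3 (tprod n)).
  rewrite INR_sum.
  have -> : \rsum_(n : {ffun 'I_r -> 'I_B}) (\rprod_(i < r) ind (n i < N.+1)%N * t3 (tprod n)) =
     \big[Rplus/0]_(n : {ffun 'I_r -> 'I_B} | [forall i, (n i < N.+1)%N]) t3 (tprod n).
    rewrite [RHS]big_mkcond; apply: eq_bigr => n _; case: ifP => [/forallP h|/negbT].
      by rewrite big1 ?Rmult_1_l // => i _; rewrite h.
    rewrite negb_forall => /existsP[i hi]; rewrite (bigD1 i) //= /ind (negbTE hi).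
    by rewrite !Rmult_0_l.
  pose h (f : {ffun 'I_r -> 'I_N.+1}) : {ffun 'I_r -> 'I_B} := [ffun i => widen_ord NB (f i)].
  rewrite (reindex h) /=; last first.
    exists (fun n : {ffun 'I_r -> 'I_B} => [ffun i => inord (n i)]) => [f _|n].
      by apply/ffunP => i; rewrite !ffunE; apply: val_inj; rewrite /= inordK.
    rewrite inE => /forallP hn; apply/ffunP => i; rewrite !ffunE; apply: val_inj => /=.
    by rewrite inordK.
  apply: eq_big => [f|f _].
    by symmetry; apply/forallP => i; rewrite ffunE /=.
  by rewrite /t3 /tprod; congr (INR (tau 3 _)); apply: eq_bigr => i _; rewrite ffunE.
rewrite (eq_bigr (fun n : {ffun 'I_r -> 'I_B} => \rsum_(d : {ffun 'I_r -> 'I_B})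
   (gcoef d * \rprod_(i < r) (ind (n i < N.+1)%N * kt (n i) (d i))))); last first.
  move=> n _; rewrite gcoef_inversion big_distrr; apply: eq_bigr => d _ /=.
  by rewrite -Rmult_assoc (Rmult_comm _ (gcoef d)) Rmult_assoc -big_split.
rewrite exchange_big; apply: eq_bigr => d _; rewrite -big_distrr; congr (_ * _).
rewrite -(bigA_distr_bigA (fun i (n : 'I_B) => ind (n < N.+1)%N * kt n (d i))) /=.
apply: eq_bigr => i _; rewrite (rsum_trunc (fun n => kt n (d i)) NB) /kt.
rewrite (rsum_multiples N.+1 t3 (ltn0Sn (d i))) dsumE (nat_floor_div (n := N.+1)) //; lra.
Qed.

(** A product is expanded to first and second order in the remainders [dl]; each order replaces one
    factor [X] by [Y]. Multiplying the left sides by [X] and [X^2] keeps division out of the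
    induction. *)
Lemma rprod_add_bounds (I : eqType) (s : seq I) (m dl v : I -> R) (X Y : R) :
  uniq s -> 0 <= Y -> Y <= X -> (forall i, 0 <= v i) ->
  (forall i, Rabs (m i) <= X * v i) -> (forall i, Rabs (m i + dl i) <= X * v i) ->
  (forall i, Rabs (dl i) <= Y * v i) ->
  [/\ Rabs (\rprod_(i <- s) m i) <= X ^ size s * \rprod_(i <- s) v i,
      Rabs (\rprod_(i <- s) (m i + dl i) - \rprod_(i <- s) m i) * X <=
        INR (size s) * Y * X ^ size s * \rprod_(i <- s) v i &
      Rabs (\rprod_(i <- s) (m i + dl i) - \rprod_(i <- s) m i -
          \rsum_(i <- s) (dl i * \rprod_(j <- s | j != i) m j)) * X ^ 2 <=
        INR (size s) ^ 2 * Y ^ 2 * X ^ size s * \rprod_(i <- s) v i].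
Proof.
move=> us Y0 YX v0 hm hD hd; have X0 : 0 <= X by lra.
elim: s us => [|i s IH] us.
  rewrite !big_nil /=; split.
  - by rewrite Rabs_R1; lra.
  - by rewrite Rminus_diag Rabs_R0 /INR; lra.
  - by rewrite Rminus_diag Rminus_0_r Rabs_R0 /INR; lra.
have /andP[ins us'] : (i \notin s) && uniq s := us.
have {IH}[I1 I2 I3] := IH us'.
rewrite !big_cons eqxx /=.
have -> : \rprod_(j <- s | j != i) m j = \rprod_(j <- s) m j.
  rewrite big_mkcond; apply: eq_big_seq => j js; case: eqP => // e.
  by move: ins; rewrite -e js.
have -> : \rsum_(k <- s) (dl k * \rprod_(j <- i :: s | j != k) m j) =
    m i * \rsum_(k <- s) (dl k * \rprod_(j <- s | j != k) m j).
  rewrite big_distrr; apply: eq_big_seq => k ks /=; rewrite big_cons.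
  have -> : i != k by apply: contraNneq ins => ->.
  by ring.
move: I1 I2 I3; set PM := \rprod_(j <- s) m j; set PD := \rprod_(j <- s) (m j + dl j).
set V := \rprod_(j <- s) v j; set S := \rsum_(k <- s) _; set n := size s.
move=> I1 I2 I3.
have V0 : 0 <= V by apply: rprod_ge0.
have Xn : 0 <= X ^ n by exact: pow_le.
have n0 := pos_INR n.
have vi := v0 i; have Xv : 0 <= X * v i by exact: Rmult_le_pos.
have Yv : 0 <= Y * v i by exact: Rmult_le_pos.
have XV : 0 <= X ^ n * V by exact: Rmult_le_pos.
rewrite S_INR; split.
- rewrite Rabs_mult.
  have := Rmult_le_compat _ _ _ _ (Rabs_pos (m i)) (Rabs_pos PM) (hm i) I1; lra.
- have -> : (m i + dl i) * PD - m i * PM = (m i + dl i) * (PD - PM) + dl i * PM by ring.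
  apply: Rle_trans (Rmult_le_compat_r _ _ _ X0 (Rabs_triang _ _)) _.
  rewrite !Rabs_mult.
  have := Rmult_le_compat _ _ _ _ (Rabs_pos _) (Rmult_le_pos _ _ (Rabs_pos (PD - PM)) X0) (hD i) I2.
  have h2 := Rmult_le_compat _ _ _ _ (Rabs_pos (dl i)) (Rabs_pos PM) (hd i) I1.
  have := Rmult_le_compat_r _ _ _ X0 h2; lra.
have -> : (m i + dl i) * PD - m i * PM - (dl i * PM + m i * S) =
    m i * (PD - PM - S) + dl i * (PD - PM) by ring.
have X2 : 0 <= X ^ 2 by exact: pow2_ge_0.
apply: Rle_trans (Rmult_le_compat_r _ _ _ X2 (Rabs_triang _ _)) _.
rewrite !Rabs_mult.
have h1 := Rmult_le_compat _ _ _ _ (Rabs_pos _) (Rmult_le_pos _ _ (Rabs_pos (PD - PM - S)) X2) (hm i) I3.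
have h2 := Rmult_le_compat _ _ _ _ (Rabs_pos (dl i)) (Rmult_le_pos _ _ (Rabs_pos (PD - PM)) X0) (hd i) I2.
have h3 := Rmult_le_compat_r _ _ _ X0 h2.
have h4 : 0 <= (INR n + 1) * (Y * v i * (X * Y * (X ^ n * V))).
  by apply: Rmult_le_pos; [lra | do ?apply: Rmult_le_pos].
have h5 : 0 <= Y * v i * (X * Y * (X ^ n * V)) by do ?apply: Rmult_le_pos.
nra.
Qed.

(** [Z] bounds the derivative of each factor relative to that factor's own bound, so the product
    rule yields one term of relative size [Z] per factor. *)
Lemma is_derive_rprod (I : Type) (s : seq I) (P : pred I) (m m' : I -> R -> R) :
  (forall i t, 0 < t -> is_derive (m i) t (m' i t) /\ continuous (m' i) t) ->
  exists W' : R -> R,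
    (forall t, 0 < t -> is_derive (fun t => \rprod_(i <- s | P i) m i t) t (W' t) /\
       continuous W' t) /\
    forall t X Z v, 0 < t -> 0 <= Z -> 0 <= X -> (forall i, 0 <= v i) ->
      (forall i, Rabs (m i t) <= X * v i) -> (forall i, Rabs (m' i t) <= Z * (X * v i)) ->
      Rabs (W' t) <= INR (size s) * Z * \rprod_(i <- s | P i) (X * v i).
Proof.
move=> hm; elim: s => [|i s [W' [IH1 IH2]]].
  exists (fun=> 0); split.
    move=> t _; split; last exact: continuous_const.
    by apply: (is_derive_ext (fun=> 1)) => [u|]; [rewrite big_nil | exact: is_derive_const].
  by move=> *; rewrite big_nil Rabs_R0 /INR /=; lra.
case Pi: (P i); last first.
  exists W'; split.
    move=> t ht; have [h1 h2] := IH1 t ht; split => //.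
    by apply: is_derive_ext h1 => u; rewrite big_cons Pi.
  move=> t X Z v ht Z0 X0 v0 h1 h2; rewrite big_cons Pi.
  apply: Rle_trans (IH2 t X Z v ht Z0 X0 v0 h1 h2) _.
  have hp : 0 <= \rprod_(j <- s | P j) (X * v j) by apply: rprod_ge0 => j _; exact: Rmult_le_pos.
  apply: Rmult_le_compat_r => //; apply: Rmult_le_compat_r => //.
  by apply: leq_INR => /=.
exists (fun t => m' i t * \rprod_(j <- s | P j) m j t + m i t * W' t); split.
  move=> t ht; have [h1 h2] := IH1 t ht; have [g1 g2] := hm i t ht; split.
    apply: (is_derive_ext (fun t => m i t * \rprod_(j <- s | P j) m j t)).
      by move=> u; rewrite big_cons Pi.
    evar_last; first apply: (is_derive_mult _ _ _ _ _ g1 h1); first exact: Rmult_comm.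
    by rewrite /plus /mult /=; ring.
  apply: (@continuous_plus R_UniformSpace R_AbsRing R_NormedModule).
    apply: (@continuous_mult R_UniformSpace R_AbsRing) => //.
    by apply: ex_derive_continuous; eexists; exact: h1.
  apply: (@continuous_mult R_UniformSpace R_AbsRing) => //.
  by apply: ex_derive_continuous; eexists; exact: g1.
move=> t X Z v ht Z0 X0 v0 h1 h2; rewrite big_cons Pi /= S_INR.
have hp : 0 <= \rprod_(j <- s | P j) (X * v j) by apply: rprod_ge0 => j _; exact: Rmult_le_pos.
have hpm : Rabs (\rprod_(j <- s | P j) m j t) <= \rprod_(j <- s | P j) (X * v j).
  rewrite rprod_Rabs; apply: (proj2 (rprod_le _ _)) => j _; split => //; exact: Rabs_pos.
have hW := IH2 t X Z v ht Z0 X0 v0 h1 h2.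
apply: Rle_trans (Rabs_triang _ _) _; rewrite !Rabs_mult.
have a1 := Rmult_le_compat _ _ _ _ (Rabs_pos _) (Rabs_pos _) (h2 i) hpm.
have a2 := Rmult_le_compat _ _ _ _ (Rabs_pos _) (Rabs_pos _) (h1 i) hW.
lra.
Qed.

(* Functions that are continuous up to a redefinition at the integers. *)
Definition pwc (f : R -> R) : Prop := forall n : nat, (0 < n)%N ->
  exists h : R -> R, (forall t, 0 < t -> continuous h t) /\
    forall t, INR n < t < INR n + 1 -> f t = h t.

Lemma pwc_continuous (f : R -> R) : (forall t, 0 < t -> continuous f t) -> pwc f.
Proof. by move=> h n _; exists f. Qed.

Lemma pwc_plus (f g : R -> R) : pwc f -> pwc g -> pwc (fun t => f t + g t).
Proof.
move=> hf hg n n0; have [f' [f1 f2]] := hf n n0; have [g' [g1 g2]] := hg n n0.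
exists (fun t => f' t + g' t); split => [t ht|t ht]; last by rewrite f2 // g2.
by apply: (@continuous_plus R_UniformSpace R_AbsRing R_NormedModule); [exact: f1 | exact: g1].
Qed.

Lemma pwc_mult (f g : R -> R) : pwc f -> pwc g -> pwc (fun t => f t * g t).
Proof.
move=> hf hg n n0; have [f' [f1 f2]] := hf n n0; have [g' [g1 g2]] := hg n n0.
exists (fun t => f' t * g' t); split => [t ht|t ht]; last by rewrite f2 // g2.
by apply: (@continuous_mult R_UniformSpace R_AbsRing); [exact: f1 | exact: g1].
Qed.

Lemma pwc_const (c : R) : pwc (fun=> c).
Proof. by apply: pwc_continuous => t _; exact: continuous_const. Qed.

Lemma pwc_ext (f g : R -> R) : (forall t, f t = g t) -> pwc f -> pwc g.
Proof. by move=> e hf n n0; have [h [h1 h2]] := hf n n0; exists h; split => // t ht; rewrite -e h2. Qed.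

Lemma pwc_minus (f g : R -> R) : pwc f -> pwc g -> pwc (fun t => f t - g t).
Proof.
move=> hf hg; apply: (pwc_ext (f := fun t => f t + -1 * g t)); first by move=> t; ring.
by apply: pwc_plus => //; apply: pwc_mult => //; exact: pwc_const.
Qed.

Lemma pwc_rsum (I : Type) (s : seq I) (P : pred I) (F : I -> R -> R) :
  (forall i, pwc (F i)) -> pwc (fun t => \rsum_(i <- s | P i) F i t).
Proof.
move=> h; elim: s => [|i s IH].
  by apply: (pwc_ext (f := fun=> 0)); [move=> t; rewrite big_nil | exact: pwc_const].
case Pi: (P i).
  apply: (pwc_ext (f := fun t => F i t + \rsum_(j <- s | P j) F j t)).
    by move=> t; rewrite big_cons Pi.
  exact: pwc_plus.
by apply: (pwc_ext _ IH) => t; rewrite big_cons Pi.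
Qed.

Lemma pwc_rprod (I : Type) (s : seq I) (P : pred I) (F : I -> R -> R) :
  (forall i, pwc (F i)) -> pwc (fun t => \rprod_(i <- s | P i) F i t).
Proof.
move=> h; elim: s => [|i s IH].
  by apply: (pwc_ext (f := fun=> 1)); [move=> t; rewrite big_nil | exact: pwc_const].
case Pi: (P i).
  apply: (pwc_ext (f := fun t => F i t * \rprod_(j <- s | P j) F j t)).
    by move=> t; rewrite big_cons Pi.
  exact: pwc_mult.
by apply: (pwc_ext _ IH) => t; rewrite big_cons Pi.
Qed.

Lemma pwc_dsum (a : nat) : (0 < a)%N -> pwc (fun t => dsum (t / INR a)).
Proof.
move=> a0 n n0; exists (fun=> \rsum_(m < n %/ a) t3 m.+1); split.
  by move=> t _; exact: continuous_const.
by move=> t ht; rewrite dsumE (nat_floor_div (n := n)) //; lra.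
Qed.

Lemma pwc_multi_sum (r : nat) : pwc (fun t => INR (tau_multi_sum r 3 t)).
Proof.
move=> n n0; exists (fun=> INR (tau_multi_sum r 3 (INR n))); split.
  by move=> t _; exact: continuous_const.
move=> t ht; rewrite /tau_multi_sum (nat_floor_unique (n := n)) ?(nat_floor_unique (n := n)) //; lra.
Qed.

Lemma split_unit_intervals (Q : R -> Prop) : Q 1 ->
  (forall n t, (0 < n)%N -> INR n <= t <= INR n + 1 -> Q (INR n) -> Q t) ->
  forall T, 1 <= T -> Q T.
Proof.
move=> Q1 hQ.
have hn n : (0 < n)%N -> Q (INR n).
  elim: n => [//|[|n] IH] _; first by rewrite INR_1.
  by apply: (hQ n.+1 _ (ltn0Sn n)); [rewrite [INR n.+2]S_INR; lra | exact: IH].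
move=> T T1; have n0 : (0 < nat_floor T)%N by apply/leq_nat_floor; rewrite ?INR_1; lra.
apply: (hQ (nat_floor T)) => //; last exact: hn.
by have := @nat_floor_le T ltac:(lra); have := nat_floor_gt T; lra.
Qed.

Lemma ex_RInt_pwc (f : R -> R) (T : R) : pwc f -> 1 <= T -> ex_RInt f 1 T.
Proof.
move=> hf; move: T; apply: split_unit_intervals; first exact: ex_RInt_point.
move=> n t n0 ht IH; apply: ex_RInt_Chasles IH _.
have [h [h1 h2]] := hf n n0; have n1 := INR_ge1 n0.
apply: (ex_RInt_ext h) => [x|].
  by rewrite Rmin_left ?Rmax_right; try lra; move=> hx; rewrite h2 //; lra.
apply: ex_RInt_continuous => z; rewrite Rmin_left ?Rmax_right; try lra.
by move=> hz; apply: h1; lra.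
Qed.

(** [F] agrees with a smooth function on each closed unit interval, so no jump enters the
    telescoping sum; [f] has to match the derivative only in the interior. *)
Lemma is_RInt_pw_derive (F f : R -> R) (T : R) : 1 <= T ->
  (forall n, (0 < n)%N -> exists G G' : R -> R,
     [/\ forall t, INR n <= t <= INR n + 1 -> F t = G t,
         forall t, 0 < t -> is_derive G t (G' t) /\ continuous G' t &
         forall t, INR n < t < INR n + 1 -> f t = G' t]) ->
  is_RInt f 1 T (F T - F 1).
Proof.
move=> T1 hF; move: T T1; apply: split_unit_intervals.
  by rewrite Rminus_diag; exact: (@is_RInt_point R_NormedModule).
move=> n t n0 ht IH; have n1 := INR_ge1 n0.
have -> : F t - F 1 = plus (F (INR n) - F 1) (F t - F (INR n)) by rewrite /plus /=; ring.
apply: is_RInt_Chasles IH _.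
have [G [G' [h1 h2 h3]]] := hF n n0.
rewrite h1 // (h1 (INR n)); last lra.
apply: (is_RInt_ext G') => [x|].
  by rewrite Rmin_left ?Rmax_right; try lra; move=> hx; rewrite h3 //; lra.
apply: (is_RInt_derive G G') => x; rewrite Rmin_left ?Rmax_right; try lra; move=> hx.
  by have [] := h2 x ltac:(lra).
by have [] := h2 x ltac:(lra).
Qed.

Lemma RInt_abs_le (f : R -> R) (T K b : R) : 1 <= T -> 0 <= K -> 0 <= b -> ex_RInt f 1 T ->
  (forall x, 1 <= x <= T -> Rabs (f x) <= K * Rpower x b) ->
  Rabs (RInt f 1 T) <= K * Rpower T (1 + b).
Proof.
move=> T1 K0 b0 hf hb; have p0 := Rpower_ge0 T b.
apply: Rle_trans (abs_RInt_le_const f 1 T (K * Rpower T b) T1 hf _) _.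
  move=> x hx; apply: Rle_trans (hb x hx) _; apply: Rmult_le_compat_l => //.
  by apply: Rpower_le_base; lra.
rewrite Rpower_plus Rpower_1; last lra.
have := Rmult_le_pos _ _ K0 p0; nra.
Qed.

Lemma size_index_enum_ord (n : nat) : size (index_enum 'I_n) = n.
Proof. by rewrite -sum1_size big_const_ord iter_addn mul1n addn0. Qed.

Lemma is_RInt_rsum (I : Type) (s : seq I) (F : I -> R -> R) (v : I -> R) (a b : R) :
  (forall i, is_RInt (F i) a b (v i)) ->
  is_RInt (fun x => \rsum_(i <- s) F i x) a b (\rsum_(i <- s) v i).
Proof.
move=> h; elim: s => [|i s IH].
  rewrite big_nil; apply: (is_RInt_ext (fun=> 0)) => [x _|]; first by rewrite big_nil.
  evar_last; first exact: is_RInt_const.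
  by rewrite /scal /= /mult /=; ring.
rewrite big_cons; apply: (is_RInt_ext (fun x => F i x + \rsum_(j <- s) F j x)) => [x _|].
  by rewrite big_cons.
by apply: (@is_RInt_plus R_NormedModule); [exact: h | exact: IH].
Qed.

Lemma rprod_const_neq (r : nat) (i : 'I_r.+1) (c : R) : \rprod_(j < r.+1 | j != i) c = c ^ r.
Proof.
rewrite big_const (eq_card (B := predC1 i)) // cardC1 card_ord /=.
by elim: r {i} => //= r ->.
Qed.

(** * The remainder in [r] variables, pointwise and in mean *)

Section MultiError.
Variables (g g1 : R).
Hypothesis riesz3_asymp : riesz3_bound g g1.

Notation main3 := (main3 g g1).
Notation main3' := (main3' g g1).
Notation delta3 := (delta3 g g1).
Notation rieszI := (rieszI g g1).

Lemma is_derive_main3_div (a : nat) (t : R) : (0 < a)%N -> 0 < t ->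
  is_derive (fun t => main3 (t / INR a)) t (main3' (t / INR a) / INR a) /\
  continuous (fun t => main3' (t / INR a) / INR a) t.
Proof.
move=> a0 t0; have ha := INR_gt0 a0; have hta : 0 < t / INR a by exact: Rdiv_lt_0_compat.
split.
  evar_last; first apply: (is_derive_comp main3 (fun t => t / INR a)).
  - exact: is_derive_main3.
  - by auto_derive.
  by rewrite /scal /= /mult /=; field; lra.
apply: ex_derive_continuous; rewrite /main3' /mainQ /mainQ' /quad.
by auto_derive; repeat split; try lra; do ?apply: Rmult_lt_0_compat; try lra; apply: Rinv_0_lt_compat.
Qed.

(** On [[n, n + 1)] the integer part of [t / a] is [n %/ a]. A term that could enter at the right
    end carries the factor [t / a - m = 0] there, so the formula holds on the closed interval. *)
Lemma rieszI_piece (a n : nat) : (0 < a)%N -> (0 < n)%N -> exists G G' : R -> R,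
  [/\ forall t, INR n <= t <= INR n + 1 -> INR a * rieszI (t / INR a) = G t,
      forall t, 0 < t -> is_derive G t (G' t) /\ continuous G' t &
      forall t, INR n < t < INR n + 1 -> delta3 (t / INR a) = G' t].
Proof.
move=> a0 n0; have ha := INR_gt0 a0; have n1 := INR_ge1 n0.
pose q := (n %/ a)%N.
exists (fun t => INR a * (\rsum_(m < q) (t3 m.+1 * (t / INR a - INR m.+1)) -
  (t / INR a) ^ 2 * riesz3_poly g g1 (ln (t / INR a)))).
exists (fun t => \rsum_(m < q) t3 m.+1 - main3 (t / INR a)); split.
- move=> t ht; rewrite /rieszI; congr (_ * (_ - _)).
  pose N := (n.+1)%N.
  have a1 := INR_ge1 a0.
  have ht0 : 0 <= t / INR a by apply: Rdiv_le_0_compat; lra.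
  have htN : t / INR a <= INR N.
    by apply: Rdiv_leI => //; rewrite /N S_INR; nra.
  have qN : (q <= N)%N by rewrite /q /N; apply: leqW; exact: leq_div.
  rewrite (riesz_pos ht0 htN) -(rsum_trunc (fun m => t3 m.+1 * (t / INR a - INR m.+1)) qN).
  apply: eq_bigr => m _; case: ltnP => hm; rewrite /ind.
    rewrite pos_eq ?Rmult_1_l //.
    have : INR m.+1 <= t / INR a; last lra.
    apply: Rle_divI => //; rewrite -mult_INR.
    have hn : (m.+1 * a <= n)%N by rewrite -leq_divRL.
    exact: Rle_trans (leq_INR hn) (proj1 ht).
  rewrite pos_eq0 ?Rmult_0_l ?Rmult_0_r //.
  have : t / INR a <= INR m.+1; last lra.
  apply: Rdiv_leI => //; rewrite -mult_INR.
  have hn : (n.+1 <= m.+1 * a)%N by rewrite -ltn_divLR // ltnS.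
  by apply: Rle_trans (leq_INR hn); rewrite S_INR; lra.
- move=> t t0; have hta : 0 < t / INR a by exact: Rdiv_lt_0_compat.
  split.
    evar_last.
      apply: is_derive_scal; apply: (@is_derive_minus R_AbsRing).
        apply: (@is_derive_rsum _ _ _ _ (fun m : 'I_q => t3 m.+1 / INR a)) => m _.
        by auto_derive => //; field; lra.
      apply: (is_derive_comp (fun y => y ^ 2 * riesz3_poly g g1 (ln y)) (fun t => t / INR a)).
      - exact: is_derive_riesz_main.
      - by auto_derive.
    rewrite /minus /plus /opp /scal /= /mult /= -big_distrl /=; field; lra.
  apply: (@continuous_minus R_UniformSpace R_AbsRing R_NormedModule); first exact: continuous_const.
  apply: ex_derive_continuous; eexists; exact: (proj1 (is_derive_main3_div a0 t0)).
- move=> t ht; rewrite /delta3 dsumE (nat_floor_div (n := n)) //; lra.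
Qed.

Lemma pwc_main3 (a : nat) : (0 < a)%N -> pwc (fun t => main3 (t / INR a)).
Proof.
move=> a0; apply: pwc_continuous => t t0; apply: ex_derive_continuous; eexists.
exact: (proj1 (is_derive_main3_div a0 t0)).
Qed.

Lemma pwc_delta3 (a : nat) : (0 < a)%N -> pwc (fun t => delta3 (t / INR a)).
Proof. by move=> a0; apply: pwc_minus; [exact: pwc_dsum | exact: pwc_main3]. Qed.

Lemma pwc_rieszI (a : nat) : (0 < a)%N -> pwc (fun t => INR a * rieszI (t / INR a)).
Proof.
move=> a0 n n0; have [G [G' [h1 h2 h3]]] := rieszI_piece a0 n0; exists G; split.
  by move=> t t0; apply: ex_derive_continuous; eexists; exact: (proj1 (h2 t t0)).
by move=> t ht; apply: h1; lra.
Qed.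

(** Integration by parts: [a rieszI (t / a)] is continuous and piecewise a primitive of
    [delta3 (t / a)]. *)
Lemma RInt_delta3_mult (a : nat) (W W' : R -> R) (T : R) : (0 < a)%N -> 1 <= T ->
  (forall t, 0 < t -> is_derive W t (W' t) /\ continuous W' t) ->
  is_RInt (fun t => delta3 (t / INR a) * W t) 1 T
    (INR a * rieszI (T / INR a) * W T - INR a * rieszI (1 / INR a) * W 1 -
     RInt (fun t => INR a * rieszI (t / INR a) * W' t) 1 T).
Proof.
move=> a0 T1 hW.
pose F t := INR a * rieszI (t / INR a) * W t.
have cW t : 0 < t -> continuous W t.
  by move=> t0; apply: ex_derive_continuous; eexists; exact: (proj1 (hW t t0)).
have h1 : is_RInt (fun t => delta3 (t / INR a) * W t + INR a * rieszI (t / INR a) * W' t) 1 T (F T - F 1).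
  apply: is_RInt_pw_derive => // n n0.
  have [G [G' [g1' g2 g3]]] := rieszI_piece a0 n0.
  exists (fun t => G t * W t), (fun t => G' t * W t + G t * W' t); split.
  - by move=> t ht; rewrite /F g1'.
  - move=> t t0; have [d1 d2] := g2 t t0; have [e1 e2] := hW t t0; split.
      evar_last; first apply: (is_derive_mult _ _ _ _ _ d1 e1); first exact: Rmult_comm.
      by rewrite /plus /mult /=; ring.
    apply: (@continuous_plus R_UniformSpace R_AbsRing R_NormedModule).
      by apply: (@continuous_mult R_UniformSpace R_AbsRing) => //; exact: cW.
    apply: (@continuous_mult R_UniformSpace R_AbsRing) => //.
    by apply: ex_derive_continuous; eexists; exact: d1.
  - by move=> t ht; rewrite g3 // g1' //; lra.
have h2 : is_RInt (fun t => INR a * rieszI (t / INR a) * W' t) 1 T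
    (RInt (fun t => INR a * rieszI (t / INR a) * W' t) 1 T).
  apply: RInt_correct; apply: ex_RInt_pwc => //; apply: pwc_mult; first exact: pwc_rieszI.
  by apply: pwc_continuous => t t0; exact: (proj2 (hW t t0)).
apply: is_RInt_ext (is_RInt_minus _ _ _ _ _ _ h1 h2) => t _.
by rewrite /minus /plus /opp /=; ring.
Qed.

(** A truncated multiple series: [x^r] times a polynomial in [ln x] whose coefficients depend on
    [B]. *)
Definition multi_main (r B : nat) (x : R) : R :=
  \rsum_(d : {ffun 'I_r -> 'I_B}) (gcoef d * \rprod_(i < r) main3 (x / INR (d i).+1)).

Definition multi_err (r B : nat) (x : R) : R := INR (tau_multi_sum r 3 x) - multi_main r B x.

Lemma multi_errE (r B : nat) (x : R) : 1 <= x -> x < INR B + 1 ->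
  multi_err r B x = \rsum_(d : {ffun 'I_r -> 'I_B}) (gcoef d *
    (\rprod_(i < r) (main3 (x / INR (d i).+1) + delta3 (x / INR (d i).+1)) -
     \rprod_(i < r) main3 (x / INR (d i).+1))).
Proof.
move=> x1 xB; rewrite /multi_err /multi_main (multi_sumE r x1 xB) -rsumB.
apply: eq_bigr => d _; rewrite Rmult_minus_distr_l; congr (_ * _ - _).
by apply: eq_bigr => i _; rewrite /delta3; ring.
Qed.

Definition multi_first (r B : nat) (x : R) : R :=
  \rsum_(d : {ffun 'I_r -> 'I_B}) (gcoef d *
    \rsum_(i < r) (delta3 (x / INR (d i).+1) *
       \rprod_(j < r | j != i) main3 (x / INR (d j).+1))).

Lemma pwc_multi_err (r B : nat) : pwc (multi_err r B).
Proof.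
apply: pwc_minus; first exact: pwc_multi_sum.
apply: pwc_rsum => d; apply: pwc_mult; first exact: pwc_const.
by apply: pwc_rprod => i; exact: pwc_main3.
Qed.

Lemma pwc_multi_first (r B : nat) : pwc (multi_first r B).
Proof.
apply: pwc_rsum => d; apply: pwc_mult; first exact: pwc_const.
apply: pwc_rsum => i; apply: pwc_mult; first exact: pwc_delta3.
by apply: pwc_rprod => j; exact: pwc_main3.
Qed.

(** Every factor decays at least like [d_i^(-7/12)], and [2 * 7/12 > 1] makes the sum over [d]
    converge by [gcoef_summable] with [k = 2]. Exchanging a main term for a remainder gains
    [x^(-5/12)], and two exchanges gain [x^(-5/6)]. *)
Lemma multi_err_pointwise (r : nat) (eta : R) : 0 < eta <= 1 / 20 ->
  exists K, 0 <= K /\ forall B x, 1 <= x -> x < INR B + 1 ->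
    Rabs (multi_err r.+2 B x) <= K * Rpower x (INR r.+2 - 1 + 7 / 12 + INR r.+2 * eta) /\
    Rabs (multi_err r.+2 B x - multi_first r.+2 B x) <=
      K * Rpower x (INR r.+2 - 5 / 6 + INR r.+2 * eta).
Proof.
move=> he; have [C [C1 hC]] := @delta3_scaled g g1 riesz3_asymp eta ltac:(lra).
have [Ks [Ks0 hKs]] := @gcoef_summable r.+2 2 (fun=> 1%N) (7 / 12) isT (fun=> isT)
   (fun _ _ _ => isT) ltac:(lra) ltac:(rewrite INR_2; lra).
set R2 := INR r.+2; have hR : R2 = INR r + 2 by rewrite /R2 !S_INR; ring.
have r0 := pos_INR r.
have p2 : 0 <= (2 * C) ^ r by apply: pow_le; lra.
exists (R2 * C * ((2 * C) * (2 * C) ^ r) * Ks + R2 ^ 2 * C ^ 2 * (2 * C) ^ r * Ks); split.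
  have q1 : 0 <= R2 * C * ((2 * C) * (2 * C) ^ r) * Ks.
    by do ?apply: Rmult_le_pos => //; lra.
  have q2 : 0 <= R2 ^ 2 * C ^ 2 * (2 * C) ^ r * Ks.
    by do ?apply: Rmult_le_pos => //; lra.
  lra.
move=> B x x1 xB; rewrite multi_errE //.
pose X := 2 * C * Rpower x (1 + eta); pose Y := C * Rpower x (7 / 12 + eta).
have pX := Rpower_gt0 x (1 + eta); have pY := Rpower_gt0 x (7 / 12 + eta).
have pYX : Rpower x (7 / 12 + eta) <= Rpower x (1 + eta) by apply: Rpower_le_exp; lra.
have X0 : 0 < X by apply: Rmult_lt_0_compat; lra.
have Y0 : 0 <= Y by apply: Rmult_le_pos; lra.
have YX : Y <= X by rewrite /X /Y; nra.
pose v (d : {ffun 'I_r.+2 -> 'I_B}) (i : 'I_r.+2) := Rpower (INR (d i).+1) (- (7 / 12)).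
have v0 d i : 0 <= v d i by exact: Rpower_ge0.
have hb (d : {ffun 'I_r.+2 -> 'I_B}) := @rprod_add_bounds _ (index_enum 'I_r.+2)
  (fun i => main3 (x / INR (d i).+1)) (fun i => delta3 (x / INR (d i).+1)) (v d) X Y
  (index_enum_uniq _) Y0 YX (v0 d).
have {}hb (d : {ffun 'I_r.+2 -> 'I_B}) : [/\ Rabs (\rprod_(i < r.+2) main3 (x / INR (d i).+1)) <= X ^ r.+2 * \rprod_(i < r.+2) v d i,
      Rabs (\rprod_(i < r.+2) (main3 (x / INR (d i).+1) + delta3 (x / INR (d i).+1)) -
        \rprod_(i < r.+2) main3 (x / INR (d i).+1)) * X <=
        R2 * Y * X ^ r.+2 * \rprod_(i < r.+2) v d i &
      Rabs (\rprod_(i < r.+2) (main3 (x / INR (d i).+1) + delta3 (x / INR (d i).+1)) -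
        \rprod_(i < r.+2) main3 (x / INR (d i).+1) -
          \rsum_(i < r.+2) (delta3 (x / INR (d i).+1) * \rprod_(j < r.+2 | j != i) main3 (x / INR (d j).+1))) * X ^ 2 <=
        R2 ^ 2 * Y ^ 2 * X ^ r.+2 * \rprod_(i < r.+2) v d i].
  have [i|i|i|b1 b2 b3] := hb d.
  - have [_ _ h _] := hC x (INR (d i).+1) x1 (INRS_ge1 (d i)).
    apply: Rle_trans h _; rewrite /X /v.
    have : Rpower (INR (d i).+1) (- (1 - eta)) <= Rpower (INR (d i).+1) (- (7 / 12)).
      by apply: Rpower_le_exp; [exact: INRS_ge1 | lra].
    move=> h; have := Rmult_le_compat_l _ _ _ (Rlt_le _ _ pX) h.
    have := v0 d i; rewrite /v => v0' h2.
    have h3 : 0 <= Rpower x (1 + eta) * Rpower (INR (d i).+1) (- (7 / 12)) by apply: Rmult_le_pos; lra.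
    nra.
  - have [h1 _ h _] := hC x (INR (d i).+1) x1 (INRS_ge1 (d i)).
    apply: Rle_trans (Rabs_triang _ _) _; rewrite /X.
    have h2 : Rpower (INR (d i).+1) (- (1 - eta)) <= Rpower (INR (d i).+1) (- (7 / 12)).
      by apply: Rpower_le_exp; [exact: INRS_ge1 | lra].
    have h3 := Rmult_le_compat_l _ _ _ (Rlt_le _ _ pX) h2.
    have h4 := Rmult_le_compat_r _ _ _ (v0 d i) pYX.
    rewrite -/(v d i) in h1 h3 *.
    have h5 := Rmult_le_compat_l C _ _ ltac:(lra) h3.
    have h6 := Rmult_le_compat_l C _ _ ltac:(lra) h4.
    lra.
  - have [h1 _ _ _] := hC x (INR (d i).+1) x1 (INRS_ge1 (d i)).
    by rewrite /Y; apply: Rle_trans h1 _; rewrite -/(v d i); lra.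
  by rewrite size_index_enum_ord in b1 b2 b3; split.
have hsum : \rsum_(d : {ffun 'I_r.+2 -> 'I_B}) (Rabs (gcoef d) * \rprod_(i < r.+2) v d i) <= Ks.
  apply: Rle_trans (hKs B); apply: Req_le; apply: eq_bigr => d _; congr (_ * _).
  by apply: eq_bigr => i _; rewrite /v INR_1 Rmult_1_l.
have Xr : 0 <= X ^ r by apply: pow_le; lra.
have eX : X ^ r = (2 * C) ^ r * Rpower x (INR r * (1 + eta)).
  rewrite /X Rpow_mult_distr; congr (_ * _).
  by rewrite -Rpower_natr // Rpower_mult; congr Rpower; ring.
have s0 : 0 <= R2 * C * ((2 * C) * (2 * C) ^ r) * Ks by do ?apply: Rmult_le_pos => //; lra.
have s1 : 0 <= R2 ^ 2 * C ^ 2 * (2 * C) ^ r * Ks.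
  by do ?apply: Rmult_le_pos => //; lra.
have R20 : 0 <= R2 by lra.
split.
  apply: Rle_trans (_ : R2 * Y * (X * X ^ r) * Ks <= _).
    apply: Rle_trans (Rabs_rsum_le _ (G := fun d : {ffun 'I_r.+2 -> 'I_B} =>
      R2 * Y * (X * X ^ r) * (Rabs (gcoef d) * \rprod_(i < r.+2) v d i)) _) _.
      move=> d _; rewrite Rabs_mult; have [_ b2 _] := hb d.
      have hP : 0 <= \rprod_(i < r.+2) v d i by apply: rprod_ge0.
      have b2' : Rabs (\rprod_(i < r.+2) (main3 (x / INR (d i).+1) + delta3 (x / INR (d i).+1)) -
        \rprod_(i < r.+2) main3 (x / INR (d i).+1)) <= R2 * Y * (X * X ^ r) * \rprod_(i < r.+2) v d i.
        apply: (Rmult_le_reg_r X) => //; apply: Rle_trans b2 _; apply: Req_le; rewrite /=; ring.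
      have := Rmult_le_compat_l _ _ _ (Rabs_pos (gcoef d)) b2'; rewrite /=; lra.
    rewrite rsumZ; apply: Rmult_le_compat_l hsum.
    by do ?apply: Rmult_le_pos => //; lra.
  have -> : R2 * Y * (X * X ^ r) * Ks =
     R2 * C * ((2 * C) * (2 * C) ^ r) * Ks * Rpower x (R2 - 1 + 7 / 12 + R2 * eta).
    have -> : R2 - 1 + 7 / 12 + R2 * eta = (7 / 12 + eta) + (1 + eta) + INR r * (1 + eta) by rewrite hR; ring.
    by rewrite !Rpower_plus eX /X /Y; rewrite !Rpower_plus; ring.
  apply: Rmult_le_compat_r; [exact: Rpower_ge0 | lra].
rewrite /multi_first -rsumB.
apply: Rle_trans (_ : R2 ^ 2 * Y ^ 2 * X ^ r * Ks <= _).
  apply: Rle_trans (Rabs_rsum_le _ (G := fun d : {ffun 'I_r.+2 -> 'I_B} =>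
    R2 ^ 2 * Y ^ 2 * X ^ r * (Rabs (gcoef d) * \rprod_(i < r.+2) v d i)) _) _.
    move=> d _; rewrite -Rmult_minus_distr_l Rabs_mult; have [_ _ b3] := hb d.
    have hP : 0 <= \rprod_(i < r.+2) v d i by apply: rprod_ge0.
    set A := Rabs (_ - _) in b3 *.
    have b3' : A <= R2 ^ 2 * Y ^ 2 * X ^ r * \rprod_(i < r.+2) v d i.
      apply: (Rmult_le_reg_r (X ^ 2)); first exact: pow_lt.
      by apply: Rle_trans b3 _; apply: Req_le; rewrite /=; ring.
    have := Rmult_le_compat_l _ _ _ (Rabs_pos (gcoef d)) b3'; rewrite /=; lra.
  rewrite rsumZ; apply: Rmult_le_compat_l hsum.
  by do ?apply: Rmult_le_pos => //; lra.
have -> : R2 ^ 2 * Y ^ 2 * X ^ r * Ks =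
   R2 ^ 2 * C ^ 2 * (2 * C) ^ r * Ks * Rpower x (R2 - 5 / 6 + R2 * eta).
  have -> : R2 - 5 / 6 + R2 * eta = (7 / 12 + eta) + (7 / 12 + eta) + INR r * (1 + eta) by rewrite hR; field.
  by rewrite !Rpower_plus eX /Y; rewrite !Rpower_plus; ring.
apply: Rmult_le_compat_r; [exact: Rpower_ge0 | lra].
Qed.

(** After integration by parts variable [i] decays like [d_i^(-1/6)] and the others like
    [d_j^(-(1 - eta))]. These are weakened to the multiples 1 and 6 of 3/20, so that any two
    multiples add up to at least 7 and [7 * 3/20 > 1]. Differentiating the other factors costs
    [1/x], which the integral restores. *)
Lemma RInt_first_term (r : nat) (eta : R) : 0 < eta <= 1 / 20 ->
  exists C, 1 <= C /\ forall B (d : {ffun 'I_r.+2 -> 'I_B}) (i : 'I_r.+2) T, 1 <= T ->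
    Rabs (RInt (fun x => delta3 (x / INR (d i).+1) *
       \rprod_(j < r.+2 | j != i) main3 (x / INR (d j).+1)) 1 T) <=
    C * Rpower T (INR r.+2 + 1 / 6 + INR r.+2 * eta) *
      \rprod_(j < r.+2) Rpower (INR (d j).+1) (- (INR (if j == i then 1 else 6)%N * (3 / 20))).
Proof.
move=> he; have [C [C1 hC]] := @delta3_scaled g g1 riesz3_asymp eta ltac:(lra).
set R2 := INR r.+2; have hR : R2 = INR r + 2 by rewrite /R2 !S_INR; ring.
have r0 := pos_INR r.
have Cr : 1 <= C ^ r.+2 by exact: pow_R1_Rle.
exists ((2 + R2) * C ^ r.+2); split; first nra.
move=> B d i T T1.
pose P := fun j : 'I_r.+2 => j != i.
have [W' [hW1 hW2]] := @is_derive_rprod _ (index_enum 'I_r.+2) P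
  (fun j x => main3 (x / INR (d j).+1)) (fun j x => main3' (x / INR (d j).+1) / INR (d j).+1)
  (fun j t t0 => is_derive_main3_div (ltn0Sn (d j)) t0).
pose W t := \rprod_(j < r.+2 | P j) main3 (t / INR (d j).+1).
rewrite size_index_enum_ord -/R2 in hW2.
pose w (j : 'I_r.+2) := Rpower (INR (d j).+1) (- (1 - eta)).
have w0 j : 0 <= w j by exact: Rpower_ge0.
pose Om := Rpower (INR (d i).+1) (- (1 / 6)) * \rprod_(j < r.+2 | P j) w j.
have a1 := INRS_ge1 (d i); set a := INR (d i).+1 in a1 Om *.
have hOm : Om <= \rprod_(j < r.+2) Rpower (INR (d j).+1) (- (INR (if j == i then 1 else 6)%N * (3 / 20))).
  rewrite [X in _ <= X](bigD1 i) //= eqxx /Om; apply: Rmult_le_compat.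
  - exact: Rpower_ge0.
  - by apply: rprod_ge0 => j _.
  - by apply: Rpower_le_exp => //; rewrite INR_1; lra.
  apply: (proj2 (rprod_le _ _)) => j hj; split => //.
  apply: Rpower_le_exp; first exact: INRS_ge1.
  by rewrite (negbTE hj) !S_INR /INR; lra.
have Om0 : 0 <= Om by apply: Rmult_le_pos; [exact: Rpower_ge0 | apply: rprod_ge0].
pose X x := C * Rpower x (1 + eta).
have X0 x : 0 <= X x by apply: Rmult_le_pos; [lra | exact: Rpower_ge0].
have prodX x : \rprod_(j < r.+2 | P j) (X x * w j) = X x ^ r.+1 * \rprod_(j < r.+2 | P j) w j.
  by rewrite big_split /= rprod_const_neq.
have hm x : 1 <= x -> forall j, Rabs (main3 (x / INR (d j).+1)) <= X x * w j.
  move=> x1 j; have [_ _ h _] := hC x (INR (d j).+1) x1 (INRS_ge1 _).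
  by apply: Rle_trans h _; rewrite /X /w; lra.
have hm' x : 1 <= x -> forall j, Rabs (main3' (x / INR (d j).+1) / INR (d j).+1) <= / x * (X x * w j).
  move=> x1 j; have dj := INRS_ge1 (d j).
  have [_ _ _ h] := hC x (INR (d j).+1) x1 dj.
  rewrite /Rdiv Rabs_mult (Rabs_pos_eq (/ INR (d j).+1)); last by apply: Rlt_le; apply: Rinv_0_lt_compat; lra.
  apply: Rle_trans (Rmult_le_compat_r _ _ _ _ h) _.
    by apply: Rlt_le; apply: Rinv_0_lt_compat; lra.
  rewrite /X /w; apply: Req_le.
  have -> : - (1 - eta) = eta + - (1) by ring.
  rewrite !Rpower_plus Rpower_Ropp !Rpower_1; try lra; field; lra.
have hI x : 1 <= x -> Rabs (a * rieszI (x / a)) <= C * (Rpower x (7 / 6 + eta) * Rpower a (- (1 / 6))).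
  move=> x1; have [_ h _ _] := hC x a x1 a1.
  rewrite Rabs_mult Rabs_pos_eq; last lra.
  apply: Rle_trans (Rmult_le_compat_l _ _ _ _ h) _; first lra.
  have -> : - (7 / 6) = - (1 / 6) + - (1) by field.
  rewrite (Rpower_plus (- (1 / 6))) (Rpower_Ropp a 1) Rpower_1; last lra.
  by apply: Req_le; field; lra.
have eX x : 1 <= x -> C * (Rpower x (7 / 6 + eta) * Rpower a (- (1 / 6))) *
    (X x ^ r.+1 * \rprod_(j < r.+2 | P j) w j) = C ^ r.+2 * Om * Rpower x (R2 + 1 / 6 + R2 * eta).
  move=> x1; have -> : R2 + 1 / 6 + R2 * eta = (7 / 6 + eta) + INR r.+1 * (1 + eta).
    by rewrite hR S_INR; field.
  rewrite (Rpower_plus (7 / 6 + eta)) /X Rpow_mult_distr /Om.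
  have -> : Rpower x (1 + eta) ^ r.+1 = Rpower x (INR r.+1 * (1 + eta)).
    by rewrite -Rpower_natr ?Rpower_mult; [congr Rpower; ring | exact: Rpower_gt0].
  by rewrite /=; ring.
have hPhi x : 1 <= x -> Rabs (a * rieszI (x / a) * W x) <= C ^ r.+2 * Om * Rpower x (R2 + 1 / 6 + R2 * eta).
  move=> x1; rewrite Rabs_mult -(eX x x1) -prodX.
  apply: Rmult_le_compat; [exact: Rabs_pos | exact: Rabs_pos | exact: hI |].
  rewrite /W rprod_Rabs; apply: (proj2 (rprod_le _ _)) => j _; split; [exact: Rabs_pos | exact: hm].
have hPhi' x : 1 <= x -> Rabs (a * rieszI (x / a) * W' x) <=
    R2 * C ^ r.+2 * Om * Rpower x (R2 + 1 / 6 + R2 * eta - 1).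
  move=> x1; rewrite Rabs_mult.
  have ix : 0 <= / x by apply: Rlt_le; apply: Rinv_0_lt_compat; lra.
  have h := hW2 x (X x) (/ x) w ltac:(lra) ix (X0 x) w0 (hm x x1) (hm' x x1).
  apply: Rle_trans (Rmult_le_compat _ _ _ _ (Rabs_pos _) (Rabs_pos _) (hI x x1) h) _.
  rewrite prodX.
  have -> : Rpower x (R2 + 1 / 6 + R2 * eta - 1) = Rpower x (R2 + 1 / 6 + R2 * eta) * / x.
    by rewrite /Rminus Rpower_plus Rpower_Ropp Rpower_1; lra.
  have e := eX x x1.
  have -> : R2 * C ^ r.+2 * Om * (Rpower x (R2 + 1 / 6 + R2 * eta) * / x) =
     R2 * / x * (C ^ r.+2 * Om * Rpower x (R2 + 1 / 6 + R2 * eta)) by ring.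
  by rewrite -e; apply: Req_le; rewrite /=; ring.
have Tp := Rpower_ge0 T (R2 + 1 / 6 + R2 * eta).
have COm : 0 <= C ^ r.+2 * Om by apply: Rmult_le_pos; lra.
rewrite (is_RInt_unique _ _ _ _ (RInt_delta3_mult (ltn0Sn (d i)) T1 hW1)) -/a.
have b1 := hPhi T T1; have b2 := hPhi 1 (Rle_refl 1).
have b3 : Rabs (RInt (fun t => a * rieszI (t / a) * W' t) 1 T) <=
    R2 * C ^ r.+2 * Om * Rpower T (1 + (R2 + 1 / 6 + R2 * eta - 1)).
  apply: RInt_abs_le => //.
  - by rewrite Rmult_assoc; apply: Rmult_le_pos => //; lra.
  - nra.
  - apply: ex_RInt_pwc => //; apply: pwc_mult; first exact: pwc_rieszI.
    by apply: pwc_continuous => t t0; exact: (proj2 (hW1 t t0)).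
  - by move=> x hx; apply: hPhi'; lra.
have e1 : 1 + (R2 + 1 / 6 + R2 * eta - 1) = R2 + 1 / 6 + R2 * eta by ring.
rewrite e1 in b3; rewrite Rpower_base1 Rmult_1_r in b2.
have Tp1 : 1 <= Rpower T (R2 + 1 / 6 + R2 * eta) by apply: Rpower_ge1; nra.
have b2' := Rmult_le_compat_l _ _ _ COm Tp1.
have fin : Rabs (a * rieszI (T / a) * W T - a * rieszI (1 / a) * W 1 -
    RInt (fun t => a * rieszI (t / a) * W' t) 1 T) <=
    (2 + R2) * C ^ r.+2 * Rpower T (R2 + 1 / 6 + R2 * eta) * Om.
  apply: Rle_trans (Rabs_sub_le _ _) _.
  have := Rabs_sub_le (a * rieszI (T / a) * W T) (a * rieszI (1 / a) * W 1); lra.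
apply: Rle_trans fin _; apply: Rmult_le_compat_l => //.
by apply: Rmult_le_pos => //; apply: Rmult_le_pos; lra.
Qed.

Lemma multi_err_bounds (r : nat) (eps : R) : (2 <= r)%N -> 0 < eps <= 1 / 20 ->
  exists K, 0 <= K /\ forall B T, 1 <= T -> T < INR B + 1 ->
    Rabs (multi_err r B T) <= K * Rpower T (INR r - 1 + 7 / 12 + eps) /\
    Rabs (RInt (multi_err r B) 1 T) <= K * Rpower T (INR r + 1 / 6 + eps).
Proof.
case: r => [//|[//|r]] _ he; set R2 := INR r.+2.
have hR : R2 = INR r + 2 by rewrite /R2 !S_INR; ring.
(* The bounds lose [x^eta] for each of the [R2] variables, in total [x^eps]. *)
have r0 := pos_INR r; pose eta := eps / R2.
have eE : R2 * eta = eps by rewrite /eta; field; lra.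
have he' : 0 < eta <= 1 / 20.
  by split; [apply: Rdiv_lt_0_compat; lra | apply: Rdiv_leI; lra].
have [K1 [K10 h1]] := @multi_err_pointwise r eta he'.
have [C [C1 h2]] := @RInt_first_term r eta he'.
have hex (i : 'I_r.+2) : exists K, 0 <= K /\ forall B,
    \rsum_(d : {ffun 'I_r.+2 -> 'I_B}) (Rabs (gcoef d) *
     \rprod_(j < r.+2) Rpower (INR (d j).+1) (- (INR (if j == i then 1 else 6)%N * (3 / 20)))) <= K.
  apply: (@gcoef_summable r.+2 7 (fun j => if j == i then 1%N else 6%N) (3 / 20)) => //.
  - by move=> j; case: eqP.
  - move=> j j' hj; case: eqP => [e|_]; case: eqP => [e'|_] //.
    by move: hj; rewrite e e' eqxx.
  - lra.
  - by rewrite !S_INR /INR; lra.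
have [Ks hKs] := fin_all_exists hex.
have SK : 0 <= \rsum_(i < r.+2) Ks i by apply: rsum_ge0 => i _; have [] := hKs i.
exists (K1 + C * \rsum_(i < r.+2) Ks i); split.
  by have := Rmult_le_pos C _ ltac:(lra) SK; lra.
have CS := Rmult_le_pos C _ ltac:(lra) SK.
move=> B T T1 TB; rewrite -/R2 eE in h1 h2; split.
  have [h _] := h1 B T T1 TB; apply: Rle_trans h _.
  by apply: Rmult_le_compat_r; [exact: Rpower_ge0 | lra].
have eq1 : ex_RInt (multi_first r.+2 B) 1 T by apply: ex_RInt_pwc => //; exact: pwc_multi_first.
have eq2 : ex_RInt (fun x => multi_err r.+2 B x - multi_first r.+2 B x) 1 T.
  by apply: ex_RInt_pwc => //; apply: pwc_minus; [exact: pwc_multi_err | exact: pwc_multi_first].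
have -> : RInt (multi_err r.+2 B) 1 T = RInt (multi_first r.+2 B) 1 T +
    RInt (fun x => multi_err r.+2 B x - multi_first r.+2 B x) 1 T.
  apply: is_RInt_unique.
  apply: is_RInt_ext (is_RInt_plus _ _ _ _ _ _ (RInt_correct _ _ _ eq1) (RInt_correct _ _ _ eq2)) => x _.
  by rewrite /plus /=; ring.
apply: Rle_trans (Rabs_triang _ _) _.
have b2 : Rabs (RInt (fun x => multi_err r.+2 B x - multi_first r.+2 B x) 1 T) <=
    K1 * Rpower T (1 + (R2 - 5 / 6 + eps)).
  apply: RInt_abs_le => //; first lra.
  by move=> x hx; have [] := h1 B x ltac:(lra) ltac:(lra).
have e : 1 + (R2 - 5 / 6 + eps) = R2 + 1 / 6 + eps by field.
rewrite e in b2.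
pose F (d : {ffun 'I_r.+2 -> 'I_B}) (i : 'I_r.+2) x := delta3 (x / INR (d i).+1) *
   \rprod_(j < r.+2 | j != i) main3 (x / INR (d j).+1).
have hF d i : is_RInt (F d i) 1 T (RInt (F d i) 1 T).
  apply: RInt_correct; apply: ex_RInt_pwc => //; apply: pwc_mult; first exact: pwc_delta3.
  by apply: pwc_rprod => j; exact: pwc_main3.
have -> : RInt (multi_first r.+2 B) 1 T = \rsum_(d : {ffun 'I_r.+2 -> 'I_B}) (gcoef d *
     \rsum_(i < r.+2) RInt (F d i) 1 T).
  apply: is_RInt_unique; apply: (is_RInt_rsum (F := fun d x => gcoef d * \rsum_(i < r.+2) F d i x)) => d.
  apply: (@is_RInt_scal R_NormedModule); exact: (is_RInt_rsum (F := F d)).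
set p := Rpower T (R2 + 1 / 6 + eps) in b2 *; have p0 : 0 <= p := Rpower_ge0 _ _.
pose V (d : {ffun 'I_r.+2 -> 'I_B}) i := \rprod_(j < r.+2)
   Rpower (INR (d j).+1) (- (INR (if j == i then 1 else 6)%N * (3 / 20))).
suff b1 : Rabs (\rsum_(d : {ffun 'I_r.+2 -> 'I_B}) (gcoef d * \rsum_(i < r.+2) RInt (F d i) 1 T)) <=
    C * p * \rsum_(i < r.+2) Ks i by lra.
apply: Rle_trans (Rabs_rsum_le _ (G := fun d => \rsum_(i < r.+2) (C * p * (Rabs (gcoef d) * V d i))) _) _.
  move=> d _; rewrite Rabs_mult; apply: Rle_trans (Rmult_le_compat_l _ _ _ (Rabs_pos _) (rsum_Rabs _ _ _)) _.
  rewrite big_distrr; apply: rsum_le => i _ /=.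
  have := Rmult_le_compat_l _ _ _ (Rabs_pos (gcoef d)) (h2 B d i T T1).
  by rewrite -/p -/(V d i) -/(F d i); lra.
rewrite exchange_big -rsumZ; apply: rsum_le => i _ /=.
by rewrite rsumZ; apply: Rmult_le_compat_l; [nra | have [_] := hKs i; exact].
Qed.

End MultiError.

(** * Polynomials in the logarithm *)

(** Degree at most [D], in Horner form: closure under products, shifts and differences then follows
    by induction on [D], without handling coefficients. *)
Fixpoint poly_fun (D : nat) (f : R -> R) : Prop :=
  match D with
  | 0%N => exists a, forall y, f y = a
  | D'.+1 => exists a g, poly_fun D' g /\ forall y, f y = a + y * g y
  end.

Lemma poly_fun_ext (D : nat) (f g : R -> R) : (forall y, f y = g y) -> poly_fun D f -> poly_fun D g.
Proof.
case: D => [|D] /= h; first by move=> [a ha]; exists a => y; rewrite -h.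
by move=> [a [k [hk ha]]]; exists a, k; split => // y; rewrite -h.
Qed.

Lemma poly_fun_const (D : nat) (a : R) : poly_fun D (fun=> a).
Proof.
elim: D a => [|D IH] a /=; first by exists a.
by exists a, (fun=> 0); split => // y; ring.
Qed.

Lemma poly_fun_scal (D : nat) (c : R) (f : R -> R) : poly_fun D f -> poly_fun D (fun y => c * f y).
Proof.
elim: D f => [|D IH] f /=; first by move=> [a ha]; exists (c * a) => y; rewrite ha.
move=> [a [k [hk ha]]]; exists (c * a), (fun y => c * k y); split; first exact: IH.
by move=> y; rewrite ha; ring.
Qed.

Lemma poly_fun_add (D : nat) (f g : R -> R) :
  poly_fun D f -> poly_fun D g -> poly_fun D (fun y => f y + g y).
Proof.
elim: D f g => [|D IH] f g /=.
  by move=> [a ha] [b hb]; exists (a + b) => y; rewrite ha hb.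
move=> [a [k [hk ha]]] [b [l [hl hb]]]; exists (a + b), (fun y => k y + l y).
by split; [exact: IH | move=> y; rewrite ha hb; ring].
Qed.

Lemma poly_fun_S (D : nat) (f : R -> R) : poly_fun D f -> poly_fun D.+1 f.
Proof.
elim: D f => [|D IH] f.
  move=> [a ha]; exists a, (fun=> 0); split; first exact: poly_fun_const.
  by move=> y; rewrite ha; ring.
by move=> [a [k [hk ha]]]; exists a, k; split => //; exact: IH.
Qed.

Lemma poly_fun_mulX (D : nat) (f : R -> R) : poly_fun D f -> poly_fun D.+1 (fun y => y * f y).
Proof. by move=> h; exists 0, f; split => // y; ring. Qed.

Lemma poly_fun_le (D E : nat) (f : R -> R) : (D <= E)%N -> poly_fun D f -> poly_fun E f.
Proof.
move=> /subnKC <-; move: (E - D)%N => n; elim: n => [|n IH] h; first by rewrite addn0.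
by rewrite addnS; apply: poly_fun_S; exact: IH.
Qed.

Lemma poly_fun_mul (D E : nat) (f g : R -> R) :
  poly_fun D f -> poly_fun E g -> poly_fun (D + E) (fun y => f y * g y).
Proof.
elim: D f => [|D IH] f.
  move=> [a ha] hg; apply: (poly_fun_ext (f := fun y => a * g y)); last exact: poly_fun_scal.
  by move=> y; rewrite ha.
move=> [a [k [hk ha]]] hg; apply: (poly_fun_ext (f := fun y => a * g y + y * (k y * g y))).
  by move=> y; rewrite ha; ring.
apply: poly_fun_add; last by rewrite addSn; apply: poly_fun_mulX; exact: IH.
by apply: (poly_fun_le (D := E)); [exact: leq_addl | exact: poly_fun_scal].
Qed.

Lemma poly_fun_shift (D : nat) (c : R) (f : R -> R) : poly_fun D f -> poly_fun D (fun y => f (y + c)).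
Proof.
elim: D f => [|D IH] f; first by move=> [a ha]; exists a => y; rewrite ha.
move=> [a [k [hk ha]]].
apply: (poly_fun_ext (f := fun y => (a + c * k (y + c)) + y * k (y + c))).
  by move=> y; rewrite ha; ring.
apply: poly_fun_add; last by apply: poly_fun_mulX; exact: IH.
apply: poly_fun_add; first exact: poly_fun_const.
by apply: poly_fun_scal; apply: poly_fun_S; exact: IH.
Qed.

Lemma poly_fun_difference (D : nat) (c : R) (f : R -> R) :
  poly_fun D.+1 f -> poly_fun D (fun y => f (y + c) - f y).
Proof.
elim: D f => [|D IH] f [a [k [hk ha]]].
  by case: hk => b hb; exists (c * b) => y; rewrite !ha !hb; ring.
apply: (poly_fun_ext (f := fun y => y * (k (y + c) - k y) + c * k (y + c))).
  by move=> y; rewrite !ha; ring.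
apply: poly_fun_add; first by apply: poly_fun_mulX; exact: IH.
by apply: poly_fun_scal; exact: poly_fun_shift.
Qed.

(** The difference with step [Y] has lower degree and is at most [2 M] at the sample points. By
    induction it is at most [2 * 3^D * M] at [z], and adding [|f (z + Y)| <= M] stays below
    [3^(D+1) * M]. *)
Lemma poly_fun_extrapolate (D : nat) (f : R -> R) (z Y M : R) : poly_fun D f ->
  (forall j, (j <= D)%N -> Rabs (f (z + INR j.+1 * Y)) <= M) -> Rabs (f z) <= 3 ^ D * M.
Proof.
elim: D f M => [|D IH] f M hf h.
  by case: hf => a ha; have := h 0%N isT; rewrite !ha /=; lra.
have M0 : 0 <= M by apply: Rle_trans (Rabs_pos _) (h 0%N isT).
have hd := IH _ (2 * M) (poly_fun_difference Y hf) _.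
have {}hd : Rabs (f (z + Y) - f z) <= 3 ^ D * (2 * M).
  apply: hd => j hj; have -> : z + INR j.+1 * Y + Y = z + INR j.+2 * Y by rewrite (S_INR j.+1); ring.
  apply: Rle_trans (Rabs_sub_le _ _) _.
  have := h j (leqW hj); have := h j.+1 hj; lra.
have h1 := h 0%N isT; rewrite INR_1 Rmult_1_l in h1.
have p1 : 1 <= 3 ^ D by apply: pow_R1_Rle; lra.
have := Rabs_sub_le (f (z + Y)) (f (z + Y) - f z).
have -> : f (z + Y) - (f (z + Y) - f z) = f z by ring.
by rewrite /=; nra.
Qed.

Lemma poly_fun_eval (D : nat) (c : nat -> R) : poly_fun D (poly_eval c D).
Proof.
elim: D c => [|D IH] c; first by exists (c 0%N) => y; rewrite /poly_eval /=; ring.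
exists (c 0%N), (poly_eval (fun l => c l.+1) D); split => // y.
rewrite /poly_eval decomp_sum; last by lia.
rewrite scal_sum /= Rmult_1_r; apply: (f_equal (Rplus _)); apply: PartSum.sum_eq => i _ /=; ring.
Qed.

Lemma poly_fun_rsum (I : Type) (s : seq I) (D : nat) (F : I -> R -> R) :
  (forall i, poly_fun D (F i)) -> poly_fun D (fun y => \rsum_(i <- s) F i y).
Proof.
move=> h; elim: s => [|i s IH].
  by apply: (poly_fun_ext (f := fun=> 0)); [move=> y; rewrite big_nil | exact: poly_fun_const].
apply: (poly_fun_ext (f := fun y => F i y + \rsum_(j <- s) F j y)).
  by move=> y; rewrite big_cons.
exact: poly_fun_add.
Qed.

Lemma poly_fun_rprod (I : Type) (s : seq I) (D : nat) (F : I -> R -> R) :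
  (forall i, poly_fun D (F i)) -> poly_fun (size s * D) (fun y => \rprod_(i <- s) F i y).
Proof.
move=> h; elim: s => [|i s IH] /=.
  by exists 1 => y; rewrite big_nil.
apply: (poly_fun_ext (f := fun y => F i y * \rprod_(j <- s) F j y)).
  by move=> y; rewrite big_cons.
by rewrite mulSn; exact: poly_fun_mul.
Qed.

Lemma poly_fun_quad (a b c : R) : poly_fun 2 (quad a b c).
Proof.
exists c, (fun y => b + y * a); split; last by move=> y; rewrite /quad; ring.
by exists b, (fun=> a); split; first by exists a.
Qed.

Lemma multi_main_poly (g g1 : R) (r B : nat) : exists q, poly_fun (r * 2) q /\
  forall x, 0 < x -> multi_main g g1 r B x = x ^ r * q (ln x).
Proof.
exists (fun y => \rsum_(d : {ffun 'I_r -> 'I_B}) (gcoef d *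
  \rprod_(i < r) (/ INR (d i).+1 * mainQ g g1 (y + - ln (INR (d i).+1))))); split.
  apply: poly_fun_rsum => d; apply: poly_fun_scal; rewrite -{1}(size_index_enum_ord r).
  apply: poly_fun_rprod => i; apply: poly_fun_scal; apply: poly_fun_shift.
  exact: poly_fun_quad.
move=> x x0; rewrite /multi_main -rsumZ; apply: eq_bigr => d _.
rewrite -Rmult_assoc (Rmult_comm (x ^ r)) Rmult_assoc; congr (_ * _).
rewrite -rprod_const -big_split /=; apply: eq_bigr => i _.
have di := INRS_gt0 (d i); rewrite /main3 ln_div //; rewrite /Rminus /Rdiv; ring.
Qed.

(** * The Laurent expansion of zeta at 1 *)

Lemma expN_taylor2 (y : R) : 0 <= y -> 0 <= exp (- y) - 1 + y <= y ^ 2 / 2.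
Proof.
move=> y0; split; first by have := exp_ineq1_le (- y); lra.
have [c hc] := @MVT_is_derive (fun y => y ^ 2 / 2 - (exp (- y) - 1 + y)) (fun y => y + exp (- y) - 1)
  0 y y0 ltac:(by move=> t _; auto_derive => //; rewrite ?INR_2; field).
rewrite Ropp_0 exp_0; have := exp_ineq1_le (- c) => h.
have : 0 <= (c + exp (- c) - 1) * (y - 0) by apply: Rmult_le_pos; lra.
lra.
Qed.

(* [zeta_phi u t] is [t^(-1-u)] minus its first-order Taylor polynomial in [u], and
   [zeta_Phi u] is the primitive of [zeta_phi u] vanishing at 1. *)
Definition zeta_phi (u t : R) : R := (exp (- (u * ln t)) - 1 + u * ln t) / t.
Definition zeta_Phi (u t : R) : R := (1 - exp (- (u * ln t))) / u - ln t + u * ln t ^ 2 / 2.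

Lemma zeta_phi_bounds (u t : R) : 0 < u -> 1 <= t ->
  0 <= zeta_phi u t <= 8 * u ^ 2 /\
  Rabs ((1 - exp (- (u * ln t))) * u / t ^ 2 - (exp (- (u * ln t)) - 1 + u * ln t) / t ^ 2)
    <= 12 * u ^ 2 * Rpower t (- 1 - 1 / 2).
Proof.
move=> u0 t1; have l0 := ln_ge0 t1; rewrite /zeta_phi.
have hl : ln t <= 4 * Rpower t (1 / 4).
  by have := @ln_le_Rpower t (1 / 4) ltac:(lra) ltac:(lra); lra.
set s := Rpower t (1 / 4) in hl; have s1 : 1 <= s by apply: Rpower_ge1; lra.
have sq : s ^ 2 = Rpower t (1 / 2).
  by rewrite /s -Rpower_natr ?Rpower_mult; [congr Rpower; rewrite INR_2; field | exact: Rpower_gt0].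
have s4 : s ^ 4 = t.
  rewrite /s -Rpower_natr ?Rpower_mult; last exact: Rpower_gt0.
  by rewrite -{2}(Rpower_1 t); [congr Rpower; rewrite !S_INR INR_0; field | lra].
have y0 : 0 <= u * ln t by apply: Rmult_le_pos; lra.
have [h1 h2] := expN_taylor2 y0; have h3 := exp_ineq1_le (- (u * ln t)).
have h4 : exp (- (u * ln t)) <= 1 by rewrite -exp_0; apply: exp_le; lra.
set A := exp _ - 1 + _ in h1 h2 *; set E := exp _ in h3 h4 *.
have l2 : ln t ^ 2 <= 16 * s ^ 2 by nra.
have u2 := pow2_ge_0 u.
have A8 : A <= 8 * u ^ 2 * s ^ 2 by nra.
have s24 : s ^ 2 <= t by rewrite -s4 /=; nra.
have t2 : 0 < t ^ 2 by apply: pow_lt; lra.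
split.
  split; first by apply: Rdiv_le_0_compat; lra.
  by apply: Rdiv_leI; [lra | nra].
have -> : Rpower t (- 1 - 1 / 2) = s ^ 2 / t ^ 2.
  rewrite sq -(Rpower_natr 2) /Rdiv -?Rpower_Ropp -?Rpower_plus; last lra.
  by congr Rpower; rewrite INR_2; field.
rewrite /Rdiv -Rmult_minus_distr_r Rabs_mult (Rabs_pos_eq (/ t ^ 2)); last first.
  by apply: Rlt_le; exact: Rinv_0_lt_compat.
rewrite -[X in _ <= X]Rmult_assoc; apply: Rmult_le_compat_r.
  by apply: Rlt_le; exact: Rinv_0_lt_compat.
have B : 0 <= (1 - E) * u <= 4 * u ^ 2 * s ^ 2.
  split; first by apply: Rmult_le_pos; lra.
  have : (1 - E) * u <= (u * ln t) * u by apply: Rmult_le_compat_r; lra.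
  have : ln t <= 4 * s ^ 2 by nra.
  nra.
by apply: Rabs_le; lra.
Qed.

(** The derivative of [zeta_phi u] is [O(u^2 t^(-3/2))], so sum and integral differ by [O(u^2)]
    uniformly in [N]. Of the constant 44, the summation takes 36 and the shift of the end point by
    1/2 takes 8. *)
Lemma zeta_phi_sum (u : R) (N : nat) : 0 < u -> (0 < N)%N ->
  Rabs (\rsum_(n < N) zeta_phi u (INR n.+1) - zeta_Phi u (INR N + 1 / 2)) <= 44 * u ^ 2.
Proof.
move=> u0 N0.
have dphi t : 0 < t -> is_derive (zeta_phi u) t
    ((1 - exp (- (u * ln t))) * u / t ^ 2 - (exp (- (u * ln t)) - 1 + u * ln t) / t ^ 2).
  by move=> t0; rewrite /zeta_phi; auto_derive; [lra | field; lra].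
have dPhi t : 0 < t -> is_derive (zeta_Phi u) t (zeta_phi u t).
  by move=> t0; rewrite /zeta_Phi /zeta_phi; auto_derive; [lra | rewrite ?INR_2; field; lra].
have h1 : Rabs (\rsum_(n < N) (zeta_phi u (INR n.+1) - (zeta_Phi u (INR n.+2) - zeta_Phi u (INR n.+1))))
    <= 36 * u ^ 2.
  apply: Rle_trans (Rabs_rsum_le _ (G := fun n : 'I_N => 12 * u ^ 2 * Rpower (INR n.+1) (- 1 - 1 / 2)) _) _.
    move=> n _; have n1 := INRS_ge1 n; have n2 : INR n.+2 = INR n.+1 + 1 by rewrite (S_INR n.+1).
    have [||c hc ->] := @MVT_is_derive (zeta_Phi u) (zeta_phi u) (INR n.+1) (INR n.+2).
    - lra.
    - by move=> t ht; apply: dPhi; lra.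
    rewrite n2 in hc *; have -> : INR n.+1 + 1 - INR n.+1 = 1 by ring.
    rewrite Rmult_1_r Rabs_minus_sym.
    have M0 : 0 <= 12 * u ^ 2 * Rpower (INR n.+1) (- 1 - 1 / 2).
      by have := Rpower_ge0 (INR n.+1) (- 1 - 1 / 2); have := pow2_ge_0 u; nra.
    have := @MVT_abs_le (zeta_phi u) _ (INR n.+1) c (12 * u ^ 2 * Rpower (INR n.+1) (- 1 - 1 / 2))
      ltac:(lra) (fun t ht => dphi t ltac:(lra)).
    have bnd t : INR n.+1 <= t <= c -> Rabs ((1 - exp (- (u * ln t))) * u / t ^ 2 -
        (exp (- (u * ln t)) - 1 + u * ln t) / t ^ 2) <= 12 * u ^ 2 * Rpower (INR n.+1) (- 1 - 1 / 2).
      move=> ht; have [_ h] := @zeta_phi_bounds u t u0 ltac:(lra).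
      apply: Rle_trans h _; apply: Rmult_le_compat_l; first by have := pow2_ge_0 u; lra.
      have -> : - 1 - 1 / 2 = - (3 / 2) by field.
      by apply: Rpower_le_neg; lra.
    by move/(_ bnd) => h; nra.
  rewrite rsumZ; have u2 := pow2_ge_0 u.
  apply: Rle_trans (Rmult_le_compat_l _ _ _ _ (@sum_Rpower_le (1 / 2) N ltac:(lra))) _; first lra.
  by have -> : / (1 / 2) = 2; [field | lra].
have tel : \rsum_(n < N) (zeta_Phi u (INR n.+2) - zeta_Phi u (INR n.+1)) = zeta_Phi u (INR N.+1).
  elim: N {h1 N0} => [|N IH].
    by rewrite rsum0 /zeta_Phi INR_1 ln_1 Rmult_0_r Ropp_0 exp_0; field; lra.
  by rewrite (rsum_recr N (fun n => zeta_Phi u (INR n.+2) - zeta_Phi u (INR n.+1))) IH; ring.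
rewrite rsumB tel in h1.
have hN := pos_INR N; have [||c hc hh] := @MVT_is_derive (zeta_Phi u) (zeta_phi u) (INR N + 1 / 2) (INR N.+1).
- by rewrite S_INR; lra.
- by move=> t ht; apply: dPhi; lra.
rewrite S_INR in hh h1 hc; have N1 := INR_ge1 N0.
have [hb _] := @zeta_phi_bounds u c u0 ltac:(lra).
have e : INR N + 1 - (INR N + 1 / 2) = 1 / 2 by field.
rewrite e in hh.
have h2 : Rabs (zeta_Phi u (INR N + 1) - zeta_Phi u (INR N + 1 / 2)) <= 8 * u ^ 2.
  by rewrite hh Rabs_pos_eq; lra.
set S := \rsum_(n < N) _ in h1 *.
have -> : S - zeta_Phi u (INR N + 1 / 2) = (S - zeta_Phi u (INR N + 1)) +
  (zeta_Phi u (INR N + 1) - zeta_Phi u (INR N + 1 / 2)) by ring.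
by apply: Rle_trans (Rabs_triang _ _) _; lra.
Qed.

Lemma lim_Rpower_neg (u : R) : 0 < u -> is_lim_seq (fun N => Rpower (INR N + 1 / 2) (- u)) 0.
Proof.
move=> u0; apply: (is_lim_seq_ext (fun N => exp (- u * ln (INR N + 1 / 2)))) => //.
apply: (is_lim_comp_seq _ _ m_infty 0); first exact: is_lim_exp_m.
  by exists 0%N.
have -> : m_infty = Rbar_mult (- u) p_infty.
  by rewrite Rbar_mult_comm; symmetry; apply: is_Rbar_mult_unique; apply: is_Rbar_mult_p_infty_neg => /=; lra.
apply: is_lim_seq_scal_l; apply: (is_lim_comp_seq _ _ p_infty); first exact: is_lim_ln_p.
  by exists 0%N.
apply: (is_lim_seq_plus _ _ p_infty (1 / 2)); first exact: is_lim_seq_INR.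
  exact: is_lim_seq_const.
by [].
Qed.

(** A one-sided second-order expansion at 0. The right side suffices because the Dirichlet series
    converges for [u > 0], and a triple pole calls for exactly three coefficients. *)
Definition jet (f : R -> R) (a b c : R) : Prop := exists K d, 0 <= K /\ 0 < d <= 1 /\
  forall u, 0 < u < d -> Rabs (f u - (a + b * u + c * u ^ 2)) <= K * u ^ 3.

Lemma jet_mul (f h : R -> R) (a b c a' b' c' : R) : jet f a b c -> jet h a' b' c' ->
  jet (fun u => f u * h u) (a * a') (a * b' + b * a') (a * c' + b * b' + c * a').
Proof.
move=> [K [d [K0 [hd hf]]]] [K' [d' [K0' [hd' hh]]]].
set M := Rabs a + Rabs b + Rabs c; set M' := Rabs a' + Rabs b' + Rabs c'.
have M0 : 0 <= M by rewrite /M; have := Rabs_pos a; have := Rabs_pos b; have := Rabs_pos c; lra.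
have M0' : 0 <= M' by rewrite /M'; have := Rabs_pos a'; have := Rabs_pos b'; have := Rabs_pos c'; lra.
exists (K * (M' + K') + M * K' + 2 * M * M'), (Rmin d d').
split; first by have := Rmult_le_pos _ _ K0 M0'; have := Rmult_le_pos _ _ K0 K0';
  have := Rmult_le_pos _ _ M0 K0'; have := Rmult_le_pos _ _ M0 M0'; lra.
split; first by split; [apply: Rmin_glb_lt; lra | have := Rmin_l d d'; lra].
move=> u hu; have ml := Rmin_l d d'; have mr := Rmin_r d d'.
have {}hf := hf u ltac:(lra); have {}hh := hh u ltac:(lra).
have bnd x y z : Rabs (x + y * u + z * u ^ 2) <= Rabs x + Rabs y + Rabs z.
  apply: Rle_trans (Rabs_triang _ _) _; have := Rabs_triang x (y * u).
  rewrite (Rabs_mult y u) (Rabs_mult z (u ^ 2)) (Rabs_pos_eq u) ?(Rabs_pos_eq (u ^ 2)); try nra.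
  have := Rabs_pos y; have := Rabs_pos z.
  have : 0 <= u ^ 2 <= 1 by nra.
  move=> ? ? ?; nra.
have bp := bnd a b c; have bq := bnd a' b' c'; rewrite -/M in bp; rewrite -/M' in bq.
set p := a + b * u + c * u ^ 2 in hf bp; set q := a' + b' * u + c' * u ^ 2 in hh bq.
set e := f u - p in hf; set e' := h u - q in hh.
have -> : f u * h u - (a * a' + (a * b' + b * a') * u + (a * c' + b * b' + c * a') * u ^ 2) =
  e * (q + e') + p * e' + u ^ 3 * (b * c' + c * b' + c * c' * u).
  by rewrite /e /e' /p /q; ring.
have u3 : 0 <= u ^ 3 <= 1.
  by split; [apply: pow_le; lra | rewrite -(pow1 3); apply: pow_incr; lra].
have b3 : Rabs (b * c' + c * b' + c * c' * u) <= 2 * M * M'.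
  apply: Rle_trans (Rabs_triang _ _) _.
  have := Rabs_triang (b * c') (c * b'); rewrite !Rabs_mult (Rabs_pos_eq u); last lra.
  rewrite /M /M'; move: (Rabs_pos a) (Rabs_pos b) (Rabs_pos c) (Rabs_pos a') (Rabs_pos b') (Rabs_pos c').
  move: (Rabs a) (Rabs b) (Rabs c) (Rabs a') (Rabs b') (Rabs c') => A B D A' B' D' *.
  have : 0 <= D * D' by nra.
  have : 0 <= B * D' by nra.
  have : 0 <= D * B' by nra.
  have : 0 <= A * A' by nra.
  have : 0 <= A * B' by nra.
  have : 0 <= A * D' by nra.
  have : 0 <= B * A' by nra.
  have : 0 <= B * B' by nra.
  have : 0 <= D * A' by nra.
  nra.
have b1 : Rabs (e * (q + e')) <= K * u ^ 3 * (M' + K').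
  rewrite Rabs_mult; apply: Rmult_le_compat; [exact: Rabs_pos | exact: Rabs_pos | exact: hf |].
  by apply: Rle_trans (Rabs_triang _ _) _; nra.
have b2 : Rabs (p * e') <= M * (K' * u ^ 3).
  by rewrite Rabs_mult; apply: Rmult_le_compat; try exact: Rabs_pos.
have b4 : Rabs (u ^ 3 * (b * c' + c * b' + c * c' * u)) <= u ^ 3 * (2 * M * M').
  by rewrite Rabs_mult Rabs_pos_eq; [apply: Rmult_le_compat_l; lra | lra].
have := Rabs_triang (e * (q + e') + p * e') (u ^ 3 * (b * c' + c * b' + c * c' * u)).
have := Rabs_triang (e * (q + e')) (p * e'); lra.
Qed.

Lemma jet_exp (L : R) : jet (fun u => exp (u * L)) 1 L (L ^ 2 / 2).
Proof.
exists (3 * Rabs L ^ 3), (/ (1 + Rabs L)); have L0 := Rabs_pos L.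
split; first by have := pow_le _ 3 L0; lra.
have i0 : 0 < / (1 + Rabs L) by apply: Rinv_0_lt_compat; lra.
have i1 : (1 + Rabs L) * / (1 + Rabs L) = 1 by apply: Rinv_r; lra.
split; first by nra.
move=> u hu; set y := u * L.
have hy : Rabs y <= 1 by rewrite /y Rabs_mult Rabs_pos_eq; nra.
have := @third_order_bound (fun t => exp t - 1 - t - t ^ 2 / 2) (fun t => exp t - 1 - t)
  (fun t => exp t - 1) (- 1) 1 3 ltac:(lra).
have e1 : exp 1 <= 3 := exp_le_3.
move=> /(_ _ _ _ _ y); have -> : Rabs y ^ 3 = Rabs L ^ 3 * u ^ 3.
  by rewrite /y Rabs_mult (Rabs_pos_eq u); [ring | lra].
have -> : exp y - 1 - y - y ^ 2 / 2 = exp y - (1 + L * u + L ^ 2 / 2 * u ^ 2) by rewrite /y; field.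
rewrite Rmult_assoc; apply.
- by move=> t _; split; auto_derive => //; rewrite ?INR_2; field.
- by rewrite exp_0; field.
- by rewrite exp_0; field.
- have de s : is_derive exp s (exp s) by auto_derive => //; ring.
  have be s : s <= 1 -> Rabs (exp s) <= 3.
    move=> hs; rewrite Rabs_pos_eq; first by apply: Rle_trans (exp_le hs) e1.
    by apply: Rlt_le; exact: exp_pos.
  move=> t ht; have [t0|t0] := Rle_or_lt 0 t.
    have := @MVT_abs_le exp exp 0 t 3 t0 (fun s _ => de s) (fun s hs => be s ltac:(lra)).
    by rewrite exp_0 (Rabs_pos_eq t) // Rminus_0_r.
  have := @MVT_abs_le exp exp t 0 3 ltac:(lra) (fun s _ => de s) (fun s hs => be s ltac:(lra)).
  by rewrite exp_0 Rabs_minus_sym (Rabs_left t) // /Rminus Rplus_0_l.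
by move/Rabs_le_between: hy.
Qed.

Lemma jet_inv1 : jet (fun u => / (1 + u)) 1 (- 1) 1.
Proof.
exists 1, 1; split; [lra | split; [lra|]] => u hu.
have -> : / (1 + u) - (1 + - 1 * u + 1 * u ^ 2) = - (u ^ 3 * / (1 + u)) by field; lra.
rewrite Rabs_Ropp.
have u3 : 0 <= u ^ 3 by apply: pow_le; lra.
have i0 : 0 < / (1 + u) by apply: Rinv_0_lt_compat; lra.
have i1 : / (1 + u) <= 1 by rewrite -[X in _ <= X]Rinv_1; apply: Rinv_le_contravar; lra.
by rewrite Rabs_pos_eq; nra.
Qed.

(** * Reading a residue off a one-sided real expansion *)

Lemma poly_eval_recl (b : nat -> R) (D : nat) (u : R) :
  poly_eval b D.+1 u = b 0%N + u * poly_eval (fun k => b k.+1) D u.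
Proof.
rewrite /poly_eval decomp_sum; last by lia.
by rewrite scal_sum /= Rmult_1_r; apply: (f_equal (Rplus _)); apply: PartSum.sum_eq => i _ /=; ring.
Qed.

(** If the constant coefficient were nonzero it would dominate as [u] tends to 0; once it is zero,
    dividing by [u] lowers the degree. Hence all coefficients vanish, and the top one is the one
    recorded. *)
Lemma poly_eval_small (b : nat -> R) (D : nat) (K d : R) : 0 < d ->
  (forall u, 0 < u < d -> Rabs (poly_eval b D u) <= K * u ^ D.+1) -> b D = 0.
Proof.
elim: D b K d => [|D IH] b K d d0 h.
  have [//|ne] := Req_dec (b 0%N) 0; exfalso.
  have hb : 0 < Rabs (b 0%N) by exact: Rabs_pos_lt.
  have hk : 0 < Rabs K + 1 by have := Rabs_pos K; lra.
  pose u := Rmin (d / 2) (Rabs (b 0%N) / (2 * (Rabs K + 1))).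
  have q0 : 0 < Rabs (b 0%N) / (2 * (Rabs K + 1)) by apply: Rdiv_lt_0_compat; lra.
  have u0 : 0 < u by apply: Rmin_glb_lt; lra.
  have ud : u < d by have := Rmin_l (d / 2) (Rabs (b 0%N) / (2 * (Rabs K + 1))); rewrite -/u; lra.
  have ub : u <= Rabs (b 0%N) / (2 * (Rabs K + 1)) by exact: Rmin_r.
  have e : Rabs (b 0%N) = Rabs (b 0%N) / (2 * (Rabs K + 1)) * (2 * (Rabs K + 1)) by field; lra.
  have := h u (conj u0 ud); rewrite /poly_eval /= !Rmult_1_r.
  have := Rle_abs K; nra.
have [b0|ne] := Req_dec (b 0%N) 0.
  apply: (IH (fun k => b k.+1) K d d0) => u hu.
  have := h u hu; rewrite poly_eval_recl b0 Rplus_0_l Rabs_mult Rabs_pos_eq; last lra.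
  by move=> h'; apply: (Rmult_le_reg_l u); [lra | move: h'; rewrite /=; lra].
exfalso; have hb : 0 < Rabs (b 0%N) by exact: Rabs_pos_lt.
have [A hA] : exists A, forall u, 0 < u < 1 -> Rabs (poly_eval (fun k => b k.+1) D u) <= A.
  elim: D (fun k => b k.+1) {IH h} => [|D IH] c.
    by exists (Rabs (c 0%N)) => u _; rewrite /poly_eval /= Rmult_1_r; lra.
  have [A hA] := IH (fun k => c k.+1); exists (Rabs (c 0%N) + A) => u hu.
  rewrite poly_eval_recl; apply: Rle_trans (Rabs_triang _ _) _.
  rewrite Rabs_mult (Rabs_pos_eq u); last lra.
  have := hA u hu; have := Rabs_pos (poly_eval (fun k => c k.+1) D u); nra.
have A0 : 0 <= A by apply: Rle_trans (Rabs_pos _) (hA (1 / 2) ltac:(lra)).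
have hk : 0 < Rabs K + A + 1 by have := Rabs_pos K; lra.
set q := Rabs (b 0%N) / (2 * (Rabs K + A + 1)).
have q0 : 0 < q by apply: Rdiv_lt_0_compat; lra.
pose u := Rmin (Rmin (d / 2) (1 / 2)) q.
have u0 : 0 < u by apply: Rmin_glb_lt => //; apply: Rmin_glb_lt; lra.
have ul := Rmin_l (Rmin (d / 2) (1 / 2)) q; have ur := Rmin_r (Rmin (d / 2) (1 / 2)) q.
have m1 := Rmin_l (d / 2) (1 / 2); have m2 := Rmin_r (d / 2) (1 / 2).
rewrite -/u in ul ur.
have e : Rabs (b 0%N) = q * (2 * (Rabs K + A + 1)) by rewrite /q; field; lra.
have h1 := h u ltac:(lra); have h2 := hA u ltac:(lra).
rewrite poly_eval_recl in h1; set w := poly_eval _ D u in h1 h2.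
have h3 : Rabs (b 0%N) <= Rabs (b 0%N + u * w) + Rabs (u * w).
  by have := Rabs_sub_le (b 0%N + u * w) (u * w); rewrite (_ : b 0%N + u * w - u * w = b 0%N); [lra | ring].
rewrite (Rabs_mult u) (Rabs_pos_eq u) in h3; last lra.
have p1 : 0 <= u ^ D.+1 <= 1.
  by split; [apply: pow_le; lra | rewrite -(pow1 D.+1); apply: pow_incr; lra].
have h4 : K * u ^ D.+2 <= Rabs K * u.
  have -> : K * u ^ D.+2 = K * u ^ D.+1 * u by rewrite /=; ring.
  apply: Rmult_le_compat_r; first lra.
  by have := Rle_abs K; have := Rabs_pos K; nra.
have := Rabs_pos K; nra.
Qed.

Lemma poly_eval_single (D j : nat) (h u : R) : (j <= D)%N ->
  poly_eval (fun k => if k == j then h else 0) D u = h * u ^ j.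
Proof.
have z n : poly_eval (fun=> 0) n u = 0.
  by elim: n => [|n IH]; rewrite ?poly_eval_recl ?IH /poly_eval /=; ring.
elim: D j => [|D IH] [|j] hj //; rewrite ?poly_eval_recl.

- by rewrite /= (z D); ring.
- by rewrite (IH j hj) /=; ring.
Qed.

Lemma PSeries_bounded_near_0 (a : nat -> R) (w : R) : 0 < w -> ex_pseries a w ->
  exists K d, 0 < d /\ forall u, 0 < u < d -> Rabs (PSeries a u) <= K.
Proof.
move=> w0 hw.
have hr : Rbar_lt (Rabs 0) (CV_radius a).
  rewrite Rabs_R0; apply: (Rbar_lt_le_trans _ w) => //; apply: Rbar_not_lt_le => hlt.
  have {hlt} : Rbar_lt (CV_radius a) (Rabs w) by rewrite Rabs_pos_eq //; lra.
  move/CV_disk_outside; apply; apply: ex_series_lim_0.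
  by case: hw => l /is_pseries_R hl; exists l.
have hc := PSeries_continuity a 0 hr.
have [d [d0 hd]] := hc 1 Rlt_0_1.
exists (Rabs (PSeries a 0) + 1), d; split => // u hu.
have := hd u; rewrite /R_dist /= /R_dist => h.
have {}h : Rabs (PSeries a u - PSeries a 0) < 1.
  apply: h; split; first by split => //; lra.
  by rewrite Rminus_0_r Rabs_pos_eq; lra.
have -> : PSeries a u = PSeries a 0 + (PSeries a u - PSeries a 0) by ring.
by apply: Rle_trans (Rabs_triang _ _) _; lra.
Qed.

(** After the truncation [u^(m+1)] factors out of the tail, and the remaining power series is
    continuous at 0, hence bounded nearby. *)
Lemma pseries_remainder (a : nat -> R) (F : R -> R) (d : R) (m : nat) : 0 < d ->
  (forall u, 0 < u < d -> is_pseries a u (F u)) ->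
  exists K d', 0 < d' /\ forall u, 0 < u < d' -> Rabs (F u - poly_eval a m u) <= K * u ^ m.+1.
Proof.
move=> d0 h.
have hw : ex_pseries (PS_decr_n a m.+1) (d / 2).
  apply: ex_pseries_decr_n; last by eexists; apply: h; lra.
  by right; exists (/ (d / 2)); rewrite /mult /Hierarchy.one /=; field; lra.
have [K [d' [d0' hK]]] := @PSeries_bounded_near_0 _ (d / 2) ltac:(lra) hw.
exists K, (Rmin d d'); split; first exact: Rmin_glb_lt.
move=> u hu; have ml := Rmin_l d d'; have mr := Rmin_r d d'.
have hF := h u ltac:(lra).
rewrite -(is_pseries_unique _ _ _ hF) (PSeries_decr_n _ m); last by eexists; exact: hF.
rewrite /poly_eval /Rminus Rplus_comm -Rplus_assoc Rplus_opp_l Rplus_0_l Rabs_mult Rmult_comm.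
rewrite (Rabs_pos_eq (u ^ _)); last by apply: pow_le; lra.
by apply: Rmult_le_compat_r; [apply: pow_le; lra | apply: hK; lra].
Qed.

Lemma is_series_fst (a : nat -> C) (l : C) :
  @is_series C_AbsRing C_NormedModule a l -> is_series (fun n => Re (a n)) (Re l).
Proof.
move=> h; have e n : Re (@sum_n C_NormedModule a n) = sum_n (fun n => Re (a n)) n.
  by elim: n => [|n IH]; rewrite ?sum_O // !sum_Sn -IH.
apply: (filterlim_ext (fun n => Re (@sum_n C_NormedModule a n))) => //.
by apply: filterlim_comp h _ => P [d hd]; exists d => z [hz _]; exact: hd.
Qed.

Lemma is_series_snd (a : nat -> C) (l : C) :
  @is_series C_AbsRing C_NormedModule a l -> is_series (fun n => Im (a n)) (Im l).
Proof.
move=> h; have e n : Im (@sum_n C_NormedModule a n) = sum_n (fun n => Im (a n)) n.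
  by elim: n => [|n IH]; rewrite ?sum_O // !sum_Sn -IH.
apply: (filterlim_ext (fun n => Im (@sum_n C_NormedModule a n))) => //.
by apply: filterlim_comp h _ => P [d hd]; exists d => z [_ hz]; exact: hd.
Qed.

Lemma rpowC_real (x s : R) : rpowC x (RtoC s) = RtoC (Rpower x s).
Proof.
rewrite /rpowC -RtoC_mult /Cexp /Rpower /RtoC /=.
by rewrite cos_0 sin_0 Rmult_1_r Rmult_0_r.
Qed.

Lemma pow_n_real (u : R) (n : nat) : @pow_n C_Ring (RtoC u) n = RtoC (u ^ n).
Proof. by elim: n => //= n ->; rewrite RtoC_mult. Qed.

Lemma zeta_real (zeta : C -> C) (u : R) : is_riemann_zeta zeta -> 0 < u ->
  zeta (RtoC (1 + u)) = RtoC (Re (zeta (RtoC (1 + u)))) /\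
  is_series (fun n => Rpower (INR n.+1) (- (1 + u))) (Re (zeta (RtoC (1 + u)))).
Proof.
move=> [_ hz] u0; have {}hz := hz (RtoC (1 + u)) ltac:(rewrite /=; lra).
have e n : rpowC (INR n.+1) (- RtoC (1 + u))%C = RtoC (Rpower (INR n.+1) (- (1 + u))).
  by rewrite -RtoC_opp rpowC_real.
have h1 : is_series (fun n => Rpower (INR n.+1) (- (1 + u))) (Re (zeta (RtoC (1 + u)))).
  by apply: is_series_ext (is_series_fst hz) => n; rewrite e.
have h2 : is_series (fun n : nat => 0) (Im (zeta (RtoC (1 + u)))).
  by apply: is_series_ext (is_series_snd hz) => n; rewrite e.
split => //; rewrite {1}(surjective_pairing (zeta _)) /RtoC; congr pair.
rewrite -/(Im (zeta (1 + u, 0))) -/(RtoC (1 + u)) -(is_series_unique _ _ h2).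
by apply: is_series_unique; apply: (filterlim_ext (fun=> 0)) => [n|];
  [elim: n => [|n IH]; rewrite ?sum_O // sum_Sn -IH /plus /= Rplus_0_l | exact: filterlim_const].
Qed.

Section ZetaLink.
Variables (g g1 CH CK : R).
Hypotheses (CH0 : 0 <= CH) (CK0 : 0 <= CK).
Hypothesis hH : harmonic_bound g CH.
Hypothesis hK : log_harmonic_bound g1 CK.

(** Each term is split as [n^(-1-u) = 1/n - u ln n / n + zeta_phi u n]. In the partial sums the
    powers of [ln v] from the harmonic expansions cancel those of [zeta_Phi]; what still depends on
    [N] is a multiple of [v^(-u)] and tends to 0. *)
Lemma zeta_near_1 (u Z : R) : 0 < u <= 1 ->
  is_series (fun n => Rpower (INR n.+1) (- (1 + u))) Z ->
  Rabs (Z - (/ u + g - g1 * u)) <= 44 * u ^ 2.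
Proof.
move=> hu hZ; pose A := 2 + CH + CK + / u.
have hN N : Rabs (sum_n (fun n => Rpower (INR n.+1) (- (1 + u))) N - (/ u + g - g1 * u)) <=
    44 * u ^ 2 + A * Rpower (INR N.+1 + 1 / 2) (- u).
  have n1 := INRS_ge1 N; set v := INR N.+1 + 1 / 2.
  have v1 : 1 <= v by rewrite /v; lra.
  have -> : sum_n (fun n => Rpower (INR n.+1) (- (1 + u))) N =
      \rsum_(n < N.+1) / INR n.+1 - u * \rsum_(n < N.+1) (ln (INR n.+1) / INR n.+1) +
      \rsum_(n < N.+1) zeta_phi u (INR n.+1).
    rewrite -rsumZ -rsumB -big_split /=.
    transitivity (\rsum_(n < N.+1) Rpower (INR n.+1) (- (1 + u))).
      elim: N {n1 v v1} => [|N IH]; first by rewrite sum_O big_ord_recl big_ord0 Rplus_0_r.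
      by rewrite sum_Sn IH (rsum_recr N.+1 (fun n => Rpower (INR n.+1) (- (1 + u)))).
    apply: eq_bigr => n _; have hn := INRS_gt0 n.
    rewrite /zeta_phi Ropp_plus_distr Rpower_plus Rpower_Ropp Rpower_1 // /Rpower.
    by rewrite (_ : - u * ln (INR n.+1) = - (u * ln (INR n.+1))); [field; lra | ring].
  have h1 := @zeta_phi_sum u N.+1 ltac:(lra) isT.
  have h2 := hH (ltn0Sn N); have h3 := hK (ltn0Sn N).
  rewrite -/v in h1 h2 h3.
  have p52 : Rpower v (- (5 / 2)) <= Rpower v (- u) by apply: Rpower_le_exp; lra.
  have iv : / v <= Rpower v (- u).
    by rewrite -{1}(Rpower_1 v) -?Rpower_Ropp; [apply: Rpower_le_exp; lra | lra].
  have iv2 : 0 <= / (24 * v ^ 2) <= / v.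
    split; first by apply: Rlt_le; apply: Rinv_0_lt_compat; nra.
    by apply: Rinv_le_contravar; nra.
  have iv3 : Rabs ((ln v - 1) / (24 * v ^ 2)) <= / v.
    rewrite /Rdiv Rabs_mult (Rabs_pos_eq (/ _)); last lra.
    have -> : / v = v * (/ v ^ 2) by field; lra.
    have i2 : 0 < / v ^ 2 by apply: Rinv_0_lt_compat; nra.
    have -> : / (24 * v ^ 2) = / 24 * / v ^ 2 by field; nra.
    rewrite -Rmult_assoc; apply: Rmult_le_compat_r; first lra.
    have := @ln_le_sub1 v ltac:(lra); have := ln_ge0 v1 => ? ?.
    have : Rabs (ln v - 1) <= v by apply: Rabs_le; lra.
    lra.
  have P0 := Rpower_ge0 v (- u).
  have ePhi : zeta_Phi u v = / u - Rpower v (- u) / u - ln v + u * ln v ^ 2 / 2.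
    by rewrite /zeta_Phi /Rpower (_ : - (u * ln v) = - u * ln v); [field; lra | ring].
  rewrite ePhi in h1.
  set S1 := \rsum_(n < N.+1) zeta_phi _ _ in h1 *; set S2 := \rsum_(n < N.+1) / _ in h2 *.
  set S3 := \rsum_(n < N.+1) (_ / _) in h3 *.
  have iu : 0 < / u by apply: Rinv_0_lt_compat; lra.
  set P := Rpower v (- u) in p52 iv P0 h1 *; set Q := Rpower v _ in h2 h3 p52.
  set w1 := / (24 * v ^ 2) in h2 iv2; set w2 := (ln v - 1) / _ in h3 iv3.
  set e1 := S1 - _ in h1; set e2 := S2 - _ in h2; set e3 := S3 - _ in h3.
  have -> : S2 - u * S3 + S1 - (/ u + g - g1 * u) = e1 + e2 + w1 - P / u - u * (e3 + w2).
    by rewrite /e1 /e2 /e3; field; lra.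
  have b2 : CH * Q <= CH * P by apply: Rmult_le_compat_l.
  have b3 : CK * Q <= CK * P by apply: Rmult_le_compat_l.
  have b4 : Rabs (u * (e3 + w2)) <= CK * P + P.
    rewrite Rabs_mult (Rabs_pos_eq u); last lra.
    have b : Rabs (e3 + w2) <= CK * P + P by apply: Rle_trans (Rabs_triang _ _) _; lra.
    have := Rabs_pos (e3 + w2); nra.
  move: h1 h2 b4 => /Rabs_le_between h1 /Rabs_le_between h2 /Rabs_le_between b4.
  have PU : 0 <= P / u by apply: Rmult_le_pos; lra.
  by rewrite /A Rmult_plus_distr_r -/(Rdiv P u) (Rmult_comm (/ u)); apply: Rabs_le; lra.
have l1 : is_lim_seq (fun N => Rabs (sum_n (fun n => Rpower (INR n.+1) (- (1 + u))) N - (/ u + g - g1 * u)))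
    (Rabs (Z - (/ u + g - g1 * u))).
  apply: (is_lim_seq_abs _ (Rbar.Finite (Z - (/ u + g - g1 * u)))).
  by apply: is_lim_seq_minus'; [exact: hZ | exact: is_lim_seq_const].
have l2 : is_lim_seq (fun N => 44 * u ^ 2 + A * Rpower (INR N.+1 + 1 / 2) (- u)) (44 * u ^ 2 + A * 0).
  apply: is_lim_seq_plus'; first exact: is_lim_seq_const.
  apply: is_lim_seq_mult'; first exact: is_lim_seq_const.
  apply: (is_lim_seq_incr_1 (fun N => Rpower (INR N + 1 / 2) (- u)) 0).1.
  by apply: lim_Rpower_neg; lra.
by have := is_lim_seq_le _ _ _ _ hN l1 l2 => /=; lra.
Qed.

(** For [x = exp L] the residue is a Laurent coefficient [c m] with an unspecified order [m].
    Restricted to real [u > 0], that Laurent series must agree with the expansion of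
    [zeta(1 + u)^3 x^(1+u) / (1 + u)] computed by jets, whose coefficient of [1/u] is
    [x * mainQ L]. *)
Lemma residue_poly_mainQ (zeta : C -> C) (p : nat -> R) (L : R) :
  is_riemann_zeta zeta -> is_residue_poly zeta 3 p -> poly_eval p 2 L = mainQ g g1 L.
Proof.
move=> hz hp; set x := exp L; have x0 : 0 < x := exp_pos L.
have [m [c [d [d0 [hs hc]]]]] := hp x x0; rewrite /x ln_exp -/x /= in hc.
pose Z u := Re (zeta (RtoC (1 + u))).
pose a k := Re (c k).
pose F u := u ^ m.+1 * (Z u ^ 3 * Rpower x (1 + u) / (1 + u)).
have hF u : 0 < u < d -> is_pseries a u (F u).
  move=> hu; apply/is_pseries_R.
  have e : (RtoC (1 + u) - RtoC 1)%C = RtoC u by rewrite -RtoC_minus; congr RtoC; ring.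
  have := hs (RtoC (1 + u)); rewrite e; move=> /(_ _ _)/is_series_fst.
  have ez := (zeta_real hz (proj1 hu)).1; rewrite ez rpowC_real -/(Z u) -!RtoC_pow -?RtoC_mult -?RtoC_div -?RtoC_mult; last lra.
  move=> h; apply: (is_series_ext (fun k => Re (scal (@pow_n C_Ring (RtoC u) k) (c k)))).
    move=> n; rewrite pow_n_real; transitivity (Re (RtoC (u ^ n) * c n)%C) => //.
    by rewrite re_scal_l Rmult_comm.
  apply: h; last by rewrite Cmod_R Rabs_pos_eq; lra.
  by case=> h; lra.
have jZ : jet (fun u => u * Z u) 1 g (- g1).
  exists 44, 1; split; [lra | split; [lra|]] => u hu.
  have := zeta_near_1 (u := u) (Z := Z u) ltac:(lra) (zeta_real hz (proj1 hu)).2.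
  move=> h; have -> : u * Z u - (1 + g * u + - g1 * u ^ 2) = u * (Z u - (/ u + g - g1 * u)) by field; lra.
  by rewrite Rabs_mult Rabs_pos_eq /=; nra.
have jH := jet_mul (jet_mul (jet_mul (jet_mul jZ jZ) jZ) (jet_exp L)) jet_inv1.
set h0 := _ * 1 in jH; set h1 := 1 * _ * _ * _ * _ + _ in jH.
set h2 := _ + _ + _ in jH.
have h2E : h2 = mainQ g g1 L by rewrite /h2 /h0 /mainQ /quad; field.
have [K [d1 [K0 [hd1 hHu]]]] := jH; have [K' [d2 [d20 hrem]]] := pseries_remainder m d0 hF.
(* The coefficients of [u^2] times the truncated power series minus [x u^m (h0 + h1 u + h2 u^2)].
   The factor [u^2] matches [u^(m+1)] against the [u^3] inside the jet for every [m]. The difference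
   is [O(u^(m+3))], so its top coefficient [a m - x h2] is zero. *)
pose b k := (if k is k'.+2 then a k' else 0) - ((if k == m then x * h0 else 0) +
  (if k == m.+1 then x * h1 else 0) + (if k == m.+2 then x * h2 else 0)).
have bE u : poly_eval b m.+2 u = u ^ 2 * poly_eval a m u - x * u ^ m * (h0 + h1 * u + h2 * u ^ 2).
  have -> : x * u ^ m * (h0 + h1 * u + h2 * u ^ 2) =
      x * h0 * u ^ m + x * h1 * u ^ m.+1 + x * h2 * u ^ m.+2 by rewrite /=; ring.
  have [m0 m1] : (m <= m.+2)%N /\ (m.+1 <= m.+2)%N by lia.
  rewrite -(poly_eval_single (x * h0) u m0) -(poly_eval_single (x * h1) u m1).
  rewrite -(poly_eval_single (x * h2) u (leqnn m.+2)).
  have -> : u ^ 2 * poly_eval a m u = poly_eval (fun k => if k is k'.+2 then a k' else 0) m.+2 u.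
    by transitivity (0 + u * (0 + u * poly_eval a m u)); [ring | rewrite !poly_eval_recl].
  rewrite /poly_eval -!plus_sum -minus_sum; apply: PartSum.sum_eq => k _; rewrite /b; ring.
have : b m.+2 = 0.
  apply: (@poly_eval_small b m.+2 (K' + x * K) (Rmin d (Rmin d1 d2))).
    by apply: Rmin_glb_lt => //; apply: Rmin_glb_lt; lra.
  move=> u hu; have l1 := Rmin_l d (Rmin d1 d2); have l2 := Rmin_r d (Rmin d1 d2).
  have l3 := Rmin_l d1 d2; have l4 := Rmin_r d1 d2.
  have {}hrem := hrem u ltac:(lra); have {}hHu := hHu u ltac:(lra).
  set H := _ * / (1 + u) in hHu.
  have FE : u ^ 2 * F u = x * u ^ m * H.
    rewrite /F Rpower_plus Rpower_1 // /Rpower ln_exp /H /=; field; lra.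
  have -> : poly_eval b m.+2 u = x * u ^ m * (H - (h0 + h1 * u + h2 * u ^ 2)) - u ^ 2 * (F u - poly_eval a m u).
    by rewrite bE Rmult_minus_distr_l -FE; ring.
  have um : 0 <= u ^ m by apply: pow_le; lra.
  apply: Rle_trans (Rabs_sub_le _ _) _.
  rewrite (Rabs_mult (x * _)) (Rabs_mult (u ^ 2)) (Rabs_pos_eq (x * _)) ?(Rabs_pos_eq (u ^ 2)); try nra.
  have q1 := Rmult_le_compat_l (x * u ^ m) _ _ ltac:(nra) hHu.
  have q2 := Rmult_le_compat_l (u ^ 2) _ _ ltac:(nra) hrem.
  apply: Rle_trans (Rplus_le_compat _ _ _ _ q1 q2) _; apply: Req_le; rewrite /=; ring.
rewrite /b eqxx (gtn_eqF (_ : m < m.+2)%N) // (gtn_eqF (_ : m.+1 < m.+2)%N) // h2E => hb.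
have am : a m = x * poly_eval p 2 L by rewrite /a -hc.
by apply: (Rmult_eq_reg_l x); lra.
Qed.

End ZetaLink.

(** * Comparison of the main terms *)

Lemma poly_fun_continuous (D : nat) (f : R -> R) (y : R) : poly_fun D f -> continuous f y.
Proof.
elim: D f => [|D IH] f.
  by move=> [a ha]; apply: (continuous_ext (fun=> a)); [move=> t; rewrite ha | exact: continuous_const].
move=> [a [k [hk ha]]]; apply: (continuous_ext (fun t => a + t * k t)); first by move=> t; rewrite ha.
apply: (@continuous_plus R_UniformSpace R_AbsRing R_NormedModule); first exact: continuous_const.
by apply: (@continuous_mult R_UniformSpace R_AbsRing); [exact: continuous_id | exact: IH].
Qed.

(** The condition [0 <= a] covers an infinite greatest lower bound, which [real] sends to 0. *)
Lemma alpha_le (p : nat -> R) (k : nat) (a : R) : 0 <= a -> bigO_pow (Defs.Delta k p) a -> alpha k p <= a.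
Proof.
move=> a0 h; rewrite /alpha; have [hl _] := Glb_Rbar_correct (bigO_pow (Defs.Delta k p)).
by move: (hl a h); case: (Glb_Rbar _) => //= t; lra.
Qed.

(** The polynomial is sampled at [ln x + (j+1) ln V] with [V = T^4 X0]. All these points lie beyond
    [T^4], where the bound [x^(-1/4)] is at most [1/T], and extrapolation carries this back to
    [ln x]. *)
Lemma main_term_close (D : nat) (f : R -> R) (A X0 T : R) : 0 <= A -> 1 <= X0 -> 1 <= T ->
  poly_fun D f ->
  (forall j, (j <= D)%N -> forall x, X0 <= x <= T * (T ^ 4 * X0) ^ j.+1 ->
     Rabs (f (ln x)) <= A * Rpower x (- (1 / 4))) ->
  forall x, 1 <= x <= T -> Rabs (f (ln x)) <= 3 ^ D * (A / T).
Proof.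
move=> A0 hX T1 hf h x hx; set V := T ^ 4 * X0 in h.
have T4 : 1 <= T ^ 4 by apply: pow_R1_Rle.
have V1 : 1 <= V by rewrite /V; nra.
apply: (poly_fun_extrapolate (Y := ln V) hf) => j hj.
have Vj : V <= V ^ j.+1.
  have : 1 <= V ^ j by apply: pow_R1_Rle.
  rewrite /=; nra.
have -> : ln x + INR j.+1 * ln V = ln (x * V ^ j.+1).
  by rewrite ln_mult ?ln_pow //; try lra; apply: pow_lt; lra.
have hxV : V <= x * V ^ j.+1 by nra.
apply: Rle_trans (h j hj _ _) _.
  split; first by rewrite /V in hxV *; nra.
  by apply: Rmult_le_compat_r; lra.
apply: Rmult_le_compat_l => //.
have T4V : T ^ 4 <= x * V ^ j.+1 by apply: Rle_trans hxV; rewrite /V; nra.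
apply: Rle_trans (Rpower_le_neg (t := T ^ 4) _ T4V _) _; try lra.
rewrite -Rpower_natr ?Rpower_mult; last lra.
rewrite (_ : INR 4 * - (1 / 4) = - (1)); first by rewrite Rpower_Ropp Rpower_1; lra.
by rewrite !S_INR INR_0; field.
Qed.

Theorem theorem4 (zeta : C -> C) (p : nat -> R) (r : nat) (d : nat -> R)
  (hzeta : is_riemann_zeta zeta)
  (hp : is_residue_poly zeta 3 p)
  (hr : (2 <= r)%N)
  (hd : is_main_coefs r 3 p d) :
  forall eps : R, 0 < eps ->
    exists K : R, forall T : R, 2 <= T ->
      Rabs (RInt (Delta_multi r 3 d) 1 T)
        <= K * Rpower T (INR r + 1 / 6 + eps).
Proof.
move=> eps eps0.
have [g [CH [CH0 hH]]] := harmonic_asymptotic.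
have [g1 [CK [CK0 hK]]] := log_harmonic_asymptotic.
have h3 := riesz3_asymptotic CH0 CK0 hH hK.
have r2 : 2 <= INR r by rewrite -INR_2; exact: leq_INR.
have hal : alpha 3 p <= 2 / 3.
  apply: alpha_le; first lra.
  have [C [C0 hC]] := @delta3_bound g g1 h3 (1 / 12) ltac:(lra).
  exists (2 * C), 1 => x x1.
  have -> : Defs.Delta 3 p x = delta3 g g1 x.
    rewrite /Defs.Delta /delta3 /dsum /main3 -(residue_poly_mainQ CH0 CK0 hH hK (ln x) hzeta hp) //.
  apply: Rle_trans (hC x ltac:(lra)) _.
  have -> : 7 / 12 + 1 / 12 = 2 / 3 by field.
  have : Rpower x (7 / 12) <= Rpower x (2 / 3) by apply: Rpower_le_exp; lra.
  nra.
(* With [alpha_3 <= 2/3] this gives [Delta_multi = O(x^(r - 1/4))]. The computed remainder has the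
   same bound, since [7/12 + 1/20 < 3/4]; any fixed saving would do for the comparison. *)
have [K0 [X0 hK0]] := hd (1 / 12) ltac:(lra).
pose e := Rmin eps (1 / 20).
have he : 0 < e <= 1 / 20 by split; [apply: Rmin_glb_lt; lra | exact: Rmin_r].
have ee : e <= eps by exact: Rmin_l.
have [K1 [K10 hK1]] := multi_err_bounds h3 hr he.
pose A := Rabs K0 + K1; have A0 : 0 <= A by rewrite /A; have := Rabs_pos K0; lra.
pose D := (r * 2)%N; pose X1 := Rmax X0 1.
have X11 : 1 <= X1 by exact: Rmax_r.
exists (K1 + 3 ^ D * A) => T T2.
pose V := T ^ 4 * X1; have V1 : 1 <= V.
  have : 1 <= T ^ 4 by apply: pow_R1_Rle; lra.
  rewrite /V; nra.
(* The box must contain every sample point used by the extrapolation, not only [[1, T]]; [K1] does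
   not depend on [B]. *)
have [B hB] := INR_unbounded (T * V ^ D.+1).
have [q [hq qE]] := multi_main_poly g g1 r B.
pose f y := q y + -1 * poly_eval d D y.
have hf : poly_fun D f by apply: poly_fun_add => //; apply: poly_fun_scal; exact: poly_fun_eval.
have split_eq x : 0 < x -> Delta_multi r 3 d x - multi_err g g1 r B x = x ^ r * f (ln x).
  by move=> x0; rewrite /Delta_multi /multi_err qE // /Mmain /f -/D /=; ring.
have VD1 : 1 <= V ^ D.+1 by apply: pow_R1_Rle.
have TB : T < INR B + 1 by nra.
have fb : forall x, 1 <= x <= T -> Rabs (f (ln x)) <= 3 ^ D * (A / T).
  apply: (main_term_close (X0 := X1)) => //; first lra.
  move=> j hj x hx; rewrite -/V in hx.
  have VjD : V ^ j.+1 <= V ^ D.+1 by apply: Rle_pow => //; lia.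
  have xB : x < INR B + 1 by nra.
  have x1 : 1 <= x by lra.
  have xX0 : X0 <= x by have := Rmax_l X0 1; rewrite -/X1; lra.
  have b1 := hK0 x xX0; have [b2 _] := hK1 B x x1 xB.
  have xr : 0 < x ^ r by apply: pow_lt; lra.
  have P0 := Rpower_ge0 x (INR r - 1 / 4).
  have b1' : Rabs (Delta_multi r 3 d x) <= Rabs K0 * Rpower x (INR r - 1 / 4).
    apply: Rle_trans b1 _; apply: Rle_trans (Rmult_le_compat_r _ _ _ (Rpower_ge0 _ _) (Rle_abs K0)) _.
    by apply: Rmult_le_compat_l; [exact: Rabs_pos | apply: Rpower_le_exp; lra].
  have b2' : Rabs (multi_err g g1 r B x) <= K1 * Rpower x (INR r - 1 / 4).
    by apply: Rle_trans b2 _; apply: Rmult_le_compat_l => //; apply: Rpower_le_exp; lra.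
  apply: (Rmult_le_reg_l (x ^ r)) => //.
  rewrite -{1}(Rabs_pos_eq (x ^ r)); last lra.
  rewrite -Rabs_mult -split_eq; last lra.
  have -> : x ^ r * (A * Rpower x (- (1 / 4))) = A * Rpower x (INR r - 1 / 4).
    by rewrite /Rminus Rpower_plus Rpower_natr; [ring | lra].
  by apply: Rle_trans (Rabs_sub_le _ _) _; rewrite /A; lra.
have T1 : 1 <= T by lra.
have eq1 : ex_RInt (multi_err g g1 r B) 1 T by apply: ex_RInt_pwc => //; exact: pwc_multi_err.
have eq2 : ex_RInt (fun x => x ^ r * f (ln x)) 1 T.
  apply: ex_RInt_pwc => //; apply: pwc_continuous => t t0.
  apply: (@continuous_mult R_UniformSpace R_AbsRing).
    by apply: ex_derive_continuous; auto_derive.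
  by apply: continuous_comp; [exact: continuous_ln | exact: poly_fun_continuous hf].
have -> : RInt (Delta_multi r 3 d) 1 T = RInt (multi_err g g1 r B) 1 T + RInt (fun x => x ^ r * f (ln x)) 1 T.
  apply: is_RInt_unique.
  apply: is_RInt_ext (is_RInt_plus _ _ _ _ _ _ (RInt_correct _ _ _ eq1) (RInt_correct _ _ _ eq2)) => x.
  by rewrite Rmin_left // => hx; rewrite /plus /= -split_eq; [ring | lra].
apply: Rle_trans (Rabs_triang _ _) _.
have [_ b1] := hK1 B T T1 TB.
have D0 : 0 <= 3 ^ D * A by apply: Rmult_le_pos => //; apply: pow_le; lra.
(* The gain [1/T] is weakened to [1/x], and the integral of the main-term discrepancy is then
   [O(T^r)], below the target power. *)
have b2 : Rabs (RInt (fun x => x ^ r * f (ln x)) 1 T) <= 3 ^ D * A * Rpower T (1 + (INR r - 1)).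
  apply: RInt_abs_le => //; first lra.
  move=> x hx; rewrite Rabs_mult Rabs_pos_eq; last by apply: pow_le; lra.
  have xr : 0 <= x ^ r by apply: pow_le; lra.
  apply: Rle_trans (Rmult_le_compat_l _ _ _ xr (fb x hx)) _.
  have -> : Rpower x (INR r - 1) = x ^ r * / x.
    by rewrite /Rminus Rpower_plus Rpower_natr ?Rpower_Ropp ?Rpower_1; lra.
  have iT : / T <= / x by apply: Rinv_le_contravar; lra.
  have := Rmult_le_compat_l (3 ^ D * A * x ^ r) _ _ ltac:(nra) iT; rewrite /Rdiv; lra.
have p1 : Rpower T (INR r + 1 / 6 + e) <= Rpower T (INR r + 1 / 6 + eps) by apply: Rpower_le_exp; lra.
have p2 : Rpower T (1 + (INR r - 1)) <= Rpower T (INR r + 1 / 6 + eps) by apply: Rpower_le_exp; lra.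
have := Rmult_le_compat_l _ _ _ K10 p1; have := Rmult_le_compat_l _ _ _ D0 p2; lra.
Qed.
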